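(* Let $\Gamma\subset\Gamma_0(q)$ be any congruence subgroup of level $q$. Then one has the bound $\sup(S_2(\Gamma))\ll\log q$, with an absolute implied constant.
   Context: $\Gamma_0(q)\subset\mathrm{SL}_2(\mathbf Z)$ is the subgroup of matrices with lower-left entry divisible by $q$. A congruence subgroup of $\mathrm{SL}_2(\mathbf Z)$ contains some principal congruence subgroup $\Gamma(q)$; its level is the smallest such $q\ge1$. $S_2(\Gamma)$ is the space of holomorphic cusp forms of weight $2$ on $\Gamma$, with inner product $\langle f,g\rangle=\int_{\Gamma\backslash\mathbf H}f(z)\overline{g(z)}y^2\,\frac{dx\,dy}{y^2}$ (not volume normalized). For an orthonormal basis $\mathscr B_2(\Gamma)$ of $S_2(\Gamma)$, $\sup(S_2(\Gamma))=\sup_{z=x+iy\in\mathbf H}\sum_{f\in\mathscr B_2(\Gamma)}y^2|f(z)|^2$. *)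

(* Defs.v *)
From HB Require Import structures.
From mathcomp Require Import all_boot all_order all_algebra.
From mathcomp Require Import complex.
From mathcomp Require Import all_classical all_reals all_analysis.

Set Implicit Arguments.
Unset Strict Implicit.
Unset Printing Implicit Defensive.

Import Order.TTheory GRing.Theory Num.Theory.
Import numFieldNormedType.Exports.

Local Open Scope classical_set_scope.
Local Open Scope complex_scope.
Local Open Scope ring_scope.

Definition SL2Z : set 'M[int]_2 := [set g | \det g = 1].

Definition Gamma0 (q : nat) : set 'M[int]_2 :=
  [set g | SL2Z g /\ (q%:Z %| g 1%R 0%R)%Z].

Definition principal_subgroup (q : nat) : set 'M[int]_2 :=
  [set g | SL2Z g /\ forall i j, (g i j = (1%:M : 'M[int]_2) i j %[mod q%:Z])%Z].

Definition SL2Z_subgroup (G : set 'M[int]_2) : Prop :=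
  [/\ G `<=` SL2Z,
      G 1%:M,
      forall g h, G g -> G h -> G (g *m h)
    & forall g, G g -> G (invmx g)].

Definition congruence_subgroup (G : set 'M[int]_2) : Prop :=
  SL2Z_subgroup G /\ exists2 q : nat, (0 < q)%N & principal_subgroup q `<=` G.

Definition is_level (G : set 'M[int]_2) (q : nat) : Prop :=
  [/\ (0 < q)%N,
      principal_subgroup q `<=` G
    & forall m : nat, (0 < m)%N -> principal_subgroup m `<=` G -> (q <= m)%N].

Section CuspForms.
Variable R : realType.
Implicit Types (z : R[i]) (f : R[i] -> R[i]) (g : 'M[int]_2).

Definition upper_half : set R[i] := [set z | 0 < complex.Im z].

Definition automorphy g z : R[i] := (g 1 0)%:~R * z + (g 1 1)%:~R.

Definition moebius g z : R[i] :=
  ((g 0 0)%:~R * z + (g 0 1)%:~R) / automorphy g z.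

(** Weight 2; the usual factor det(g) is 1 on SL_2(Z). *)
Definition slash2 f g : R[i] -> R[i] :=
  fun z => automorphy g z ^- 2 * f (moebius g z).

(** The casts to [R[i]^o] make the scalars of the difference quotient complex:
    [derivable _ z 1] is complex differentiability at [z]. *)
Definition holomorphic_on_upper_half f : Prop :=
  forall z, upper_half z ->
    derivable (f : R[i]^o -> R[i]^o) z 1.

(** [f z] tends to 0 as [Im z] tends to infinity, uniformly in [Re z] *)
Definition vanishes_at_im_infty f : Prop :=
  forall e : R, 0 < e -> exists A : R,
    forall z, upper_half z -> A <= complex.Im z -> Normc.normc (f z) <= e.

(** The space S_2(G). Only the values on [upper_half] are constrained, and two
    such functions represent the same form when they agree there. Vanishing at
    every cusp is tested by moving each cusp to infinity with SL_2(Z). *)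
Definition cusp_form2 (G : set 'M[int]_2) f : Prop :=
  [/\ holomorphic_on_upper_half f,
      forall g, G g -> forall z, upper_half z -> slash2 f g z = f z
    & forall g, SL2Z g -> vanishes_at_im_infty (slash2 f g)].

(** A measurable system of representatives of G \ H; the point x + iy is the
    pair (x, y). *)
Definition fundamental_domain (G : set 'M[int]_2)
    (D : set (measurableTypeR R * measurableTypeR R)) : Prop :=
  [/\ measurable D,
      forall p, D p -> upper_half (p.1 +i* p.2)
    & forall z, upper_half z ->
        exists! p, D p /\ exists2 g, G g & p.1 +i* p.2 = moebius g z].

Definition hyperbolic_integral
    (D : set (measurableTypeR R * measurableTypeR R)) (h : R[i] -> R[i]) : R[i] :=
  let mu := (@lebesgue_measure R \x @lebesgue_measure R)%E in
  (Rintegral mu D (fun p => complex.Re (h (p.1 +i* p.2)) / p.2 ^+ 2))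
  +i* (Rintegral mu D (fun p => complex.Im (h (p.1 +i* p.2)) / p.2 ^+ 2)).

(** The Petersson product, not normalized by the volume. For [D] a fundamental
    domain of G and [f1], [f2] in S_2(G) the integrand is G-invariant, so this is
    the integral over G \ H and does not depend on [D]. *)
Definition petersson (D : set (measurableTypeR R * measurableTypeR R))
    (f1 f2 : R[i] -> R[i]) : R[i] :=
  hyperbolic_integral D
    (fun z => f1 z * (f2 z)^*%C * ((complex.Im z) ^+ 2)%:C).

Definition orthonormal_basis (G : set 'M[int]_2)
    (D : set (measurableTypeR R * measurableTypeR R))
    (n : nat) (B : 'I_n -> R[i] -> R[i]) : Prop :=
  [/\ forall i, cusp_form2 G (B i),
      forall i j, petersson D (B i) (B j) = (i == j)%:R
    & forall f, cusp_form2 G f -> exists c : 'I_n -> R[i],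
        forall z, upper_half z -> f z = \sum_(i < n) c i * B i z].

Definition sup_S2 (n : nat) (B : 'I_n -> R[i] -> R[i]) : \bar R :=
  ereal_sup [set (\sum_(i < n) (complex.Im z) ^+ 2 * Normc.normc (B i z) ^+ 2)%:E
            | z in upper_half].

End CuspForms.

(* Main.v *)
(** The bound is in fact uniform in [q]. For [q >= 2] this gives [log q] up to the
    factor [1 / log 2]; for [q = 1], where [log q = 0], it needs [S_2(SL_2(Z)) = 0].

    By duality it suffices to bound [y |f(z)|] for one form [f] of norm 1. Moving [z]
    by SL_2(Z), which replaces [G] by a conjugate, one may assume [Im z >= 4/5]; let [w]
    be the width of the cusp at infinity of the conjugate. If [Im z <= 2 w], Cauchy's
    formula bounds [y^2 |f(z)|^2] by the integral of [|f|^2] over a square of side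
    proportional to [y] around [z]. At most 12 elements of the group move a given point
    of this square into the square: their bottom row [(c, d)] has bounded entries up to
    a shift, and it determines the element because the square is narrower than [w].
    Hence unfolding bounds the integral by 12 times the norm of [f]. If [Im z > 2 w],
    Cauchy's formula with a [w]-periodic kernel shows that [f] decays exponentially
    above height [w], which reduces to the first case. For [SL_2(Z)] the same decay
    contracts the supremum of [y |f|], so [f = 0].

    Everything rests on Goursat's lemma, proved by bisection for closed real 1-forms
    which are merely differentiable, and on the invariance of [dx dy / y^2]. *)

Require Import Defs.
From mathcomp Require Import all_boot all_order all_algebra.
From mathcomp Require Import complex.
From mathcomp Require Import all_classical all_reals all_analysis.
From mathcomp Require Import measurable_realfun.
From mathcomp Require Import ring lra zify.
Import Order.TTheory GRing.Theory Num.Theory.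
Import numFieldNormedType.Exports.
Local Open Scope classical_set_scope.
Local Open Scope complex_scope.
Local Open Scope ring_scope.
Set Implicit Arguments.
Unset Strict Implicit.
Unset Printing Implicit Defensive.

(** * Invariance of the hyperbolic measure *)

(** Duality works through the reproducing kernel: for fixed [z], the form [sum_i conj(B_i(z)) B_i]
    has squared norm [S = sum_i |B_i(z)|^2] and value [S] at [z]. So [y^2 |f(z)|^2 <= K |f|^2] for
    single forms yields [y^2 S <= K] with the same [K], whatever the dimension. A square with side
    proportional to its height has bounded hyperbolic size, which keeps the number of overlaps
    absolute; only translations along a cusp could spoil this, hence the ceiling [2 w], below which
    the side [y / 4] is at most [w / 2]. Holomorphy is pointwise complex differentiability, without
    continuity of the derivative, so Green's theorem does not apply and Goursat's bisection is
    needed. Complex contour integrals are never formed: multiplying [f] by the conjugate of its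
    value at the centre makes the quantity sought real, and real circulations suffice. Similarly,
    the invariance of the measure is built from Tonelli's theorem and substitutions in one real
    variable, so no Jacobian occurs. *)

Section LineIntegrals.
Context {R : realType}.
Local Notation mR := (measurableTypeR R).
Local Notation mu := (@lebesgue_measure R).
Implicit Types f : mR -> \bar R.
Local Open Scope ereal_scope.

(** A measure that gives every half-open interval its length is Lebesgue measure. The pushforward
    under a translation does so, and for [integral_scale] the rescaled pushforward under a dilation
    does. *)
Lemma integral_shift (b : R) f : measurable_fun [set: mR] f -> (forall x, 0 <= f x) ->
  \int[mu]_x f (x + b)%R = \int[mu]_x f x.
Proof.
move=> mf f0.
have mphi : measurable_fun setT ((fun x => x + b)%R : mR -> mR).
  exact: measurable_funD.
rewrite -[LHS](ge0_integral_pushforward mphi mu measurableT)//.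
apply: eq_measure_integral => A mA _.
apply/esym; apply: (lebesgue_measure_unique
  (mu := pushforward mu ((fun x => x + b)%R : mR -> mR))) => // _ [[c d]] _ <-.
transitivity (mu `](c - b)%R, (d - b)%R]%classic); last first.
  congr (mu _).
  by apply/seteqP; split => x /=; rewrite !in_itv/= ltrBlDr lerBrDr.
rewrite !lebesgue_measure_itv/= !lte_fin ltrD2r; case: ifP => // _.
by rewrite -!EFinB; congr (_%:E); ring.
Qed.

Lemma integral_scale (a : R) f : (0 < a)%R ->
  measurable_fun [set: mR] f -> (forall x, 0 <= f x) ->
  a%:E * \int[mu]_x f (a * x)%R = \int[mu]_x f x.
Proof.
move=> a0 mf f0.
have mphi : measurable_fun setT ((fun x => a * x)%R : mR -> mR).
  exact: measurable_funM.
pose ann : {nonneg R} := NngNum (ltW a0).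
rewrite -[X in _ * X](ge0_integral_pushforward mphi mu measurableT)//.
rewrite -(ge0_integral_mscale _ measurableT ann)//.
apply: eq_measure_integral => A mA _.
apply/esym; apply: (lebesgue_measure_unique
  (mu := mscale ann (pushforward mu ((fun x => a * x)%R : mR -> mR)))) => // _ [[c d]] _ <-.
transitivity (a%:E * mu `](c / a)%R, (d / a)%R]%classic); last first.
  congr (_ * mu _).
  by apply/seteqP; split => x /=; rewrite !in_itv/= ltr_pdivrMr// ler_pdivlMr// ![(x * a)%R]mulrC.
rewrite !lebesgue_measure_itv/= !lte_fin ltr_pM2r ?invr_gt0//; case: ifP => // _.
  by rewrite -EFinB -EFinM; congr (_%:E); field; rewrite gt_eqF.
by rewrite mule0.
Qed.

Lemma integral_opp f : measurable_fun [set: mR] f -> (forall x, 0 <= f x) ->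
  \int[mu]_x f (- x)%R = \int[mu]_x f x.
Proof.
move=> mf f0.
have mphi : measurable_fun setT (-%R : mR -> mR) by exact: oppr_measurable.
rewrite -[LHS](ge0_integral_pushforward mphi mu measurableT)//.
by apply: eq_measure_integral => A mA _; exact: lebesgue_measureN.
Qed.

(** Inversion is continuous only off 0, so the line is split into the point 0 and its open
    complement. *)
Lemma measurable_invr : measurable_fun setT (@GRing.inv R : mR -> mR).
Proof.
rewrite -(setUv [set 0%R]); apply/measurable_funU => //.
  exact: measurableC.
split; first exact: measurable_fun_set1.
apply: open_continuous_measurable_fun; last first.
  by move=> x /[!inE]/= x0; apply: inv_continuous; apply/eqP.
by apply: closed_openC; exact/accessible_closed_set1/hausdorff_accessible/Rhausdorff.
Qed.


(** Being 0 for [y <= 0], this weight confines integrals over the whole line or plane to [y > 0], so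
    that no domain of integration has to be carried along. *)
Definition posinv (y : mR) : R := if (0 < y)%R then (y^-1)%R else 0%R.

Lemma posinv_ge0 y : (0 <= posinv y)%R.
Proof. by rewrite /posinv; case: ifPn => // y0; rewrite invr_ge0 ltW. Qed.

Lemma posinv_eq y : (0 < y)%R -> posinv y = (y^-1)%R.
Proof. by rewrite /posinv => ->. Qed.

Lemma posinvM a y : (0 < a)%R -> posinv (a * y)%R = (a^-1 * posinv y)%R.
Proof.
move=> a0; rewrite /posinv pmulr_rgt0//; case: ifP => _; last by rewrite mulr0.
by rewrite invfM.
Qed.

Lemma measurable_posinv : measurable_fun [set: mR] posinv.
Proof.
apply: measurable_fun_ifT => //; last exact: measurable_invr.
exact: measurable_fun_ltr.
Qed.

Let chi (t : mR) : R := \1_(`]1%R, 2%R[%classic : set mR) t.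

Let chi_ge0 t : (0 <= chi t)%R. Proof. by []. Qed.

Let mchi : measurable_fun [set: mR] chi. Proof. exact: measurable_indic. Qed.

Let int_chi : \int[mu]_t (chi t)%:E = 1.
Proof.
rewrite integral_indic// setIT.
by rewrite [LHS]lebesgue_measure_itv/= lte_fin ltr1n -EFinB; congr (_%:E); ring.
Qed.

(** The substitution [t = u * y] in the integral of [chi], which is 1. *)
Let posinv_chi y k : 0 <= k ->
  (posinv y)%:E * k = \int[mu]_u ((if (0 < y)%R then chi (u * y)%R else 0)%:E * k).
Proof.
move=> k0; rewrite ge0_integralZr//=; last 2 first.
- apply/measurable_EFinP; apply: measurable_fun_ifT => //.
  by apply: measurableT_comp => //; apply: measurable_funM.
- by move=> u _; rewrite lee_fin; case: ifP.
congr (_ * _); rewrite /posinv; case: (boolP (0 < y)%R) => [y0|_]; last by rewrite integral0.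
rewrite -[RHS]mul1e -(@mulVf _ y) ?gt_eqF// EFinM -muleA.
under eq_integral do rewrite mulrC.
rewrite (integral_scale (f := EFin \o chi) y0)//; last exact/measurable_EFinP.
by rewrite int_chi mule1.
Qed.

(** The weight [1/y = |{u : 1 < u y < 2}|] is symmetric under exchanging [u]
    and [y] up to scaling, so that inverting [y] only takes Tonelli's theorem and
    linear substitutions. *)
Lemma integral_inv (k : mR -> \bar R) :
  measurable_fun [set: mR] k -> (forall x, 0 <= k x) ->
  \int[mu]_y ((posinv y)%:E * k (y^-1)%R) = \int[mu]_y ((posinv y)%:E * k y).
Proof.
move=> mk k0; apply/esym.
under eq_integral do rewrite posinv_chi//.
rewrite (fubini_tonelli (fun p : mR * mR =>
  (if (0 < p.1)%R then chi (p.2 * p.1)%R else 0)%:E * k p.1)); last 2 first.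
- apply: emeasurable_funM; last exact: measurableT_comp.
  apply/measurable_EFinP; apply: measurable_fun_ifT => //=.
    by apply: measurable_fun_ltr.
  by apply: measurableT_comp => //; apply: measurable_funM.
- by move=> p; apply: mule_ge0 => //; rewrite lee_fin; case: ifP.
(* For fixed [u > 0] this is the substitution [t = u * y]; for [u <= 0] both sides vanish because
   [chi] lives on []1, 2[]. *)
transitivity (\int[mu]_u \int[mu]_t ((posinv u)%:E * ((chi t)%:E * k (t * u^-1)%R))).
  apply: eq_integral => u _ /=; rewrite /posinv; case: ifPn => [u0|].
    rewrite ge0_integralZl//=; last 3 first.
    - apply: emeasurable_funM; first exact/measurable_EFinP.
      by apply: measurableT_comp => //; apply: measurable_funM.
    - by move=> t _; apply: mule_ge0; rewrite // lee_fin.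
    - by rewrite lee_fin invr_ge0 ltW.
    under [in RHS]eq_integral do rewrite mulrC.
    rewrite -(integral_scale (a := u^-1) (f := fun y =>
       (if (0 < y)%R then chi (u * y)%R else 0)%:E * k y)) ?invr_gt0//; last 2 first.
    - apply: emeasurable_funM => //.
      apply/measurable_EFinP; apply: measurable_fun_ifT => //=.
        by apply: measurable_fun_ltr.
      by apply: measurableT_comp => //; apply: measurable_funM.
    - by move=> p; apply: mule_ge0 => //; rewrite lee_fin; case: ifP.
    congr (_ * _); apply: eq_integral => t _.
    rewrite pmulr_rgt0 ?invr_gt0// mulVKf ?gt_eqF//; case: ifPn => //.
    rewrite -leNgt => t0; congr (_%:E * _).
    by rewrite /chi indicE memNset//= in_itv/=; lra.
  rewrite -leNgt => u0.
  under [RHS]eq_integral do rewrite mul0e.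
  rewrite integral0 integral0_eq// => t _; case: ifPn => t0; last by rewrite mul0e.
  rewrite /chi indicE memNset ?mul0e//= in_itv/=; nra.
rewrite (fubini_tonelli (fun p : mR * mR =>
  (posinv p.1)%:E * ((chi p.2)%:E * k (p.2 * p.1^-1)%R))); last 2 first.
- apply: emeasurable_funM.
    apply/measurable_EFinP; apply: measurableT_comp => //; exact: measurable_posinv.
  apply: emeasurable_funM.
    by apply/measurable_EFinP; apply: measurableT_comp => //.
  apply: measurableT_comp => //; apply: measurable_funM => //.
  by apply: measurableT_comp => //; exact: measurable_invr.
- by move=> p; rewrite !mule_ge0// lee_fin ?posinv_ge0.
set I := RHS.
(* For fixed [t > 0] the measure [du / u] is unchanged by [u |-> t * u], which turns [k (t / u)]
   into [k (1 / u)]. *)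
transitivity (\int[mu]_t ((chi t)%:E * I)).
  apply: eq_integral => t _ /=.
  under eq_integral do rewrite muleCA.
  rewrite ge0_integralZl//=; last 3 first.
  - apply: emeasurable_funM; first by apply/measurable_EFinP; exact: measurable_posinv.
    apply: measurableT_comp => //; apply: measurable_funM => //.
    exact: measurable_invr.
  - by move=> u _; rewrite mule_ge0// lee_fin posinv_ge0.
  - by rewrite lee_fin.
  rewrite {1 2}/chi indicE; have [|] := boolP (t \in _); last by rewrite !mul0e.
  rewrite inE/= in_itv/= => /andP[t1 _].
  have t0 : (0 < t)%R by lra.
  congr (_ * _).
  rewrite -(integral_scale (f := fun u => (posinv u)%:E * k (t * u^-1)%R) t0)//; last 2 first.
  - apply: emeasurable_funM; first by apply/measurable_EFinP; exact: measurable_posinv.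
    apply: measurableT_comp => //; apply: measurable_funM => //.
    exact: measurable_invr.
  - by move=> u; rewrite mule_ge0// lee_fin posinv_ge0.
  rewrite -ge0_integralZl//=; last 3 first.
  - apply: emeasurable_funM.
      apply/measurable_EFinP; apply: measurableT_comp; first exact: measurable_posinv.
      exact: measurable_funM.
    apply: measurableT_comp => //; apply: measurable_funM => //.
    apply: measurableT_comp; first exact: measurable_invr.
    exact: measurable_funM.
  - by move=> u _; rewrite mule_ge0// lee_fin posinv_ge0.
  - by rewrite lee_fin ltW.
  apply: eq_integral => u _; rewrite muleA posinvM// -EFinM mulVKf ?gt_eqF//.
  by rewrite invfM mulVKf ?gt_eqF.
rewrite ge0_integralZr//=.
- by rewrite int_chi mul1e.
- exact/measurable_EFinP.
- by move=> t _; rewrite lee_fin.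
- by apply: integral_ge0 => y _; rewrite mule_ge0// lee_fin posinv_ge0.
Qed.

End LineIntegrals.

(** * The measure dx dy / y^2 under fractional linear maps *)

Section HyperbolicMeasure.
Context {R : realType}.
Local Notation mR := (measurableTypeR R).
Local Notation mu := (@lebesgue_measure R).
Implicit Types (h : mR * mR -> \bar R).
Local Open Scope ereal_scope.

Definition hyp_int h := \int[(mu \x mu)%E]_p ((posinv p.2 ^+ 2)%:E * h p).

Let mposinv := @measurable_posinv R.

Let mw : measurable_fun [set: mR] (fun y : mR => posinv y ^+ 2)%R.
Proof. exact: measurable_funX. Qed.

Lemma hyp_int_iter h : measurable_fun [set: mR * mR] h -> (forall p, 0 <= h p) ->
  hyp_int h = \int[mu]_y ((posinv y ^+ 2)%:E * \int[mu]_x h (x, y)).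
Proof.
move=> mh h0; rewrite /hyp_int fubini_tonelli2/=; last 2 first.
- apply: emeasurable_funM => //; apply/measurable_EFinP.
  by apply: (measurableT_comp mw).
- by move=> p /=; rewrite mule_ge0// lee_fin sqr_ge0.
apply: eq_integral => y _; rewrite /fubini_G/= ge0_integralZl//=.
- by apply: measurableT_comp => //.
- by rewrite lee_fin sqr_ge0.
Qed.

(** [dx] and [dy] contribute one factor [a] each, and the weight [1 / y ^ 2] absorbs both. *)
Lemma hyp_int_affine (a b : R) h : (0 < a)%R ->
  measurable_fun [set: mR * mR] h -> (forall p, 0 <= h p) ->
  hyp_int (fun p => h (a * p.1 + b, a * p.2)%R) = hyp_int h.
Proof.
move=> a0 mh h0.
have mha : measurable_fun [set: mR * mR]
    (fun p : mR * mR => h (a * p.1 + b, a * p.2)%R).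
  apply: (measurableT_comp mh); apply: measurable_fun_pair.
    by apply: measurable_funD => //; apply: measurable_funM.
  by apply: measurable_funM.
apply: etrans (hyp_int_iter mha (fun p => h0 _)) (etrans _ (esym (hyp_int_iter mh h0))).
set H := fun y => \int[mu]_x h (x, y).
have mH : measurable_fun [set: mR] H.
  exact: (measurable_fun_fubini_tonelli_G _ mh h0).
have H0 y : 0 <= H y by exact: integral_ge0.
transitivity (\int[mu]_y (a%:E * ((posinv (a * y) ^+ 2)%:E * H (a * y)%R))).
  apply: eq_integral => y _ /=.
  have mhy : measurable_fun [set: mR] (fun x : mR => h (x, a * y)%R).
    by apply: measurableT_comp.
  rewrite -(integral_scale (a := a^-1) (f := fun x => h (a * x + b, a * y)%R)) ?invr_gt0//; last first.
    by apply: (measurableT_comp mhy); apply: measurable_funD => //; apply: measurable_funM.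
  under eq_integral do rewrite mulVKf ?gt_eqF//.
  rewrite (integral_shift b (f := fun x => h (x, a * y)%R))//.
  rewrite !muleA posinvM// -!EFinM; congr (_%:E * _).
  by field; rewrite gt_eqF.
rewrite ge0_integralZl//=.
- rewrite (integral_scale (f := fun y => (posinv y ^+ 2)%:E * H y))//.
    by apply: emeasurable_funM => //; apply/measurable_EFinP.
  by move=> y; rewrite mule_ge0// lee_fin sqr_ge0.
- apply: emeasurable_funM.
    apply/measurable_EFinP; apply: (measurableT_comp mw); exact: measurable_funM.
  by apply: (measurableT_comp mH); exact: measurable_funM.
- by move=> y _; rewrite mule_ge0// lee_fin sqr_ge0.
- by rewrite lee_fin ltW.
Qed.

(** At fixed [y], putting [x = t * y] turns [dx dy / y ^ 2] into [dt dy / y], whose second factor is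
    the measure of [integral_inv]. *)
Let hyp_int_polar h : measurable_fun [set: mR * mR] h -> (forall p, 0 <= h p) ->
  hyp_int h = \int[mu]_t \int[mu]_y ((posinv y)%:E * h (t * y, y)%R).
Proof.
move=> mh h0.
rewrite (fubini_tonelli (fun p : mR * mR => (posinv p.2)%:E * h (p.1 * p.2, p.2)%R)); last 2 first.
- apply: emeasurable_funM.
    by apply/measurable_EFinP; apply: (measurableT_comp mposinv).
  apply: (measurableT_comp mh); apply: measurable_fun_pair => //.
  exact: measurable_funM.
- by move=> p /=; rewrite mule_ge0// lee_fin posinv_ge0.
rewrite hyp_int_iter//; apply: eq_integral => y _ /=.
have mhy : measurable_fun [set: mR] (fun x : mR => h (x, y)).
  by apply: measurableT_comp.
rewrite ge0_integralZl//=; last 2 first.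
- by apply: (measurableT_comp mhy); apply: measurable_funM.
- by rewrite lee_fin posinv_ge0.
have [y0|y0] := ltP 0%R y; last by rewrite /posinv ltNge y0/= expr0n/= !mul0e.
under [in RHS]eq_integral do rewrite mulrC.
rewrite -(integral_scale (f := fun x => h (x, y)) y0)// muleA -EFinM.
by congr (_%:E * _); rewrite posinv_eq//; field; rewrite gt_eqF.
Qed.

Let polarE (s c y : R) : (c != 0)%R -> (y != 0)%R ->
  (s * y / (c * y ^+ 2) = s * (c^-1 * y^-1))%R.
Proof. by move=> c0 y0; field; rewrite c0 y0. Qed.

(** In the coordinates [t = x / y] and [y] the inversion [z |-> - 1 / z] is
    [(t, y) |-> (- t, 1 / (y (1 + t ^ 2)))]. *)
Lemma hyp_int_inversion h :
  measurable_fun [set: mR * mR] h -> (forall p, 0 <= h p) ->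
  hyp_int (fun p : mR * mR => h (- p.1 / (p.1 ^+ 2 + p.2 ^+ 2), p.2 / (p.1 ^+ 2 + p.2 ^+ 2))%R)
  = hyp_int h.
Proof.
move=> mh h0.
have mN : measurable_fun [set: mR * mR]
    (fun p : mR * mR => (p.1 ^+ 2 + p.2 ^+ 2)^-1 : mR)%R.
  apply: (measurableT_comp (@measurable_invr R)).
  by apply: measurable_funD; apply: measurable_funX.
have mhS : measurable_fun [set: mR * mR] (fun p : mR * mR =>
    h (- p.1 / (p.1 ^+ 2 + p.2 ^+ 2), p.2 / (p.1 ^+ 2 + p.2 ^+ 2))%R).
  apply: (measurableT_comp mh); apply: measurable_fun_pair.
    by apply: measurable_funM => //; exact: measurableT_comp.
  exact: measurable_funM.
apply: etrans (hyp_int_polar mhS (fun p => h0 _)) (etrans _ (esym (hyp_int_polar mh h0))).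
have mht t : measurable_fun [set: mR] (fun y : mR => h (t * y, y)%R).
  by apply: (measurableT_comp mh); apply: measurable_fun_pair => //.
transitivity (\int[mu]_t \int[mu]_y ((posinv y)%:E * h (- t * y, y)%R)); last first.
  rewrite (integral_opp (f := fun t => \int[mu]_y ((posinv y)%:E * h (t * y, y)%R)))//.
    apply: (measurable_fun_fubini_tonelli_F
      (fun p : mR * mR => (posinv p.2)%:E * h (p.1 * p.2, p.2)%R)).
      apply: emeasurable_funM.
        by apply/measurable_EFinP; apply: (measurableT_comp mposinv).
      apply: (measurableT_comp mh); apply: measurable_fun_pair => //.
      exact: measurable_funM.
    by move=> p /=; rewrite mule_ge0// lee_fin posinv_ge0.
  by move=> t; apply: integral_ge0 => y _; rewrite mule_ge0// lee_fin posinv_ge0.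
apply: eq_integral => t _.
have c0 : (0 < 1 + t ^+ 2)%R by rewrite ltr_pwDl// sqr_ge0.
set c := (1 + t ^+ 2)%R in c0 *.
transitivity (\int[mu]_y ((posinv y)%:E * h (- t * (c^-1 * y^-1), c^-1 * y^-1)%R)).
  apply: eq_integral => y _; have [y0|y0] := ltP 0%R y; last first.
    by rewrite /posinv ltNge y0/= !mul0e.
  have N0 : ((t * y) ^+ 2 + y ^+ 2 = c * y ^+ 2)%R by rewrite /c; ring.
  congr (_ * h (_, _)); rewrite /= N0.
  + by rewrite -mulNr; apply: polarE; rewrite gt_eqF.
  + by rewrite -[X in (X / _)%R = _]mul1r -[RHS]mul1r polarE ?gt_eqF.
(* Inversion of [y], followed by the dilation by [1 / c]; both preserve [dy / y]. *)
rewrite (integral_inv (k := fun y => h (- t * (c^-1 * y), c^-1 * y)%R))//; last first.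
  by apply: (measurableT_comp (mht (- t)%R)); exact: measurable_funM.
have c'0 : (0 < c^-1)%R by rewrite invr_gt0.
rewrite -(integral_scale (f := fun y => (posinv y)%:E * h (- t * y, y)%R) c'0); last 2 first.
- by apply: emeasurable_funM => //; exact/measurable_EFinP.
- by move=> y; rewrite mule_ge0// lee_fin posinv_ge0.
rewrite -ge0_integralZl//=.
- apply: eq_integral => y _; rewrite muleA -EFinM posinvM// invrK.
  by rewrite mulKf// gt_eqF.
- apply: emeasurable_funM.
    by apply/measurable_EFinP; apply: (measurableT_comp mposinv); exact: measurable_funM.
  by apply: (measurableT_comp (mht (- t)%R)); exact: measurable_funM.
- by move=> y _; rewrite mule_ge0// lee_fin posinv_ge0.
- by rewrite lee_fin ltW.
Qed.

(** Real coordinates of [(a z + b) / (c z + d)], obtained by multiplying with the conjugate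
    denominator. The factor [a d - b c] of the imaginary part is taken to be 1, so this is the
    Moebius action only for determinant 1. *)
Definition real_moebius (a b c d : R) (p : mR * mR) : mR * mR :=
  let N := ((c * p.1 + d) ^+ 2 + (c * p.2) ^+ 2)%R in
  ((a * c * (p.1 ^+ 2 + p.2 ^+ 2) + (a * d + b * c) * p.1 + b * d) / N, p.2 / N)%R.

Lemma measurable_real_moebius a b c d :
  measurable_fun [set: mR * mR] (real_moebius a b c d).
Proof.
have mN : measurable_fun [set: mR * mR]
    (fun p : mR * mR => ((c * p.1 + d) ^+ 2 + (c * p.2) ^+ 2)^-1 : mR)%R.
  apply: (measurableT_comp (@measurable_invr R)).
  apply: measurable_funD; apply: measurable_funX; last exact: measurable_funM.
  by apply: measurable_funD => //; exact: measurable_funM.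
apply: measurable_fun_pair; apply: measurable_funM => //.
apply: measurable_funD => //; apply: measurable_funD; apply: measurable_funM => //.
by apply: measurable_funD; exact: measurable_funX.
Qed.

Lemma eq_hyp_int h1 h2 :
  (forall p : mR * mR, (0 < p.2)%R -> h1 p = h2 p) -> hyp_int h1 = hyp_int h2.
Proof.
move=> h12; apply: eq_integral => p _; have [y0|y0] := ltP 0%R p.2.
  by rewrite h12.
by rewrite /posinv ltNge y0/= expr0n/= !mul0e.
Qed.

(** Bruhat decomposition: for [c <> 0] the map is [a / c - 1 / (c ^ 2 z + c d)], an affine map, then
    the inversion, then a translation; for [c = 0] it is [z / d ^ 2 + b / d]. *)
Lemma hyp_int_moebius (a b c d : R) h : (a * d - b * c = 1)%R ->
  measurable_fun [set: mR * mR] h -> (forall p, 0 <= h p) ->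
  hyp_int (h \o real_moebius a b c d) = hyp_int h.
Proof.
move=> det1 mh h0.
have [c0|c0] := eqVneq c 0%R.
  have d0 : (d != 0)%R by apply/eqP => d0; move: det1; rewrite c0 d0; lra.
  rewrite -[RHS](@hyp_int_affine (d ^- 2) (b / d))//; last first.
    by rewrite invr_gt0 exprn_even_gt0.
  apply: eq_hyp_int => -[x y] _ /=; rewrite /real_moebius/= c0.
  have ad : (a = d^-1)%R by apply: (mulIf d0); rewrite mulVf//; move: det1; rewrite c0; lra.
  by congr (h (_, _)); rewrite ?ad; field.
pose h1 := fun p : mR * mR => h (1 * p.1 + a / c, 1 * p.2)%R.
have mh1 : measurable_fun [set: mR * mR] h1.
  apply: (measurableT_comp mh); apply: measurable_fun_pair.
    by apply: measurable_funD => //; exact: measurable_funM.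
  exact: measurable_funM.
pose h2 := fun p : mR * mR => h1 (- p.1 / (p.1 ^+ 2 + p.2 ^+ 2), p.2 / (p.1 ^+ 2 + p.2 ^+ 2))%R.
have mh2 : measurable_fun [set: mR * mR] h2.
  have mN : measurable_fun [set: mR * mR]
      (fun p : mR * mR => (p.1 ^+ 2 + p.2 ^+ 2)^-1 : mR)%R.
    apply: (measurableT_comp (@measurable_invr R)).
    by apply: measurable_funD; apply: measurable_funX.
  apply: (measurableT_comp mh1); apply: measurable_fun_pair.
    by apply: measurable_funM => //; exact: measurableT_comp.
  exact: measurable_funM.
rewrite -(hyp_int_affine (a / c) ltr01 mh h0) -(hyp_int_inversion mh1) -?/h2; last by move=> p; exact: h0.
rewrite -[RHS](@hyp_int_affine (c ^+ 2) (c * d))//; last 2 first.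
- by rewrite exprn_even_gt0.
- by move=> p; exact: h0.
apply: eq_hyp_int => -[x y] /= y0; rewrite /real_moebius/= /h2 /h1/=.
have N0 : ((c * x + d) ^+ 2 + (c * y) ^+ 2 != 0)%R.
  by rewrite gt_eqF// ltr_wpDl ?sqr_ge0// exprn_even_gt0//= mulf_neq0// gt_eqF.
have N1 : ((c ^+ 2 * x + c * d) ^+ 2 + (c ^+ 2 * y) ^+ 2 != 0)%R.
  rewrite (_ : _ + _ = c ^+ 2 * ((c * x + d) ^+ 2 + (c * y) ^+ 2))%R; last by ring.
  by rewrite mulf_neq0// expf_neq0.
have b_eq : (b = (a * d - 1) / c)%R by rewrite -det1; field.
by congr (h (_, _)); rewrite ?b_eq; field; rewrite ?c0 ?N0 ?N1.
Qed.

End HyperbolicMeasure.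

(** * Goursat's lemma *)

Section Goursat.
Context {R : realType}.
Local Notation mu := (@lebesgue_measure R).
Implicit Types (f g : R -> R) (a b c d x y : R).

Definition linint f a b : R := \int[mu]_(x in `[a, b]) f x.

(** Continuity is two-sided even at the end points, which is what differentiability at a point of
    the plane provides. *)
Definition cont_seg f a b := forall x, a <= x <= b -> {for x, continuous f}.

Lemma cont_segB f g a b : cont_seg f a b -> cont_seg g a b ->
  cont_seg (fun x => f x - g x) a b.
Proof. by move=> cf cg x xab; apply: continuousB; [exact: cf|exact: cg]. Qed.

Lemma cont_seg_integrable f a b : cont_seg f a b ->
  mu.-integrable `[a, b] (EFin \o f).
Proof.
move=> cf; apply: continuous_compact_integrable; first exact: segment_compact.
apply: continuous_in_subspaceT => x; rewrite inE/= in_itv/=; exact: cf.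
Qed.

Lemma linint_split f a m b : a <= m -> m <= b -> cont_seg f a b ->
  linint f a b = linint f a m + linint f m b.
Proof.
move=> am mb cf; have if_ := cont_seg_integrable cf.
rewrite /linint -(@Rintegral_itv_obnd_cbnd _ m); last first.
  by apply: integrableS if_ => //; apply: subset_itv; rewrite bnd_simp.
by rewrite -(@Rintegral_itvB _ f (BLeft a) (BRight b) m)// addrC subrK.
Qed.

Lemma linintB f g a b : cont_seg f a b -> cont_seg g a b ->
  linint (fun x => f x - g x) a b = linint f a b - linint g a b.
Proof. by move=> cf cg; apply: RintegralB => //; exact: cont_seg_integrable. Qed.

Lemma linintD f g a b : cont_seg f a b -> cont_seg g a b ->
  linint (fun x => f x + g x) a b = linint f a b + linint g a b.
Proof. by move=> cf cg; apply: RintegralD => //; exact: cont_seg_integrable. Qed.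

Lemma linintZ k f a b : cont_seg f a b ->
  linint (fun x => k * f x) a b = k * linint f a b.
Proof. by move=> cf; apply: RintegralZl => //; exact: cont_seg_integrable. Qed.

Lemma linint_cst k a b : a <= b -> linint (fun=> k) a b = k * (b - a).
Proof.
move=> ab; rewrite /linint Rintegral_cst//; congr (_ * _).
rewrite [X in fine X](lebesgue_measure_itv `[a, b])/= lte_fin.
by case: ltgtP ab => //= -> _; rewrite subrr.
Qed.

Lemma cont_seg_cst k a b : cont_seg (fun=> k) a b.
Proof. by move=> x _; exact: cst_continuous. Qed.

Lemma linint_le f g a b : a <= b -> cont_seg f a b -> cont_seg g a b ->
  (forall x, a <= x <= b -> f x <= g x) -> linint f a b <= linint g a b.
Proof.
by move=> ab cf cg fg; apply: le_Rintegral => //; exact: cont_seg_integrable.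
Qed.

Lemma linint_bound f a b M : a <= b -> cont_seg f a b ->
  (forall x, a <= x <= b -> `|f x| <= M) -> `|linint f a b| <= M * (b - a).
Proof.
move=> ab cf fM; rewrite ler_norml -mulNr -!linint_cst//.
have fM' x : a <= x <= b -> - M <= f x /\ f x <= M.
  by move=> /fM; rewrite ler_norml => /andP[].
by apply/andP; split; apply: linint_le => //; try exact: cont_seg_cst;
  move=> x /fM' [].
Qed.

Lemma eq_linint f g a b : (forall x, a <= x <= b -> f x = g x) ->
  linint f a b = linint g a b.
Proof. by move=> fg; apply: eq_Rintegral => x; rewrite inE/= in_itv/=; exact: fg. Qed.

(** The circulation of [P dx + Q dy] around the boundary, counterclockwise, with opposite sides
    paired under one integral. *)
Definition rect_int (P Q : R -> R -> R) a b c d : R :=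
  linint (fun x => P x c - P x d) a b + linint (fun y => Q b y - Q a y) c d.

(** [P dx + Q dy] is differentiable at [(x, y)], and closed there. *)
Definition closed_form_at (P Q : R -> R -> R) x y := exists A B E : R,
  forall e, 0 < e -> exists2 dl, 0 < dl & forall x' y',
    `|x' - x| < dl -> `|y' - y| < dl ->
    `|P x' y' - P x y - A * (x' - x) - B * (y' - y)|
       <= e * (`|x' - x| + `|y' - y|) /\
    `|Q x' y' - Q x y - B * (x' - x) - E * (y' - y)|
       <= e * (`|x' - x| + `|y' - y|).

Let diff1_continuous f x A :
  (forall e, 0 < e -> exists2 dl, 0 < dl & forall x',
    `|x' - x| < dl -> `|f x' - f x - A * (x' - x)| <= e * `|x' - x|) ->
  {for x, continuous f}.
Proof.
move=> df; apply/cvgrPdist_le => e e0.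
have [dl dl0 H] := df 1 ltr01.
have K0 : 0 < 1 + `|A| by rewrite ltr_pwDl.
have nearx e' : 0 < e' -> \forall t \near x, `|t - x| < e'.
  move=> e'0; apply/nbhs_ballP; exists e' => //= t.
  by rewrite /ball/= distrC.
near=> t.
have tx : `|t - x| < dl by near: t; exact: nearx.
have te : `|t - x| < e / (1 + `|A|) by near: t; apply: nearx; rewrite divr_gt0.
rewrite distrC (_ : f t - f x = (f t - f x - A * (t - x)) + A * (t - x)); last by ring.
rewrite (le_trans (ler_normD _ _))// normrM.
have := H _ tx; rewrite mul1r => {}H.
rewrite (le_trans (lerD H (lexx _)))// -[X in X + _]mul1r -mulrDl mulrC.
by rewrite -ler_pdivlMr// ltW.
Unshelve. all: by end_near. Qed.

Section continuity.
Variables (P Q : R -> R -> R).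

Lemma closed_form_contP1 x y : closed_form_at P Q x y ->
  {for x, continuous (fun x => P x y)}.
Proof.
move=> [A [B [E H]]]; apply: (@diff1_continuous _ _ A) => e /H[dl dl0 {}H].
exists dl => // x' xx'; have yy : `|y - y| < dl by rewrite subrr normr0.
have [+ _] := H x' y xx' yy.
by rewrite subrr mulr0 subr0 normr0 addr0.
Qed.

Lemma closed_form_contQ2 x y : closed_form_at P Q x y ->
  {for y, continuous (Q x)}.
Proof.
move=> [A [B [E H]]]; apply: (@diff1_continuous _ _ E) => e /H[dl dl0 {}H].
exists dl => // y' yy'; have xx : `|x - x| < dl by rewrite subrr normr0.
have [_] := H x y' xx yy'.
by rewrite subrr mulr0 subr0 normr0 add0r.
Qed.

Definition closed_hseg y a b := forall x, a <= x <= b -> closed_form_at P Q x y.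
Definition closed_vseg x c d := forall y, c <= y <= d -> closed_form_at P Q x y.

Lemma closed_hseg_cont y a b : closed_hseg y a b -> cont_seg (fun x => P x y) a b.
Proof. by move=> H x xab; apply: closed_form_contP1; exact: H. Qed.

Lemma closed_vseg_cont x c d : closed_vseg x c d -> cont_seg (Q x) c d.
Proof. by move=> H y ycd; apply: closed_form_contQ2; exact: H. Qed.

Lemma rect_int_vsplit a m b c d : a <= m -> m <= b ->
  closed_hseg c a b -> closed_hseg d a b ->
  closed_vseg a c d -> closed_vseg m c d -> closed_vseg b c d ->
  rect_int P Q a b c d = rect_int P Q a m c d + rect_int P Q m b c d.
Proof.
move=> am mb /closed_hseg_cont hc /closed_hseg_cont hd
  /closed_vseg_cont va /closed_vseg_cont vm /closed_vseg_cont vb.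
rewrite /rect_int (linint_split am mb); last exact: cont_segB.
by rewrite !(linintB (f := Q _))//; ring.
Qed.

Lemma rect_int_hsplit a b c m d : c <= m -> m <= d ->
  closed_hseg c a b -> closed_hseg m a b -> closed_hseg d a b ->
  closed_vseg a c d -> closed_vseg b c d ->
  rect_int P Q a b c d = rect_int P Q a b c m + rect_int P Q a b m d.
Proof.
move=> cm md /closed_hseg_cont hc /closed_hseg_cont hm /closed_hseg_cont hd
  /closed_vseg_cont va /closed_vseg_cont vb.
rewrite /rect_int (linint_split cm md); last exact: cont_segB.
by rewrite !(linintB (f := fun x => P x _))//; ring.
Qed.

(** At a closed point the linear part of the form has circulation 0, since the terms
    [B * (d - c) * (b - a)] from horizontal and vertical sides cancel. Over the boundary, of length
    [2 * S] with [S] the half perimeter, only remainders of size at most [e / 2 * S] at each point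
    are left. *)
Lemma rect_int_local x y : closed_form_at P Q x y ->
  forall e, 0 < e -> exists2 dl, 0 < dl & forall a b c d,
    a <= x <= b -> c <= y <= d -> b - a < dl -> d - c < dl ->
    closed_hseg c a b -> closed_hseg d a b ->
    closed_vseg a c d -> closed_vseg b c d ->
    `|rect_int P Q a b c d| <= e * ((b - a) + (d - c)) ^+ 2.
Proof.
move=> [A [B [E H]]] e e0.
have [|dl dl0 {}H] := H (e / 2); first by rewrite divr_gt0.
exists dl => // a b c d /andP[ax xb] /andP[cy yd] bd dd.
move=> /closed_hseg_cont hc /closed_hseg_cont hd.
move=> /closed_vseg_cont va /closed_vseg_cont vb.
have ab : a <= b by rewrite (le_trans ax).
have cd : c <= d by rewrite (le_trans cy).
set S := (b - a) + (d - c).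
have near x' y' : a <= x' <= b -> c <= y' <= d ->
  [/\ `|x' - x| < dl, `|y' - y| < dl & `|x' - x| + `|y' - y| <= S].
  move=> /andP[ax' x'b] /andP[cy' y'd].
  have H1 : `|x' - x| <= b - a by rewrite ler_norml; apply/andP; split; lra.
  have H2 : `|y' - y| <= d - c by rewrite ler_norml; apply/andP; split; lra.
  by split; [exact: le_lt_trans bd|exact: le_lt_trans dd|exact: lerD].
have e2 : 0 <= e / 2 by rewrite divr_ge0// ltW.
have close x' y' : a <= x' <= b -> c <= y' <= d ->
  `|P x' y' - P x y - A * (x' - x) - B * (y' - y)| <= e / 2 * S /\
  `|Q x' y' - Q x y - B * (x' - x) - E * (y' - y)| <= e / 2 * S.
  move=> Hx Hy; have [H1 H2 H3] := near _ _ Hx Hy.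
  have [H4 H5] := H _ _ H1 H2.
  by split; [apply: le_trans H4 _|apply: le_trans H5 _]; rewrite ler_wpM2l.
have cc : c <= c <= d by rewrite lexx.
have dd' : c <= d <= d by rewrite lexx andbT.
have aa : a <= a <= b by rewrite lexx.
have bb : a <= b <= b by rewrite lexx andbT.
have I1 : `|linint (fun x => P x c - P x d + B * (d - c)) a b| <= e * S * (b - a).
  apply: linint_bound => // [x' x'ab|x' x'ab].
    apply: continuousD; last exact: cst_continuous.
    by apply: continuousB; [exact: hc|exact: hd].
  have [H1 _] := close _ _ x'ab cc; have [H2 _] := close _ _ x'ab dd'.
  rewrite (_ : _ + _ = (P x' c - P x y - A * (x' - x) - B * (c - y))
     - (P x' d - P x y - A * (x' - x) - B * (d - y))); last by ring.
  by rewrite (le_trans (ler_normB _ _))// (le_trans (lerD H1 H2))//; lra.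
have I2 : `|linint (fun y => Q b y - Q a y - B * (b - a)) c d| <= e * S * (d - c).
  apply: linint_bound => // [y' y'ab|y' y'ab].
    apply: continuousB; last exact: cst_continuous.
    by apply: continuousB; [exact: vb|exact: va].
  have [_ H1] := close _ _ bb y'ab; have [_ H2] := close _ _ aa y'ab.
  rewrite (_ : _ - _ = (Q b y' - Q x y - B * (b - x) - E * (y' - y))
     - (Q a y' - Q x y - B * (a - x) - E * (y' - y))); last by ring.
  by rewrite (le_trans (ler_normB _ _))// (le_trans (lerD H1 H2))//; lra.
rewrite linintD in I1; [|exact: cont_segB|exact: cont_seg_cst].
rewrite (linintB (g := fun=> _)) in I2; [|exact: cont_segB|exact: cont_seg_cst].
rewrite !linint_cst// in I1 I2.
rewrite /rect_int.
set u := linint _ _ _ in I1 *; set v := linint _ _ _ in I2 *.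
rewrite (_ : u + v = (u + B * (d - c) * (b - a)) + (v - B * (b - a) * (d - c))); last by ring.
by rewrite (le_trans (ler_normD _ _))// (le_trans (lerD I1 I2))// -mulrDr /S; lra.
Qed.

End continuity.
End Goursat.

Section Goursat2.
Context {R : realType}.
Variables P Q : R -> R -> R.
Implicit Types a b c d e s x y : R.

Section bisection.
Variables (a b c d : R).
Hypotheses (ab : a < b) (cd : c < d).
Hypothesis PQ : forall x y, a <= x <= b -> c <= y <= d -> closed_form_at P Q x y.

Let W n : R := (b - a) / 2 ^+ n.
Let H n : R := (d - c) / 2 ^+ n.

Let W0 n : 0 < W n. Proof. by rewrite divr_gt0 ?exprn_gt0// subr_gt0. Qed.
Let H0 n : 0 < H n. Proof. by rewrite divr_gt0 ?exprn_gt0// subr_gt0. Qed.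
Let WS n : W n = W n.+1 + W n.+1.
Proof. by rewrite /W exprS; field; rewrite expf_neq0. Qed.
Let HS n : H n = H n.+1 + H n.+1.
Proof. by rewrite /H exprS; field; rewrite expf_neq0. Qed.

Let inside n (p : R * R) :=
  [/\ a <= p.1, p.1 + W n <= b, c <= p.2 & p.2 + H n <= d].

Let I n (p : R * R) := rect_int P Q p.1 (p.1 + W n) p.2 (p.2 + H n).

Let bad e n p := inside n p /\ e * (W n * H n) < `|I n p|.

Let quarter n (p p' : R * R) :=
  (p'.1 = p.1 \/ p'.1 = p.1 + W n.+1) /\ (p'.2 = p.2 \/ p'.2 = p.2 + H n.+1).

(** A bad rectangle has circulation exceeding [e] per unit area. Circulation and area are both
    additive over the four quarters, so one quarter is bad too. *)
Let bad_step e n p : bad e n p -> exists p', bad e n.+1 p' /\ quarter n p p'.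
Proof.
case: p => x y [[/= ax xb cy yd]]; rewrite /I/=.
have w0 := W0 n.+1; have h0 := H0 n.+1.
have := WS n; have := HS n; move: xb yd.
set w := W n.+1 in w0 *; set h := H n.+1 in h0 *.
move=> xb yd HE WE; rewrite HE WE in xb yd *; rewrite !addrA in xb yd *.
have hseg y' : y <= y' <= y + h + h -> forall x1 x2, x <= x1 -> x2 <= x + w + w ->
    closed_hseg P Q y' x1 x2.
  by move=> /andP[y1 y2] x1 x2 xx1 xx2 t /andP[t1 t2]; apply: PQ; apply/andP; split; lra.
have vseg x' : x <= x' <= x + w + w -> forall y1 y2, y <= y1 -> y2 <= y + h + h ->
    closed_vseg P Q x' y1 y2.
  by move=> /andP[x1 x2] y1 y2 yy1 yy2 t /andP[t1 t2]; apply: PQ; apply/andP; split; lra.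
rewrite (@rect_int_vsplit _ _ _ _ (x + w)); try lra; last 5 first.
- by apply: hseg; [apply/andP; split|..]; lra.
- by apply: hseg; [apply/andP; split|..]; lra.
- by apply: vseg; [apply/andP; split|..]; lra.
- by apply: vseg; [apply/andP; split|..]; lra.
- by apply: vseg; [apply/andP; split|..]; lra.
rewrite (@rect_int_hsplit _ _ _ x _ _ (y + h)); try lra; last 5 first.
- by apply: hseg; [apply/andP; split|..]; lra.
- by apply: hseg; [apply/andP; split|..]; lra.
- by apply: hseg; [apply/andP; split|..]; lra.
- by apply: vseg; [apply/andP; split|..]; lra.
- by apply: vseg; [apply/andP; split|..]; lra.
rewrite (@rect_int_hsplit _ _ _ (x + w) _ _ (y + h)); try lra; last 5 first.
- by apply: hseg; [apply/andP; split|..]; lra.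
- by apply: hseg; [apply/andP; split|..]; lra.
- by apply: hseg; [apply/andP; split|..]; lra.
- by apply: vseg; [apply/andP; split|..]; lra.
- by apply: vseg; [apply/andP; split|..]; lra.
set I1 := rect_int P Q x (x + w) y (y + h).
set I2 := rect_int P Q x (x + w) (y + h) (y + h + h).
set I3 := rect_int P Q (x + w) (x + w + w) y (y + h).
set I4 := rect_int P Q (x + w) (x + w + w) (y + h) (y + h + h).
move=> big.
have [B1|B1] := ltP (e * (w * h)) `|I1|.
  by exists (x, y); split; [split => //; split => /=; rewrite -?/w -?/h; lra|split; left].
have [B2|B2] := ltP (e * (w * h)) `|I2|.
  by exists (x, y + h); split; [split => //; split => /=; rewrite -?/w -?/h; lra|split; [left|right]].
have [B3|B3] := ltP (e * (w * h)) `|I3|.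
  by exists (x + w, y); split; [split => //; split => /=; rewrite -?/w -?/h; lra|split; [right|left]].
have [B4|B4] := ltP (e * (w * h)) `|I4|.
  by exists (x + w, y + h); split; [split => //; split => /=; rewrite -?/w -?/h; lra|split; right].
exfalso; move: big; apply/negP; rewrite -leNgt.
have T : `|I1 + I2 + (I3 + I4)| <= `|I1| + `|I2| + (`|I3| + `|I4|).
  by rewrite (le_trans (ler_normD _ _))// lerD// ler_normD.
by rewrite (le_trans T)//; nra.
Qed.

Let bad_ind e : 0 < e -> ~ bad e 0 (a, c).
Proof.
move=> e0 bad0.
(* Dependent choice through a total function: off the bad rectangles [F] keeps [p], a case that
   never occurs along [s]. *)
pose F n p := if pselect (bad e n p) is left Hp then projT1 (cid (bad_step Hp)) else p.
pose s := fix s n := if n is m.+1 then F m (s m) else (a, c).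
have bads n : bad e n (s n).
  elim: n => //= n IH; rewrite /F; case: pselect => // Hp.
  by case: (cid _) => p' [].
have qs n : quarter n (s n) (s n.+1).
  have -> : s n.+1 = F n (s n) by [].
  by rewrite /F; case: pselect (bads n) => // Hp _; case: (cid _) => p' [].
have mono1 n k : (s n).1 <= (s (n + k)%N).1 /\ (s (n + k)%N).1 + W (n + k) <= (s n).1 + W n.
  elim: k => [|k [IH1 IH2]]; first by rewrite addn0.
  have [+ _] := qs (n + k)%N; have := W0 (n + k).+1; have := WS (n + k).
  by rewrite addnS => ? ? [] ->; split; lra.
have mono2 n k : (s n).2 <= (s (n + k)%N).2 /\ (s (n + k)%N).2 + H (n + k) <= (s n).2 + H n.
  elim: k => [|k [IH1 IH2]]; first by rewrite addn0.
  have [_] := qs (n + k)%N; have := H0 (n + k).+1; have := HS (n + k).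
  by rewrite addnS => ? ? [] ->; split; lra.
have ub1 m n : (s m).1 <= (s n).1 + W n.
  have [mn|/ltnW nm] := leqP m n.
    have [+ _] := mono1 m (n - m)%N; rewrite subnKC// => /le_trans; apply.
    by rewrite lerDl ltW.
  by have [_] := mono1 n (m - n)%N; rewrite subnKC//; have := W0 m; lra.
have ub2 m n : (s m).2 <= (s n).2 + H n.
  have [mn|/ltnW nm] := leqP m n.
    have [+ _] := mono2 m (n - m)%N; rewrite subnKC// => /le_trans; apply.
    by rewrite lerDl ltW.
  by have [_] := mono2 n (m - n)%N; rewrite subnKC//; have := H0 m; lra.
(* The supremum of the lower left corners, taken in each coordinate, lies in all the nested
   rectangles. *)
pose X := sup (range (fun n => (s n).1)); pose Y := sup (range (fun n => (s n).2)).
have Xs n : (s n).1 <= X <= (s n).1 + W n.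
  apply/andP; split.
    apply: ub_le_sup; last by exists n.
    by exists ((s 0%N).1 + W 0) => _ [m _ <-]; exact: ub1.
  by apply: ge_sup; [exists (s 0%N).1; exists 0%N|move=> _ [m _ <-]; exact: ub1].
have Ys n : (s n).2 <= Y <= (s n).2 + H n.
  apply/andP; split.
    apply: ub_le_sup; last by exists n.
    by exists ((s 0%N).2 + H 0) => _ [m _ <-]; exact: ub2.
  by apply: ge_sup; [exists (s 0%N).2; exists 0%N|move=> _ [m _ <-]; exact: ub2].
have ins n : inside n (s n) by case: (bads n).
have XY : closed_form_at P Q X Y.
  have [H1 H2 H3 H4] := ins 0%N.
  have /andP[X1 X2] := Xs 0%N; have /andP[Y1 Y2] := Ys 0%N; apply: PQ; apply/andP.
    by split; [exact: le_trans H1 X1|exact: le_trans X2 H2].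
  by split; [exact: le_trans H3 Y1|exact: le_trans Y2 H4].
pose D := (b - a) + (d - c).
have D0 : 0 < D by rewrite addr_gt0// subr_gt0.
(* All rectangles of the sequence are similar, so this choice makes [e' * (W n + H n) ^+ 2] equal to
   [e * (W n * H n)] for every [n]. *)
pose e' := e * ((b - a) * (d - c)) / D ^+ 2.
have e'0 : 0 < e' by rewrite divr_gt0 ?exprn_gt0// mulr_gt0// mulr_gt0// subr_gt0.
have [dl dl0 loc] := rect_int_local XY e'0.
have [n Dn] : exists n : nat, D / 2 ^+ n < dl.
  exists (Num.trunc (D / dl)).+1.
  rewrite ltr_pdivrMr ?exprn_gt0// mulrC -ltr_pdivrMr//.
  rewrite (lt_le_trans (truncnS_gt _))//.
  by rewrite -natrX ler_nat ltnW// ltn_expl.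
have [p1 p2 p3 p4] := ins n.
have WHn : W n + H n = D / 2 ^+ n by rewrite /W /H -mulrDl.
have e1 : (s n).1 + W n - (s n).1 = W n by ring.
have e2 : (s n).2 + H n - (s n).2 = H n by ring.
have big := loc (s n).1 ((s n).1 + W n) (s n).2 ((s n).2 + H n) (Xs n) (Ys n).
rewrite e1 e2 in big.
have w0 := W0 n; have h0 := H0 n.
have := bads n => -[_]; rewrite ltNge => /negP; apply.
have wd : W n < dl by lra.
have hd : H n < dl by lra.
have sub x y : (s n).1 <= x <= (s n).1 + W n -> (s n).2 <= y <= (s n).2 + H n ->
    closed_form_at P Q x y.
  move=> /andP[x1 x2] /andP[y1 y2]; apply: PQ; apply/andP.
    by split; [exact: le_trans p1 x1|exact: le_trans x2 p2].
  by split; [exact: le_trans p3 y1|exact: le_trans y2 p4].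
have w1 : (s n).1 <= (s n).1 <= (s n).1 + W n by rewrite lexx lerDl ltW.
have w2 : (s n).1 <= (s n).1 + W n <= (s n).1 + W n by rewrite lexx lerDl ltW.
have h1 : (s n).2 <= (s n).2 <= (s n).2 + H n by rewrite lexx lerDl ltW.
have h2 : (s n).2 <= (s n).2 + H n <= (s n).2 + H n by rewrite lexx lerDl ltW.
apply: le_trans (big wd hd (fun x Hx => sub x _ Hx h1) (fun x Hx => sub x _ Hx h2)
  (fun y Hy => sub _ y w1 Hy) (fun y Hy => sub _ y w2 Hy)) _.
rewrite WHn /e' /W /H le_eqVlt; apply/orP; left; apply/eqP.
by field; rewrite expf_neq0//= gt_eqF.
Qed.

Theorem goursat : rect_int P Q a b c d = 0.
Proof.
apply/eqP; rewrite -normr_eq0 eq_le normr_ge0 andbT leNgt; apply/negP => I0.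
(* Half the circulation per unit area, so that the initial rectangle is strictly bad. *)
pose e := `|rect_int P Q a b c d| / (2 * ((b - a) * (d - c))).
have wh : 0 < (b - a) * (d - c) by rewrite mulr_gt0// subr_gt0.
have e0 : 0 < e by rewrite divr_gt0// mulr_gt0.
apply: (bad_ind e0); split; first by split => //=; rewrite /W /H expr0 divr1; lra.
rewrite /I /W /H/= expr0 !divr1 !subrKC.
have -> : e * ((b - a) * (d - c)) = `|rect_int P Q a b c d| / 2.
  by rewrite /e; move: wh; set t := (b - a) * (d - c) => t0; field; rewrite gt_eqF.
by lra.
Qed.

End bisection.

(** The frame between the two rectangles is cut into two strips of full height at the sides and one
    piece each below and above the inner rectangle; [goursat] applies to all four. *)
Lemma rect_int_shrink a b c d a' b' c' d' :
  a < a' -> a' < b' -> b' < b -> c < c' -> c' < d' -> d' < d ->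
  (forall x y, a <= x <= b -> c <= y <= d ->
     [\/ x <= a', b' <= x, y <= c' | d' <= y] -> closed_form_at P Q x y) ->
  rect_int P Q a b c d = rect_int P Q a' b' c' d'.
Proof.
move=> aa ab bb cc cd dd H.
have hs y x1 x2 : c <= y -> y <= d -> y <= c' \/ d' <= y -> a <= x1 -> x2 <= b ->
    closed_hseg P Q y x1 x2.
  move=> cy yd yy ax xb x /andP[x1x xx2]; apply: H.
  - by rewrite (le_trans ax x1x) (le_trans xx2 xb).
  - by rewrite cy yd.
  - by case: yy => ?; [apply: Or43|apply: Or44].
have vs x y1 y2 : a <= x -> x <= b -> x <= a' \/ b' <= x -> c <= y1 -> y2 <= d ->
    closed_vseg P Q x y1 y2.
  move=> ax xb xx cy yd y /andP[y1y yy2]; apply: H.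
  - by rewrite ax xb.
  - by rewrite (le_trans cy y1y) (le_trans yy2 yd).
  - by case: xx => ?; [apply: Or41|apply: Or42].
have zero x1 x2 y1 y2 : x1 < x2 -> y1 < y2 -> a <= x1 -> x2 <= b -> c <= y1 -> y2 <= d ->
    [\/ x2 <= a', b' <= x1, y2 <= c' | d' <= y1] -> rect_int P Q x1 x2 y1 y2 = 0.
  move=> x12 y12 ax xb cy yd out; apply: goursat => // x y /andP[xx1 xx2] /andP[yy1 yy2].
  apply: H; [by rewrite (le_trans ax xx1) (le_trans xx2 xb)|
             by rewrite (le_trans cy yy1) (le_trans yy2 yd)|].
  case: out => o; [apply: Or41|apply: Or42|apply: Or43|apply: Or44].
  - exact: le_trans xx2 o.
  - exact: le_trans o xx1.
  - exact: le_trans yy2 o.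
  - exact: le_trans o yy1.
have laa := ltW aa; have lab := ltW ab; have lbb := ltW bb.
have lcc := ltW cc; have lcd := ltW cd; have ldd := ltW dd.
have lab' := le_trans laa lab; have lab'' := le_trans lab lbb.
have lcd' := le_trans lcc lcd; have lcd'' := le_trans lcd ldd.
have l1 := le_trans laa lab''; have l2 := le_trans lcc lcd''.
have acd : c < d := lt_trans cc (lt_trans cd dd).
have acd' : c' < d := lt_trans cd dd.
have z1 : rect_int P Q a a' c d = 0 by apply: zero => //; exact: Or41.
have z2 : rect_int P Q b' b c d = 0 by apply: zero => //; exact: Or42.
have z3 : rect_int P Q a' b' c c' = 0 by apply: zero => //; exact: Or43.
have z4 : rect_int P Q a' b' d' d = 0 by apply: zero => //; exact: Or44.
rewrite (@rect_int_vsplit _ P Q a a' b c d laa lab''); try by [apply: hs; auto|apply: vs; auto].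
rewrite (@rect_int_vsplit _ P Q a' b' b c d lab lbb); try by [apply: hs; auto|apply: vs; auto].
rewrite (@rect_int_hsplit _ P Q a' b' c c' d lcc lcd''); try by [apply: hs; auto|apply: vs; auto].
rewrite (@rect_int_hsplit _ P Q a' b' c' d' d lcd ldd); try by [apply: hs; auto|apply: vs; auto].
by rewrite z1 z2 z3 z4 !addr0 !add0r.
Qed.

(** The rectangle shrinks to a square of half-side [s] around the puncture, where the circulation is
    at most [8 * M * s]; then [s] tends to 0. *)
Theorem goursat_punctured a b c d (p q M s0 : R) : a < p < b -> c < q < d -> 0 < s0 ->
  (forall x y, a <= x <= b -> c <= y <= d -> (x, y) != (p, q) ->
     closed_form_at P Q x y) ->
  (forall x y, `|x - p| <= s0 -> `|y - q| <= s0 -> (x, y) != (p, q) ->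
     `|P x y| <= M /\ `|Q x y| <= M) ->
  rect_int P Q a b c d = 0.
Proof.
move=> /andP[ap pb] /andP[cq qd] s00 PQ bM.
have M0 : 0 <= M.
  have [| | |+ _] := bM (p + s0) q; last exact: le_trans.
  - by rewrite addrC addKr gtr0_norm.
  - by rewrite subrr normr0 ltW.
  - by rewrite xpair_eqE eqxx andbT addrC -subr_eq0 addrK gt_eqF.
pose s1 := Num.min (Num.min s0 (Num.min (p - a) (b - p))) (Num.min (q - c) (d - q)).
have s10 : 0 < s1 by rewrite !lt_min s00 !subr_gt0 ap pb cq qd.
have small s : 0 < s -> s < s1 -> `|rect_int P Q a b c d| <= 8 * M * s.
  move=> spos; rewrite !lt_min => /andP[/andP[ss0 /andP[spa sbp]] /andP[sqc sdq]].
  have ne1 x y : x < p \/ p < x -> (x, y) != (p, q).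
    by rewrite xpair_eqE negb_and => -[xp|xp]; rewrite ?(lt_eqF xp) ?(gt_eqF xp).
  have ne2 x y : y < q \/ q < y -> (x, y) != (p, q).
    by rewrite xpair_eqE negb_and orbC => -[xp|xp]; rewrite ?(lt_eqF xp) ?(gt_eqF xp).
  have PQs x y : a <= x <= b -> c <= y <= d ->
      [\/ x <= p - s, p + s <= x, y <= q - s | q + s <= y] -> closed_form_at P Q x y.
    move=> Hx Hy H; apply: PQ => //; apply/negP => /eqP[xp yq].
    by move: H; rewrite xp yq; clear - spos; case=> H; lra.
  have -> : rect_int P Q a b c d = rect_int P Q (p - s) (p + s) (q - s) (q + s).
    by apply: rect_int_shrink => //; clear - spos spa sbp sqc sdq; lra.
  have aps : a <= p - s by clear - spa; lra.
  have psb : p + s <= b by clear - sbp; lra.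
  have cqs : c <= q - s by clear - sqc; lra.
  have qsd : q + s <= d by clear - sdq; lra.
  have pps : p - s <= p + s by clear - spos; lra.
  have qqs : q - s <= q + s by clear - spos; lra.
  have Hh y : y = q - s \/ y = q + s -> closed_hseg P Q y (p - s) (p + s).
    move=> H x /andP[x1 x2]; apply: PQs.
    - by rewrite (le_trans aps x1) (le_trans x2 psb).
    - by case: H => ->; [rewrite cqs (le_trans qqs)|rewrite qsd (le_trans cqs)].
    - by case: H => ->; [apply: Or43|apply: Or44].
  have Hv x : x = p - s \/ x = p + s -> closed_vseg P Q x (q - s) (q + s).
    move=> H y /andP[y1 y2]; apply: PQs.
    - by case: H => ->; [rewrite aps (le_trans pps)|rewrite psb (le_trans aps)].
    - by rewrite (le_trans cqs y1) (le_trans y2 qsd).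
    - by case: H => ->; [apply: Or41|apply: Or42].
  have nearp w x : w - s <= x <= w + s -> `|x - w| <= s0.
    move=> /andP[x1 x2]; clear - ss0 x1 x2; rewrite ler_norml; apply/andP; split; lra.
  have sab w : w - s < w /\ w < w + s by clear - spos; split; lra.
  have [psp pps'] := sab p; have [qsq qqs'] := sab q.
  have sle w : w - s <= w - s <= w + s /\ w - s <= w + s <= w + s.
    by rewrite !lexx andbT/=; clear - spos; lra.
  have B1 : `|linint (fun x => P x (q - s) - P x (q + s)) (p - s) (p + s)| <= 2 * M * (p + s - (p - s)).
    apply: linint_bound => // [|x Hx].
      by apply: cont_segB; apply: (closed_hseg_cont (P := P) (Q := Q)); apply: Hh; [left|right].
    have xs := nearp _ _ Hx.
    have [H1 _] := bM x (q - s) xs (nearp _ _ (proj1 (sle q))) (ne2 x _ (or_introl qsq)).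
    have [H2 _] := bM x (q + s) xs (nearp _ _ (proj2 (sle q))) (ne2 x _ (or_intror qqs')).
    by rewrite (le_trans (ler_normB _ _))//; clear - H1 H2; lra.
  have B2 : `|linint (fun y => Q (p + s) y - Q (p - s) y) (q - s) (q + s)| <= 2 * M * (q + s - (q - s)).
    apply: linint_bound => // [|y Hy].
      by apply: cont_segB; apply: (closed_vseg_cont (P := P) (Q := Q)); apply: Hv; [right|left].
    have ys := nearp _ _ Hy.
    have [_ H1] := bM (p + s) y (nearp _ _ (proj2 (sle p))) ys (ne1 _ y (or_intror pps')).
    have [_ H2] := bM (p - s) y (nearp _ _ (proj1 (sle p))) ys (ne1 _ y (or_introl psp)).
    by rewrite (le_trans (ler_normB _ _))//; clear - H1 H2; lra.
  by rewrite /rect_int (le_trans (ler_normD _ _))// (le_trans (lerD B1 B2))//; clear; lra.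
apply/eqP; rewrite -normr_eq0 eq_le normr_ge0 andbT leNgt; apply/negP => I0.
(* [8 * M + 1] instead of [8 * M] keeps the denominator positive when [M = 0]. *)
pose s := Num.min (s1 / 2) (`|rect_int P Q a b c d| / (8 * M + 1) / 2).
have M1 : 0 < 8 * M + 1 by lra.
have t0 : 0 < `|rect_int P Q a b c d| / (8 * M + 1) by rewrite divr_gt0.
have spos : 0 < s by rewrite lt_min; apply/andP; split; lra.
have ss1 : s < s1 by rewrite gt_min; apply/orP; left; lra.
have := small s spos ss1; apply/negP; rewrite -ltNge.
have s2 : s <= `|rect_int P Q a b c d| / (8 * M + 1) / 2 by rewrite ge_min lexx orbT.
move: t0 s2; set t := _ / (8 * M + 1) => t0 s2.
have -> : `|rect_int P Q a b c d| = t * (8 * M + 1) by rewrite /t divfK// gt_eqF.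
by nra.
Qed.

End Goursat2.

(** * Cauchy's formula *)

Section ComplexDerivative.
Context {R : realType}.
Implicit Types (f g : R[i] -> R[i]) (z h l : R[i]).
Local Notation normc := Normc.normc.

Lemma normcE2 z : normc z ^+ 2 = complex.Re z ^+ 2 + complex.Im z ^+ 2.
Proof. by case: z => a b; rewrite sqr_sqrtr// addr_ge0// sqr_ge0. Qed.

Lemma normc_ge0 z : 0 <= normc z.
Proof. by case: z => a b; exact: sqrtr_ge0. Qed.

Lemma normc_norm z : `|z| = (normc z)%:C.
Proof. by case: z. Qed.

Lemma normc_geRe z : `|complex.Re z| <= normc z.
Proof.
by rewrite -[_ <= _]ler_sqr ?nnegrE ?normc_ge0// normcE2 real_normK ?num_real// lerDl sqr_ge0.
Qed.

Lemma normc_geIm z : `|complex.Im z| <= normc z.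
Proof.
by rewrite -[_ <= _]ler_sqr ?nnegrE ?normc_ge0// normcE2 real_normK ?num_real// lerDr sqr_ge0.
Qed.

Lemma normc_leD z : normc z <= `|complex.Re z| + `|complex.Im z|.
Proof.
rewrite -[_ <= _]ler_sqr ?nnegrE ?normc_ge0 ?addr_ge0// normcE2.
rewrite -[complex.Re z ^+ 2]real_normK ?num_real// -[complex.Im z ^+ 2]real_normK ?num_real//.
by have := normr_ge0 (complex.Re z); have := normr_ge0 (complex.Im z); nra.
Qed.

Lemma normc_eq0 z : (normc z == 0) = (z == 0).
Proof.
apply/eqP/eqP => [/Normc.eq0_normc//|->]; exact: Normc.normc0.
Qed.

Lemma normc_gt0 z : (0 < normc z) = (z != 0).
Proof. by rewrite lt_neqAle normc_ge0 andbT eq_sym normc_eq0. Qed.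

Lemma normc_triangle z h : normc (z + h) <= normc z + normc h.
Proof. exact: le_normcD. Qed.

Lemma normc_real (r : R) : normc r%:C = `|r|.
Proof. by rewrite /= expr0n/= addr0 sqrtr_sqr. Qed.

Lemma addcE (a b c d : R) : (a +i* b) + (c +i* d) = (a + c) +i* (b + d).
Proof. by []. Qed.

Lemma mulcE (a b c d : R) :
  (a +i* b) * (c +i* d) = (a * c - b * d) +i* (a * d + b * c).
Proof. by []. Qed.

Lemma ReB z h : complex.Re (z - h) = complex.Re z - complex.Re h.
Proof. by case: z; case: h. Qed.

(** The complex derivative with real tolerances and without a quotient, so that [h = 0] needs no
    exception and real and imaginary parts can be read off directly. *)
Definition cdiff f z l := forall e : R, 0 < e -> exists2 d : R, 0 < d &
  forall h, normc h < d -> normc (f (z + h) - f z - l * h) <= e * normc h.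

Lemma cdiff_derivable f z l : cdiff f z l ->
  derivable (f : R[i]^o -> R[i]^o) z 1.
Proof.
move=> H; apply/cvg_ex; exists (l : R[i]^o).
apply/(@cvgrPdist_le _ R[i]^o) => e e0.
(* Positive elements of [R[i]] have imaginary part 0, so [e] is an ordinary real tolerance. *)
have eE : e = (complex.Re e)%:C.
  by move: e0; case: e => a b; rewrite ltcE/= => /andP[/eqP -> _].
have er0 : 0 < complex.Re e by move: e0; rewrite eE ltcR.
have [d d0 Hd] := H _ er0.
apply/nbhs_ballP; exists d%:C => /=; first by rewrite ltcR.
move=> h; rewrite /ball/= sub0r normrN normc_norm ltcR => hd h0.
have := Hd _ hd; rewrite [in X in X -> _](addrC z) => {}Hd.
rewrite distrC.
rewrite (_ : _ - l = h^-1 * (f (h + z) - f z - l * h)); last first.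
  by rewrite -[h%:A]/(h * 1) mulr1 -[_ *: _]/(_ * _) [RHS]mulrBr [h^-1 * (l * h)]mulrCA mulVf// mulr1.
rewrite eE normc_norm lecR Normc.normcM Normc.normcV.
by rewrite ler_pdivrMl ?normc_gt0// [normc h * _]mulrC.
Qed.

Lemma derivable_cdiff f z :
  derivable (f : R[i]^o -> R[i]^o) z 1 -> exists l, cdiff f z l.
Proof.
move=> /cvg_ex[l H]; exists l => e e0.
have ec0 : 0 < e%:C by rewrite ltcR.
move/(@cvgrPdist_le _ R[i]^o) : H => /(_ _ ec0)/nbhs_ballP[d /= d0 Hd].
have dE : d = (complex.Re d)%:C.
  by move: d0; case: d {Hd} => a b; rewrite ltcE/= => /andP[/eqP -> _].
exists (complex.Re d); first by move: d0; rewrite dE ltcR.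
move=> h hd; have [->|h0] := eqVneq h 0.
  by rewrite addr0 subrr mulr0 subr0 Normc.normc0 mulr0.
have := Hd h; rewrite /ball/= sub0r normrN normc_norm dE ltcR => /(_ hd h0).
rewrite distrC (_ : _ - l = h^-1 * (f (h + z) - f z - l * h)); last first.
  by rewrite -[h%:A]/(h * 1) mulr1 -[_ *: _]/(_ * _) [RHS]mulrBr [h^-1 * (l * h)]mulrCA mulVf// mulr1.
rewrite normc_norm lecR Normc.normcM Normc.normcV (addrC h).
by rewrite ler_pdivrMl ?normc_gt0// [normc h * _]mulrC.
Qed.

(** The form is the real part of [f dz]. With [l = a + i b] its coefficients have partial
    derivatives [a, - b] and [- b, - a]: closedness is one of the Cauchy-Riemann equations, hidden
    in the complex linearity of [h |-> l * h]. *)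
Lemma cdiff_closed_form f (x y : R) l : cdiff f (x +i* y) l ->
  closed_form_at (fun x y => complex.Re (f (x +i* y)))
                 (fun x y => - complex.Im (f (x +i* y))) x y.
Proof.
case: l => a b H; exists a, (- b), (- a) => e e0; have [d d0 H0] := H e e0.
exists (d / 2); first by rewrite divr_gt0.
move=> x' y' xx yy.
pose h : R[i] := (x' - x) +i* (y' - y).
have hle : normc h <= `|x' - x| + `|y' - y| by exact: (normc_leD h).
have hd : normc h < d by lra.
have := H0 _ hd; have -> : (x +i* y) + h = x' +i* y'.
  by rewrite /h addcE; congr (_ +i* _); ring.
rewrite /h mulcE; case: (f (x +i* y)) => u v; case: (f (x' +i* y')) => u' v'.
set k := (X in normc X) => Hk.
have eh : e * normc h <= e * (`|x' - x| + `|y' - y|).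
  by rewrite ler_wpM2l// ltW.
split.
  apply: le_trans eh; apply: le_trans Hk; apply: le_trans (normc_geRe k).
  by rewrite le_eqVlt; apply/orP; left; apply/eqP; congr `|_|; rewrite /k/=; ring.
apply: le_trans eh; apply: le_trans Hk; apply: le_trans (normc_geIm k).
by rewrite -normrN le_eqVlt; apply/orP; left; apply/eqP; congr `|_|; rewrite /k/=; ring.
Qed.

End ComplexDerivative.

Section ComplexFunctions.
Context {R : realType}.
Implicit Types (f g : R[i] -> R[i]) (z h l : R[i]).
Local Notation normc := Normc.normc.

Lemma cdiff_lipschitz f z l : cdiff f z l -> exists2 d : R, 0 < d &
  forall h, normc h < d -> normc (f (z + h) - f z) <= (1 + normc l) * normc h.
Proof.
move=> /(_ 1 ltr01)[d d0 H]; exists d => // h /H; rewrite mul1r => {}H.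
rewrite (_ : _ - f z = (f (z + h) - f z - l * h) + l * h); last by ring.
by rewrite (le_trans (normc_triangle _ _))// Normc.normcM mulrDl mul1r lerD.
Qed.

Definition cderivable f z := derivable (f : R[i]^o -> R[i]^o) z 1.

Lemma cderivable_cst l z : cderivable (fun=> l) z.
Proof. exact: derivable_cst. Qed.

Lemma cderivable_id z : cderivable id z.
Proof. exact: derivable_id. Qed.

Lemma cderivableD f g z : cderivable f z -> cderivable g z ->
  cderivable (fun x => f x + g x) z.
Proof. exact: derivableD. Qed.

Lemma cderivableB f g z : cderivable f z -> cderivable g z ->
  cderivable (fun x => f x - g x) z.
Proof. exact: derivableB. Qed.

Lemma cderivableM f g z : cderivable f z -> cderivable g z ->
  cderivable (fun x => f x * g x) z.
Proof. exact: (@derivableM _ R[i]^o). Qed.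

Lemma cderivableV f z : f z != 0 -> cderivable f z -> cderivable (fun x => (f x)^-1) z.
Proof. exact: (@derivableV _ R[i]^o). Qed.

Lemma cderivable_comp f g z : cderivable f (g z) -> cderivable g z ->
  cderivable (f \o g) z.
Proof.
move=> /derivable_cdiff[l df] /derivable_cdiff[m dg]; apply: (@cdiff_derivable _ _ _ (l * m)).
have [d1 d10 gL] := cdiff_lipschitz dg.
set L := 1 + normc m in gL.
have L0 : 0 < L by rewrite ltr_pwDl// normc_ge0.
move=> e e0.
have [|d2 d20 Hf] := df (e / (2 * L)); first by rewrite divr_gt0// mulr_gt0.
have K0 : 0 < 2 * (1 + normc l) by rewrite mulr_gt0// ltr_pwDl// normc_ge0.
have [|d3 d30 Hg] := dg (e / (2 * (1 + normc l))); first by rewrite divr_gt0.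
exists (Num.min (Num.min d1 d3) (d2 / L)); first by rewrite !lt_min d10 d30 divr_gt0.
move=> h; rewrite !lt_min => /andP[/andP[h1 h3] h2].
set k := g (z + h) - g z; have kE : g (z + h) = g z + k by rewrite /k; ring.
have kL : normc k <= L * normc h by exact: gL.
have kd : normc k < d2 by rewrite (le_lt_trans kL)// mulrC -ltr_pdivlMr.
rewrite /= kE.
rewrite (_ : _ - _ - _ = (f (g z + k) - f (g z) - l * k) + l * (k - m * h)); last by ring.
apply: le_trans (normc_triangle _ _) _; rewrite Normc.normcM.
have A1 : normc (f (g z + k) - f (g z) - l * k) <= e / 2 * normc h.
  apply: le_trans (Hf _ kd) _.
  apply: le_trans (ler_wpM2l _ kL) _; first by rewrite divr_ge0 ?mulr_ge0// ltW.
  by rewrite le_eqVlt; apply/orP; left; apply/eqP; field; rewrite gt_eqF.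
have A2 : normc l * normc (k - m * h) <= e / 2 * normc h.
  have l0 := normc_ge0 l.
  apply: le_trans (ler_wpM2l l0 (Hg _ h3)) _.
  rewrite mulrA ler_wpM2r ?normc_ge0// mulrA ler_pdivrMr//; nra.
lra.
Qed.

Definition cexp z : R[i] :=
  (expR (complex.Re z) * cos (complex.Im z)) +i* (expR (complex.Re z) * sin (complex.Im z)).

Lemma cexpD z h : cexp (z + h) = cexp z * cexp h.
Proof.
case: z => a b; case: h => c d; rewrite addcE /cexp mulcE/= expRD cosD sinD.
by congr (_ +i* _); ring.
Qed.

Lemma normc_cexp z : normc (cexp z) = expR (complex.Re z).
Proof.
apply/eqP; rewrite -(eqrXn2 (n := 2)) ?normc_ge0 ?expR_ge0//; apply/eqP.
by rewrite normcE2/= !exprMn -mulrDr cos2Dsin2 mulr1.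
Qed.

Let real_diff0 (f : R -> R) (l : R) : is_derive (0 : R) 1 f l ->
  forall e : R, 0 < e -> exists2 d : R, 0 < d &
    forall h : R, `|h| < d -> `|f h - f 0 - l * h| <= e * `|h|.
Proof.
move=> H e e0; have [df fl] := H.
have /(@cvgrPdist_le _ R^o)/(_ _ e0)/nbhs_ballP[d /= d0 Hd] : (fun h : R => h^-1 *: ((f \o shift 0) (h *: 1) - f 0)) @ 0^' --> l.
  by rewrite -fl; exact: df.
exists d => // h hd; have [->|h0] := eqVneq h 0.
  by rewrite subrr mulr0 subr0 normr0 mulr0.
have := Hd h; rewrite /ball/= sub0r normrN => /(_ hd h0).
rewrite distrC addr0 (_ : _ - l = h^-1 * (f h - f 0 - l * h)); last first.
  by rewrite -[h%:A]/(h * 1) mulr1 -[_ *: _]/(_ * _) [RHS]mulrBr [h^-1 * (l * h)]mulrCA mulVf// mulr1.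
by rewrite normrM normfV ler_pdivrMl ?normr_gt0// [_ * e]mulrC.
Qed.

Lemma cdiff_cexp0 : cdiff cexp 0 1.
Proof.
move=> e e0.
(* The error terms below add up to [6 * (e1 * n)], so [e / 8] leaves room. The bound by 1 keeps
   [|1 + a|] below 2, and [n < e1 / 2] makes the quadratic term [a * sin b] at most [e1 * n]. *)
pose e1 := Num.min (e / 8) 1.
have e10 : 0 < e1 by rewrite lt_min ltr01 divr_gt0.
have e1e : e1 <= e / 8 by rewrite ge_min lexx.
have e11 : e1 <= 1 by rewrite ge_min lexx orbT.
have [d1 d10 H1] := real_diff0 (is_derive_expR 0) e10.
have [d2 d20 H2] := real_diff0 (is_derive_cos 0) e10.
have [d3 d30 H3] := real_diff0 (is_derive_sin 0) e10.
pose d := Num.min (Num.min d1 d2) (Num.min d3 (e1 / 2)).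
exists d; first by rewrite !lt_min d10 d20 d30/= divr_gt0.
case=> a b; rewrite !lt_min => /andP[/andP[nd1 nd2] /andP[nd3 nde]].
have na := normc_geRe (a +i* b); have nb := normc_geIm (a +i* b).
rewrite /= in na nb; move: na nb; rewrite -/(normc (a +i* b)) => na nb.
have := H1 _ (le_lt_trans na nd1).
have := H2 _ (le_lt_trans nb nd2).
have := H3 _ (le_lt_trans nb nd3).
rewrite expR0 cos0 sin0 subr0 oppr0 mul0r subr0 !mul1r => h3 h2 h1.
rewrite add0r ?mul1r.
have -> : cexp 0 = 1 by rewrite /cexp/= expR0 cos0 sin0 mulr1 mulr0.
set n := normc (a +i* b) in nd1 nd2 nd3 nde na nb *.
have n0 : 0 <= n := normc_ge0 _.
have e1n (t : R) : `|t| <= n -> e1 * `|t| <= e1 * n by move=> ?; rewrite ler_wpM2l// ltW.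
have {}h1 := le_trans h1 (e1n _ na).
have {}h2 := le_trans h2 (e1n _ nb).
have {}h3 := le_trans h3 (e1n _ nb).
have cb : `|cos b| <= 1 by rewrite ler_norml cos_geN1 cos_le1.
have sb : `|sin b| <= 1 by rewrite ler_norml sin_geN1 sin_le1.
apply: le_trans (normc_leD _) _ => /=; rewrite -/(normc _).
have -> : expR a * cos b - 1 - a = (expR a - 1 - a) * cos b + (1 + a) * (cos b - 1) by ring.
have -> : expR a * sin b - 0 - b = (expR a - 1 - a) * sin b + a * sin b + (sin b - b) by ring.
have sbn : `|sin b| <= 2 * n.
  have -> : sin b = (sin b - b) + b by ring.
  by rewrite (le_trans (ler_normD _ _))//; nra.
have t1 : `|(expR a - 1 - a) * cos b| <= e1 * n.
  by rewrite normrM -[leRHS]mulr1 ler_pM.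
have t2 : `|(1 + a) * (cos b - 1)| <= 2 * (e1 * n).
  rewrite normrM ler_pM// (le_trans (ler_normD _ _))// normr1; lra.
have t3 : `|(expR a - 1 - a) * sin b| <= e1 * n.
  by rewrite normrM -[leRHS]mulr1 ler_pM.
have t4 : `|a * sin b| <= e1 * n.
  rewrite normrM (le_trans (ler_pM (normr_ge0 _) (normr_ge0 _) na sbn))//; nra.
have T1 := ler_normD ((expR a - 1 - a) * cos b) ((1 + a) * (cos b - 1)).
have T2 := ler_normD ((expR a - 1 - a) * sin b + a * sin b) (sin b - b).
have T3 := ler_normD ((expR a - 1 - a) * sin b) (a * sin b).
have : 6 * (e1 * n) <= e * n by nra.
lra.
Qed.

Lemma cdiff_cexp z : cdiff cexp z (cexp z).
Proof.
move=> e e0; have c0 : 0 < normc (cexp z) by rewrite normc_cexp expR_gt0.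
have [|d d0 Hd] := @cdiff_cexp0 (e / normc (cexp z)); first by rewrite divr_gt0.
exists d => // h /Hd; rewrite add0r mul1r cexpD.
have -> : cexp 0 = 1 by rewrite /cexp/= expR0 cos0 sin0 mulr1 mulr0.
rewrite (_ : _ * _ - _ - _ = cexp z * (cexp h - 1 - h)); last by ring.
by rewrite Normc.normcM => H; rewrite -ler_pdivlMl// mulrA [_^-1 * e]mulrC.
Qed.

Lemma cderivable_cexp z : cderivable cexp z.
Proof. exact/cdiff_derivable/cdiff_cexp. Qed.

(** This bounds the denominator of a difference quotient from below near a simple zero. *)
Lemma cdiff_expanding f z l : cdiff f z l -> l != 0 -> exists2 d : R, 0 < d &
  forall h, normc h < d -> normc l / 2 * normc h <= normc (f (z + h) - f z).
Proof.
move=> H l0; have nl : 0 < normc l by rewrite normc_gt0.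
have [|d d0 Hd] := H (normc l / 2); first by rewrite divr_gt0.
exists d => // h /Hd {}Hd.
have : normc (l * h) <= normc (f (z + h) - f z) + normc (f (z + h) - f z - l * h).
  set X := f (z + h) - f z.
  have := normc_triangle X (- (X - l * h)); rewrite normcN.
  by rewrite (_ : X + _ = l * h)//; ring.
by rewrite Normc.normcM; lra.
Qed.

(** The difference quotient of [f] over [g] has a removable singularity at [z0];
    boundedness is all that Goursat's lemma needs. *)
Lemma cauchy_quotient f g (a b c d p q : R) (lg : R[i]) :
  a < p < b -> c < q < d ->
  (forall x y, a <= x <= b -> c <= y <= d -> cderivable f (x +i* y)) ->
  (forall x y, a <= x <= b -> c <= y <= d -> cderivable g (x +i* y)) ->
  (forall x y, a <= x <= b -> c <= y <= d -> (x, y) != (p, q) ->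
     g (x +i* y) != g (p +i* q)) ->
  cdiff g (p +i* q) lg -> lg != 0 ->
  let k z := (f z - f (p +i* q)) / (g z - g (p +i* q)) in
  rect_int (fun x y => complex.Re (k (x +i* y)))
           (fun x y => - complex.Im (k (x +i* y))) a b c d = 0
  /\ forall x y, a <= x <= b -> c <= y <= d -> (x, y) != (p, q) ->
     closed_form_at (fun x y => complex.Re (k (x +i* y)))
           (fun x y => - complex.Im (k (x +i* y))) x y.
Proof.
move=> pab qcd hf hg gneq dg lg0 k.
have holk x y : a <= x <= b -> c <= y <= d -> (x, y) != (p, q) ->
     closed_form_at (fun x y => complex.Re (k (x +i* y)))
           (fun x y => - complex.Im (k (x +i* y))) x y.
  move=> xab ycd xy; have gz : g (x +i* y) - g (p +i* q) != 0 by rewrite subr_eq0 gneq.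
  have : cderivable k (x +i* y).
    apply: cderivableM; first by apply: cderivableB; [exact: hf|exact: cderivable_cst].
    by apply: cderivableV => //; apply: cderivableB; [exact: hg|exact: cderivable_cst].
  by move=> /derivable_cdiff[l]; exact: cdiff_closed_form.
split => //.
have [lf df] : exists l, cdiff f (p +i* q) l.
  by apply: derivable_cdiff; apply: hf; apply/andP; split; lra.
have [d1 d10 H1] := cdiff_lipschitz df.
have [d2 d20 H2] := cdiff_expanding dg lg0.
(* The Lipschitz constant of [f] over the expansion constant of [g]. The 4 in [s0] ensures that two
   coordinate offsets of at most [s0] stay within both radii. *)
pose M := (1 + normc lf) / (normc lg / 2).
pose s0 := Num.min d1 d2 / 4.
have s00 : 0 < s0 by rewrite divr_gt0// lt_min d10.
apply: (@goursat_punctured _ _ _ a b c d p q M s0) => // x y xp yq xy.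
suff kM : normc (k (x +i* y)) <= M.
  by split; [|rewrite normrN]; apply: le_trans kM; [exact: normc_geRe|exact: normc_geIm].
pose h : R[i] := (x - p) +i* (y - q).
have hE : x +i* y = (p +i* q) + h by rewrite addcE; congr (_ +i* _); ring.
have hs : normc h < Num.min d1 d2.
  by have := normc_leD h; rewrite /h/= -/(normc _) -/h; move: s00; rewrite /s0 in xp yq *; lra.
move: (hs); rewrite lt_min => /andP[hd1 hd2].
have h0 : 0 < normc h.
  rewrite normc_gt0; apply: contra xy => /eqP[/eqP + /eqP]; rewrite !subr_eq0 => /eqP -> /eqP ->.
  by [].
have nl : 0 < normc lg by rewrite normc_gt0.
rewrite /k hE Normc.normcM Normc.normcV.
apply: (@le_trans _ _ ((1 + normc lf) * normc h / (normc lg / 2 * normc h))).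
  apply: ler_pM; rewrite ?normc_ge0 ?invr_ge0 ?normc_ge0//; first exact: H1.
  by rewrite lef_pV2 ?posrE ?H2// ?mulr_gt0 ?divr_gt0// (lt_le_trans _ (H2 _ hd2))// mulr_gt0// divr_gt0.
by rewrite /M le_eqVlt; apply/orP; left; apply/eqP; field; rewrite !gt_eqF.
Qed.

End ComplexFunctions.

Section CauchyEstimates.
Context {R : realType}.
Implicit Types (f g : R[i] -> R[i]) (z h l : R[i]) (x y s t w : R).
Local Notation normc := Normc.normc.

Let ReNi z : complex.Re (- 'i * z) = complex.Im z.
Proof. by case: z => a b /=; ring. Qed.

Let ImNi z : - complex.Im (- 'i * z) = complex.Re z.
Proof. by case: z => a b /=; ring. Qed.

Let cdiff_Ni f z l : cdiff f z l -> cdiff (fun z => - 'i * f z) z (- 'i * l).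
Proof.
move=> H e /H[d d0 Hd]; exists d => // h /Hd.
rewrite (_ : _ * _ - _ * _ - _ = - 'i * (f (z + h) - f z - l * h)); last by ring.
by rewrite Normc.normcM normcN /= expr0n/= add0r expr1n sqrtr1 mul1r.
Qed.

(** The closed form of [f] itself gives only continuity of [Re f] in [x] and of [Im f] in [y]; the
    closed form of [- i f] gives the two others. *)
Lemma holo_contRe f (x y : R) : cderivable f (x +i* y) ->
  {for x, continuous (fun x => complex.Re (f (x +i* y)))} /\
  {for x, continuous (fun x => complex.Im (f (x +i* y)))}.
Proof.
move=> /derivable_cdiff[l H]; split; first exact: closed_form_contP1 (cdiff_closed_form H).
rewrite (_ : (fun _ => _) = (fun x => complex.Re (- 'i * f (x +i* y)))).
  exact: (closed_form_contP1 (cdiff_closed_form (cdiff_Ni H))).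
by apply/funext => u; rewrite ReNi.
Qed.

Lemma holo_contIm f (x y : R) : cderivable f (x +i* y) ->
  {for y, continuous (fun y => complex.Re (f (x +i* y)))} /\
  {for y, continuous (fun y => complex.Im (f (x +i* y)))}.
Proof.
move=> /derivable_cdiff[l H]; split.
  rewrite (_ : (fun _ => _) = (fun y => - complex.Im (- 'i * f (x +i* y)))).
    exact: (closed_form_contQ2 (cdiff_closed_form (cdiff_Ni H))).
  by apply/funext => u; rewrite ImNi.
rewrite (_ : (fun _ => _) = (fun y => - (- complex.Im (f (x +i* y))))).
  exact: continuousN (closed_form_contQ2 (cdiff_closed_form H)).
by apply/funext => u; rewrite opprK.
Qed.

Definition normsq f (x y : R) : R := normc (f (x +i* y)) ^+ 2.

Lemma normsq_cont1 f (x y : R) : cderivable f (x +i* y) ->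
  {for x, continuous (fun x => normsq f x y)}.
Proof.
move=> /holo_contRe[cr ci].
rewrite (_ : (fun _ => _) = (fun x => complex.Re (f (x +i* y)) * complex.Re (f (x +i* y))
   + complex.Im (f (x +i* y)) * complex.Im (f (x +i* y)))); last first.
  by apply/funext => u; rewrite /normsq normcE2 !expr2.
by apply: continuousD; apply: continuousM.
Qed.

Lemma normsq_cont2 f (x y : R) : cderivable f (x +i* y) ->
  {for y, continuous (normsq f x)}.
Proof.
move=> /holo_contIm[cr ci].
rewrite (_ : normsq f x = (fun y => complex.Re (f (x +i* y)) * complex.Re (f (x +i* y))
   + complex.Im (f (x +i* y)) * complex.Im (f (x +i* y)))); last first.
  by apply/funext => u; rewrite /normsq normcE2 !expr2.
by apply: continuousD; apply: continuousM.
Qed.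

(** On a side at distance [t] from the centre, [s] is the offset along the side, [u + i v] is [f]
    times the conjugate of its central value, and [A], [n] are [|f|^2] at the centre and at the
    point. Cauchy-Schwarz gives [(t u + s v)^2 <= N A n], the arithmetic-geometric mean inequality
    turns this into [t (t u + s v) <= A N / 4 + t^2 n], and [N <= 2 t^2] does the rest. *)
Let side_bound (t s u v A n : R) : 0 < t -> s ^+ 2 <= t ^+ 2 -> 0 < A ->
  u ^+ 2 + v ^+ 2 = A * n ->
  (t * (u - A) + s * v) / (s ^+ 2 + t ^+ 2) <= (n - A / 4) / t.
Proof.
move=> t0 st A0 uv.
have t20 : 0 < t ^+ 2 by rewrite exprn_gt0.
have s20 := sqr_ge0 s.
set N := s ^+ 2 + t ^+ 2; have N0 : 0 < N by rewrite /N; lra.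
rewrite ler_pdivrMr// mulrAC ler_pdivlMr//.
have n0 : 0 <= n.
  by rewrite -(pmulr_rge0 n A0) -uv addr_ge0// sqr_ge0.
pose q := t * u + s * v.
have q2 : q ^+ 2 <= N * (A * n).
  rewrite -uv -subr_ge0 (_ : _ - _ = (t * v - s * u) ^+ 2) ?sqr_ge0//.
  by rewrite /N /q; ring.
have AN : 0 < A * N by rewrite mulr_gt0.
have key : t * q <= A * N / 4 + t ^+ 2 * n.
  rewrite -(ler_pM2l AN).
  have := sqr_ge0 (A * N / 2 - t * q).
  have : t ^+ 2 * q ^+ 2 <= t ^+ 2 * (N * (A * n)) by rewrite ler_wpM2l// ltW.
  by nra.
have tn : t ^+ 2 * n <= N * n by rewrite ler_wpM2r// /N; lra.
have AN2 : A * N <= 2 * (A * t ^+ 2).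
  by rewrite mulrCA (ler_wpM2l (ltW A0))// /N; lra.
rewrite (_ : _ * t = t * q - A * t ^+ 2); last by rewrite /q; ring.
lra.
Qed.

Let invcE (s y : R) :
  (s +i* y)^-1 = (s / (s ^+ 2 + y ^+ 2)) +i* (- (y / (s ^+ 2 + y ^+ 2))).
Proof. by []. Qed.

Let quotientE (p q a b s y : R) :
  (((- 'i) * (a +i* b)^*%C) * (p +i* q) - ((- 'i) * (a +i* b)^*%C) * (a +i* b)) / (s +i* y) =
  let u := a * p + b * q in let v := a * q - b * p in let A := a ^+ 2 + b ^+ 2 in
  ((v * s - (u - A) * y) / (s ^+ 2 + y ^+ 2)) +i* ((- (u - A) * s - v * y) / (s ^+ 2 + y ^+ 2)).
Proof.
rewrite invcE; simpc.
by congr (_ +i* _); ring.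
Qed.

(** Cauchy's formula on a square, in absolute value: the exact value of
    [\oint dz / (z - z0)] is not needed, only that its imaginary part is at least 4. *)
Lemma square_mean_value f (x0 y0 t : R) : 0 < t ->
  (forall x y, x0 - t <= x <= x0 + t -> y0 - t <= y <= y0 + t -> cderivable f (x +i* y)) ->
  2 * t * normsq f x0 y0 <=
    (linint (fun x => normsq f x (y0 - t)) (x0 - t) (x0 + t) +
     linint (fun x => normsq f x (y0 + t)) (x0 - t) (x0 + t)) +
    (linint (normsq f (x0 + t)) (y0 - t) (y0 + t) +
     linint (normsq f (x0 - t)) (y0 - t) (y0 + t)).
Proof.
move=> t0 hf.
have xx : x0 - t <= x0 + t by lra.
have yy : y0 - t <= y0 + t by lra.
have xm : x0 - t <= x0 - t <= x0 + t by rewrite lexx.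
have xp : x0 - t <= x0 + t <= x0 + t by rewrite lexx andbT.
have ym : y0 - t <= y0 - t <= y0 + t by rewrite lexx.
have yp : y0 - t <= y0 + t <= y0 + t by rewrite lexx andbT.
have c1 y : y0 - t <= y <= y0 + t -> cont_seg (fun x => normsq f x y) (x0 - t) (x0 + t).
  by move=> Hy x Hx; apply: normsq_cont1; exact: hf.
have c2 x : x0 - t <= x <= x0 + t -> cont_seg (normsq f x) (y0 - t) (y0 + t).
  by move=> Hx y Hy; apply: normsq_cont2; exact: hf.
have [A0|] := leP (normsq f x0 y0) 0.
  apply: (@le_trans _ _ 0); first by rewrite pmulr_rle0// mulr_gt0.
  by rewrite !addr_ge0// /linint; apply: Rintegral_ge0 => // u _; exact: sqr_ge0.
rewrite {1 2}/normsq; case fE : (f (x0 +i* y0)) => [a b]; rewrite normcE2/= => A0.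
set A := a ^+ 2 + b ^+ 2 in A0 *.
(* The conjugate makes the central value the real number [A] up to [- i]; the factor [- i] moves the
   imaginary part of the contour integral into the real part, which is what [cauchy_quotient]
   controls. *)
pose F z := ((- 'i) * (a +i* b)^*%C) * f z.
pose k z := (F z - F (x0 +i* y0)) / (z - (x0 +i* y0)).
have kE x y : k (x +i* y) =
  let u := a * complex.Re (f (x +i* y)) + b * complex.Im (f (x +i* y)) in
  let v := a * complex.Im (f (x +i* y)) - b * complex.Re (f (x +i* y)) in
  ((v * (x - x0) - (u - A) * (y - y0)) / ((x - x0) ^+ 2 + (y - y0) ^+ 2)) +i*
  ((- (u - A) * (x - x0) - v * (y - y0)) / ((x - x0) ^+ 2 + (y - y0) ^+ 2)).
  rewrite /k /F fE (_ : x +i* y - _ = (x - x0) +i* (y - y0))//.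
  by case: (f (x +i* y)) => p q; rewrite quotientE.
have uvE x y : (a * complex.Re (f (x +i* y)) + b * complex.Im (f (x +i* y))) ^+ 2 +
   (a * complex.Im (f (x +i* y)) - b * complex.Re (f (x +i* y))) ^+ 2 = A * normsq f x y.
  by rewrite /normsq normcE2 /A; ring.
have hF x y : x0 - t <= x <= x0 + t -> y0 - t <= y <= y0 + t -> cderivable F (x +i* y).
  by move=> Hx Hy; apply: cderivableM; [exact: cderivable_cst|exact: hf].
have did : cdiff (@id R[i]) (x0 +i* y0) 1.
  move=> e e0; exists 1 => // h _; rewrite (_ : _ - _ - _ = 0); last by ring.
  by rewrite Normc.normc0 mulr_ge0 ?normc_ge0 ?ltW.
have [||||K0 K1] := @cauchy_quotient _ F id (x0 - t) (x0 + t) (y0 - t) (y0 + t) x0 y0 1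
  _ _ hF _ _ did (oner_neq0 _).
- by apply/andP; split; lra.
- by apply/andP; split; lra.
- by move=> *; exact: cderivable_id.
- by move=> x y _ _; rewrite xpair_eqE eq_complex.
rewrite -/(k) in K0 K1.
set P := (fun x y => complex.Re (k (x +i* y))) in K0 K1.
set Q := (fun x y => - complex.Im (k (x +i* y))) in K0 K1.
have Pc y : y0 - t <= y <= y0 + t -> y != y0 -> cont_seg (fun x => P x y) (x0 - t) (x0 + t).
  move=> Hy yn; apply: (closed_hseg_cont (P := P) (Q := Q)) => x Hx; apply: K1 => //.
  by rewrite xpair_eqE negb_and yn orbT.
have Qc x : x0 - t <= x <= x0 + t -> x != x0 -> cont_seg (Q x) (y0 - t) (y0 + t).
  move=> Hx xn; apply: (closed_vseg_cont (P := P) (Q := Q)) => y Hy; apply: K1 => //.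
  by rewrite xpair_eqE negb_and xn.
have sq s w : w - t <= s <= w + t -> (s - w) ^+ 2 <= t ^+ 2.
  by move=> /andP[? ?]; rewrite -subr_ge0 subr_sqr mulr_ge0//; lra.
have sub1 w : w - t - w = - t by ring.
have sub2 w : w + t - w = t by ring.
have nm w : w - t != w by rewrite lt_eqF//; lra.
have np w : w + t != w by rewrite gt_eqF//; lra.
have B1 : linint (fun x => P x (y0 - t) - P x (y0 + t)) (x0 - t) (x0 + t) <=
   linint (fun x => t^-1 * ((normsq f x (y0 - t) + normsq f x (y0 + t)) - A / 2)) (x0 - t) (x0 + t).
  apply: linint_le => //.
  - by apply: cont_segB; apply: Pc.
  - move=> x Hx; apply: continuousM; first exact: cst_continuous.
    apply: continuousB; last exact: cst_continuous.
    by apply: continuousD; exact: c1.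
  move=> x Hx; rewrite /P !kE/= sub1 sub2 sqrrN.
  have := side_bound t0 (sq _ _ Hx) A0 (uvE x (y0 - t)).
  (* The top side is traversed backwards, so [side_bound] applies with the opposite offset. *)
  have sq' : (- (x - x0)) ^+ 2 <= t ^+ 2 by rewrite sqrrN; exact: sq.
  have := side_bound t0 sq' A0 (uvE x (y0 + t)).
  rewrite sqrrN; set N := _ / 4; move=> H1 H2.
  apply: le_trans (le_trans (lerD H1 H2) _); rewrite le_eqVlt; apply/orP; left; apply/eqP; first by ring.
  by rewrite /N; field; rewrite gt_eqF.
have B2 : linint (fun y => Q (x0 + t) y - Q (x0 - t) y) (y0 - t) (y0 + t) <=
   linint (fun y => t^-1 * ((normsq f (x0 + t) y + normsq f (x0 - t) y) - A / 2)) (y0 - t) (y0 + t).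
  apply: linint_le => //.
  - by apply: cont_segB; apply: Qc.
  - move=> x Hx; apply: continuousM; first exact: cst_continuous.
    apply: continuousB; last exact: cst_continuous.
    by apply: continuousD; exact: c2.
  move=> y Hy; rewrite /Q !kE/= sub1 sub2 sqrrN.
  have := side_bound t0 (sq _ _ Hy) A0 (uvE (x0 + t) y).
  have sq' : (- (y - y0)) ^+ 2 <= t ^+ 2 by rewrite sqrrN; exact: sq.
  have := side_bound t0 sq' A0 (uvE (x0 - t) y).
  rewrite sqrrN ![_ ^+ 2 + t ^+ 2]addrC; set N := _ / 4; move=> H1 H2.
  apply: le_trans (le_trans (lerD H1 H2) _); rewrite le_eqVlt; apply/orP; left; apply/eqP; first by ring.
  by rewrite /N; field; rewrite gt_eqF.
(* The circulation is 0, so its upper bound is nonnegative. The term [A / 4] over a boundary of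
   length [8 * t] produces the [2 * t * A] of the claim. *)
have : 0 <= linint (fun x => t^-1 * ((normsq f x (y0 - t) + normsq f x (y0 + t)) - A / 2)) (x0 - t) (x0 + t)
  + linint (fun y => t^-1 * ((normsq f (x0 + t) y + normsq f (x0 - t) y) - A / 2)) (y0 - t) (y0 + t).
  by rewrite -K0 /rect_int lerD.
have cD (g1 g2 : R -> R) u1 u2 : cont_seg g1 u1 u2 -> cont_seg g2 u1 u2 -> cont_seg (fun x => g1 x + g2 x) u1 u2.
  by move=> H1 H2 x Hx; apply: continuousD; [exact: H1|exact: H2].
rewrite !linintZ; [|apply: cont_segB; [apply: cD|exact: cont_seg_cst]; by [exact: c1|exact: c2]..].
rewrite !(linintB (g := fun=> _)); [|by [exact: cont_seg_cst|apply: cD; by [exact: c1|exact: c2]]..].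
rewrite !linintD; [|by [exact: c1|exact: c2]..].
rewrite !linint_cst// -mulrDr pmulr_rge0 ?invr_gt0//.
rewrite (_ : x0 + t - (x0 - t) = 2 * t); last by ring.
rewrite (_ : y0 + t - (y0 - t) = 2 * t); last by ring.
lra.
Qed.

End CauchyEstimates.

(** * Exponential decay of periodic functions in the cusp *)

Section PeriodicDecay.
Context {R : realType}.
Implicit Types (f g : R[i] -> R[i]) (z h l : R[i]) (x y e t w : R).
Local Notation normc := Normc.normc.

Lemma normcB_ge z h : normc z - normc h <= normc (z - h).
Proof.
have := normc_triangle (z - h) h; rewrite (_ : z - h + h = z); last by ring.
by lra.
Qed.

Lemma normcB_le z h : normc (z - h) <= normc z + normc h.
Proof. by have := normc_triangle z (- h); rewrite normcN. Qed.

Lemma cos_eq1 (t : R) : `|t| <= pi -> cos t = 1 -> t = 0.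
Proof.
move=> tpi ct; apply/eqP; rewrite -normr_eq0; apply/eqP.
apply: (@cos_inj R); rewrite ?in_itv/= ?normr_ge0 ?lexx ?pi_ge0//.
rewrite cos0 -ct; have [t0|t0] := leP 0 t; first by rewrite ger0_norm.
by rewrite ltr0_norm// cosN.
Qed.

(** Cauchy's formula with the [w]-periodic kernel [1 / (e(z / w) - e(z0 / w))]
    on a period rectangle whose upper side goes to infinity. *)
Lemma periodic_decay f (w x0 y0 y1 S : R) : 0 < w -> 0 < y1 -> y1 < y0 ->
  (forall x y, 0 < y -> cderivable f (x +i* y)) ->
  (forall x y, 0 < y -> f ((x + w) +i* y) = f (x +i* y)) ->
  vanishes_at_im_infty f ->
  (forall x, normc (f (x +i* y1)) <= S) ->
  normc (f (x0 +i* y0)) * (1 - 2 * expR (- (2 * pi / w * (y0 - y1)))) <=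
    expR (- (2 * pi / w * (y0 - y1))) * S.
Proof.
move=> w0 y10 y1y0 hf pf vf fS; set dl := expR _.
have dl0 : 0 < dl by exact: expR_gt0.
have S0 : 0 <= S := le_trans (normc_ge0 _) (fS x0).
set n0 := normc (f (x0 +i* y0)).
have [n00|n0p] := eqVneq n0 0; first by rewrite n00 mul0r mulr_ge0// ltW.
have {}n0p : 0 < n0 by rewrite lt_neqAle eq_sym n0p normc_ge0.
set A := n0 ^+ 2; have A0 : 0 < A by rewrite exprn_gt0.
pose kap : R := 2 * pi / w.
have kap0 : 0 < kap by rewrite divr_gt0// mulr_gt0// pi_gt0.
have dl1 : dl < 1 by rewrite -[ltRHS]expR0 ltr_expR oppr_lt0 mulr_gt0// subr_gt0.
pose c := (f (x0 +i* y0))^*%C.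
have nc : normc c = n0 by rewrite /c /n0; case: (f _) => a b /=; rewrite sqrrN.
pose F z := c * f z.
have nF z : normc (F z) = n0 * normc (f z) by rewrite /F Normc.normcM nc.
have F0 : F (x0 +i* y0) = A%:C.
  by rewrite /F /c /A /n0; case: (f _) => a b; rewrite normcE2/=; simpc; congr (_ +i* _); ring.
(* The local coordinate [e(z / w)] at the cusp, normalized to the value 1 at [z0]; its modulus is
   [1 / dl] at height [y1] and tends to 0 upwards. *)
pose g z := cexp ((0 +i* kap) * (z - (x0 +i* y0))).
have gE x y : g (x +i* y) = (expR (- (kap * (y - y0))) * cos (kap * (x - x0))) +i*
     (expR (- (kap * (y - y0))) * sin (kap * (x - x0))).
  rewrite /g (_ : _ * _ = (- (kap * (y - y0))) +i* (kap * (x - x0)))//.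
  by simpc; rewrite ?mul0r; congr (_ +i* _); ring.
have g0 : g (x0 +i* y0) = 1.
  by rewrite gE !subrr mulr0 oppr0 expR0 cos0 sin0 mulr1 mulr0.
have ng x y : normc (g (x +i* y)) = expR (- (kap * (y - y0))).
  rewrite /g (_ : _ * _ = (- (kap * (y - y0))) +i* (kap * (x - x0))); last first.
    by simpc; rewrite ?mul0r; congr (_ +i* _); ring.
  by rewrite normc_cexp.
have gp x y : g ((x + w) +i* y) = g (x +i* y).
  rewrite !gE (_ : kap * (x + w - x0) = kap * (x - x0) + pi *+ 2).
    by rewrite cosD2pi sinD2pi.
  by rewrite /kap -mulr_natl; field; rewrite gt_eqF.
(* For a top side at finite height the comparison of bottom and top holds up to an error of order
   [e]. In the limit, dividing by [n0] gives [n0 (1 - dl) <= dl (S + n0)], which is the claim. *)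
suff main e : 0 < e -> e < 1 -> A * (1 - dl) <= dl * (S * n0 + A) + 6 * (A * e) * (1 - dl).
  have {}main : A * (1 - dl) <= dl * (S * n0 + A).
    rewrite leNgt; apply/negP => lt.
    set D := A * (1 - dl) - dl * (S * n0 + A).
    have D0 : 0 < D by rewrite /D; lra.
    have K0 : 0 < 6 * A * (1 - dl) by rewrite !mulr_gt0//; lra.
    pose e := Num.min (1 / 2) (D / (6 * A * (1 - dl)) / 2).
    have e0 : 0 < e by rewrite lt_min !divr_gt0.
    have e1 : e < 1 by rewrite gt_min; apply/orP; left; lra.
    have := main _ e0 e1.
    have : 6 * A * (1 - dl) * e <= D / 2.
      rewrite -ler_pdivlMl//; apply: (@le_trans _ _ (D / (6 * A * (1 - dl)) / 2)).
        by rewrite ge_min lexx orbT.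
      by rewrite le_eqVlt; apply/orP; left; apply/eqP; field; rewrite !gt_eqF//; lra.
    rewrite /D in D0 *; lra.
  rewrite -(ler_pM2l n0p).
  rewrite (_ : n0 * (n0 * (1 - 2 * dl)) = A * (1 - dl) - dl * A); last by rewrite /A; ring.
  lra.
move=> e0 e1.
have [Y1 HY1] := vf (e * n0) (mulr_gt0 e0 n0p).
(* At this height [|F| <= A * e], and [expR t >= 1 + t] with [t >= 1 / e] gives
   [eta <= e / (1 + e)]. *)
pose Y := Num.max (Y1) (y0 + 1 / (kap * e)).
have Yy0 : y0 + 1 / (kap * e) <= Y by rewrite le_max lexx orbT.
have ke0 : 0 < 1 / (kap * e) by rewrite divr_gt0// mulr_gt0.
have y0Y : y0 < Y by lra.
pose eta := expR (- (kap * (Y - y0))).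
have eta0 : 0 < eta by exact: expR_gt0.
have etae : eta <= e / (1 + e).
  have : 1 / e <= kap * (Y - y0).
    rewrite -ler_pdivrMl//; apply: (@le_trans _ _ (1 / (kap * e))); last lra.
    by rewrite le_eqVlt; apply/orP; left; apply/eqP; field; rewrite !gt_eqF.
  move=> H1; have H2 := expR_ge1Dx (kap * (Y - y0)).
  have H3 : 1 + 1 / e <= expR (kap * (Y - y0)) by lra.
  have e1p : 0 < 1 + 1 / e by rewrite addr_gt0// divr_gt0.
  rewrite /eta expRN; apply: (@le_trans _ _ (1 + 1 / e)^-1).
    by rewrite lef_pV2 ?posrE ?expR_gt0.
  by rewrite le_eqVlt; apply/orP; left; apply/eqP; field; rewrite !gt_eqF//; lra.
have wab : x0 - w / 2 < x0 < x0 + w / 2 by apply/andP; split; lra.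
have ycd : y1 < y0 < Y by apply/andP; split.
have gc : cdiff g (x0 +i* y0) (0 +i* kap).
  move=> e' e'0; have [|d d0 Hd] := @cdiff_cexp0 R (e' / kap); first by rewrite divr_gt0.
  exists (d / kap); first by rewrite divr_gt0.
  move=> h hd; have nk : normc ((0 +i* kap) * h) = kap * normc h.
    by rewrite Normc.normcM /= expr0n/= add0r sqrtr_sqr gtr0_norm.
  have hd' : normc ((0 +i* kap) * h) < d by rewrite nk mulrC -ltr_pdivlMr.
  have := Hd _ hd'; rewrite nk add0r mul1r g0.
  have -> : cexp 0 = 1 :> R[i] by rewrite /cexp/= expR0 cos0 sin0 mulr1 mulr0.
  rewrite mulrA divfK ?gt_eqF// => {}Hd.
  by rewrite /g (_ : x0 +i* y0 + h - _ = h)//; ring.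
have hg z : cderivable g z.
  apply: (@cderivable_comp _ cexp); first exact: cderivable_cexp.
  apply: cderivableM; first exact: cderivable_cst.
  by apply: cderivableB; [exact: cderivable_id|exact: cderivable_cst].
(* The modulus of [g] fixes [y]. Then the angle has absolute value at most [pi], even on the closed
   rectangle, and the only such angle with cosine 1 is 0. *)
have ginj x y : x0 - w / 2 <= x <= x0 + w / 2 -> y1 <= y <= Y ->
    (x, y) != (x0, y0) -> g (x +i* y) != g (x0 +i* y0).
  move=> /andP[xa xb] _; apply: contra => /eqP gg.
  have : normc (g (x +i* y)) = 1 by rewrite gg g0 Normc.normc1.
  rewrite ng -expR0 => /expR_inj/eqP; rewrite oppr_eq0 mulf_eq0 gt_eqF//= subr_eq0 => /eqP yy.
  move: gg; rewrite g0 gE yy subrr mulr0 oppr0 expR0 !mul1r => -[cc _].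
  have tp : `|kap * (x - x0)| <= pi.
    rewrite normrM gtr0_norm// /kap (_ : 2 * pi / w * _ = pi * (2 / w * `|x - x0|)); last by ring.
    rewrite -[leRHS]mulr1 ler_wpM2l ?pi_ge0// mulrAC ler_pdivrMr// mul1r.
    have : `|x - x0| <= w / 2 by rewrite ler_norml; apply/andP; split; lra.
    lra.
  have /eqP := cos_eq1 tp cc; rewrite mulf_eq0 gt_eqF//= subr_eq0 => /eqP ->.
  by [].
have kap_n0 : (0 +i* kap : R[i]) != 0 by rewrite eq_complex/= eqxx/= gt_eqF.
have hF x y : x0 - w / 2 <= x <= x0 + w / 2 -> y1 <= y <= Y -> cderivable F (x +i* y).
  move=> _ /andP[yy1 _]; apply: cderivableM; first exact: cderivable_cst.
  by apply: hf; lra.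
have [K0 K1] := @cauchy_quotient _ F g _ _ _ _ x0 y0 _ wab ycd hF (fun x y _ _ => hg _) ginj gc kap_n0.
rewrite g0 F0 in K0 K1.
pose k z := (F z - A%:C) / (g z - 1).
have kp x y : 0 < y -> k ((x + w) +i* y) = k (x +i* y).
  by move=> yp; rewrite /k /F gp pf.
set P := (fun x y => complex.Re (k (x +i* y))) in K0 K1.
set Q := (fun x y => - complex.Im (k (x +i* y))) in K0 K1.
have ab : x0 - w / 2 <= x0 + w / 2 by lra.
have yY : y1 <= Y by lra.
have Pc y : y1 <= y <= Y -> y != y0 -> cont_seg (fun x => P x y) (x0 - w / 2) (x0 + w / 2).
  move=> Hy yn; apply: (closed_hseg_cont (P := P) (Q := Q)) => x Hx; apply: K1 => //.
  by rewrite xpair_eqE negb_and yn orbT.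
have Pc1 : cont_seg (fun x => P x y1) (x0 - w / 2) (x0 + w / 2).
  by apply: Pc; [rewrite lexx|rewrite lt_eqF].
have Pc2 : cont_seg (fun x => P x Y) (x0 - w / 2) (x0 + w / 2).
  by apply: Pc; [rewrite lexx andbT|rewrite gt_eqF].
(* By periodicity the two vertical sides cancel, so the bottom and top integrals of [Re k] agree. *)
have vert : linint (fun y => Q (x0 + w / 2) y - Q (x0 - w / 2) y) y1 Y = 0.
  rewrite (@eq_linint _ _ (fun=> 0)); first by rewrite linint_cst// mul0r.
  move=> y /andP[yy1 _]; rewrite /Q (_ : x0 + w / 2 = x0 - w / 2 + w); last by lra.
  by rewrite kp ?subrr//; lra.
move: K0; rewrite /rect_int vert addr0 linintB// => /eqP; rewrite subr_eq0 => /eqP PP.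
have AC : normc A%:C = A by rewrite normc_real gtr0_norm.
have bot : linint (fun x => P x y1) (x0 - w / 2) (x0 + w / 2) <=
   linint (fun=> dl * (S * n0 + A) / (1 - dl)) (x0 - w / 2) (x0 + w / 2).
  apply: linint_le => //; first exact: cont_seg_cst.
  move=> x _; apply: le_trans (ler_norm _) _; apply: le_trans (normc_geRe _) _.
  rewrite /k Normc.normcM Normc.normcV.
  have gl : dl^-1 - 1 <= normc (g (x +i* y1) - 1).
    have := normcB_ge (g (x +i* y1)) 1; rewrite ng Normc.normc1; apply: le_trans.
    rewrite lerD2r /dl -expRN opprK ler_expR le_eqVlt; apply/orP; left; apply/eqP.
    by rewrite /kap; ring.
  have dp : 0 < dl^-1 - 1 by rewrite subr_gt0 invf_gt1.
  have dE : dl / (1 - dl) = (dl^-1 - 1)^-1 by clear - dl0 dl1; field; rewrite !gt_eqF//; lra.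
  rewrite mulrAC mulrC dE; apply: ler_pM; rewrite ?normc_ge0 ?invr_ge0 ?normc_ge0//.
    by rewrite lef_pV2 ?posrE// (lt_le_trans dp).
  apply: le_trans (normcB_le _ _) _; rewrite AC lerD2r nF mulrC.
  by rewrite ler_wpM2r// ltW.
have top : linint (fun=> A - 6 * (A * e)) (x0 - w / 2) (x0 + w / 2) <=
   linint (fun x => P x Y) (x0 - w / 2) (x0 + w / 2).
  apply: linint_le => //; first exact: cont_seg_cst.
  move=> x _; rewrite /P.
  have nf : normc (F (x +i* Y)) <= A * e.
    rewrite nF /A expr2 -mulrA (ler_wpM2l (ltW n0p))// mulrC HY1//=; last by rewrite le_max lexx.
    by rewrite /upper_half/=; lra.
  set G := g (x +i* Y).
  have nG : normc G = eta by rewrite /G ng.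
  have e1' : 0 < 1 + e by rewrite addr_gt0.
  have eta_e : eta * (1 + e) <= e by rewrite -ler_pdivlMr.
  have ge1 : 1 - eta <= normc (G - 1).
    by have := normcB_ge 1 G; rewrite nG Normc.normc1 -[G - 1]opprB normcN.
  have eta1 : 0 < 1 - eta by clear - e0 eta_e e1'; nra.
  have G1 : G - 1 != 0 by rewrite -normc_gt0 (lt_le_trans eta1).
  (* Since [1 / (G - 1) = - 1 + G / (G - 1)], the quotient [k] differs from [A - F] by a multiple of
     [G], hence is close to [A] high up. *)
  have kk : k (x +i* Y) - (A%:C - F (x +i* Y)) = (F (x +i* Y) - A%:C) * G / (G - 1).
    by rewrite /k -/G; field.
  have kb : normc (k (x +i* Y) - (A%:C - F (x +i* Y))) <= (A * e + A) * e.
    rewrite kk !Normc.normcM Normc.normcV nG -mulrA; apply: ler_pM; rewrite ?normc_ge0//.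
    - by rewrite mulr_ge0 ?invr_ge0 ?normc_ge0// ltW.
    - by apply: le_trans (normcB_le _ _) _; rewrite AC lerD2r.
    rewrite ler_pdivrMr; last by rewrite normc_gt0.
    apply: (@le_trans _ _ (e * (1 - eta))); first by clear - e0 eta0 eta_e; nra.
    by rewrite ler_wpM2l// ltW.
  have Rk : complex.Re (k (x +i* Y)) = A - complex.Re (F (x +i* Y)) +
      complex.Re (k (x +i* Y) - (A%:C - F (x +i* Y))).
    by rewrite !ReB/=; ring.
  have R1 := le_trans (ler_norm _) (le_trans (normc_geRe (F (x +i* Y))) nf).
  have := le_trans (normc_geRe (k (x +i* Y) - (A%:C - F (x +i* Y)))) kb.
  rewrite ler_norml => /andP[R2 _].
  have Ae : A * e * e <= A * e * 1 by rewrite ler_wpM2l ?ltW// mulr_gt0.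
  have Ae0 : 0 < A * e by rewrite mulr_gt0.
  by rewrite Rk; clear - R1 R2 Ae Ae0; lra.
have := le_trans top (eq_ind _ (fun t => t <= _) bot _ PP).
rewrite !linint_cst//; rewrite (_ : x0 + w / 2 - (x0 - w / 2) = w); last by lra.
rewrite ler_pM2r// ler_pdivlMr ?subr_gt0//.
by move: (A * e) => t; clear; lra.
Qed.

End PeriodicDecay.

(** * From mean values over sides of squares to area integrals *)

Section AreaBound.
Context {R : realType}.
Local Notation mR := (measurableTypeR R).
Local Notation mu := (@lebesgue_measure R).
Implicit Types (f : R[i] -> R[i]).

(** A separately continuous function is the limit of the functions obtained by
    rounding the first variable, which are piecewise functions of the second. *)
Lemma measurable_separately_continuous (u : R -> R -> R) :
  (forall x y : R, 0 < y -> {for x, continuous (fun x => u x y)}) ->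
  (forall x y : R, 0 < y -> {for y, continuous (u x)}) ->
  measurable_fun [set: mR * mR] (fun p : mR * mR => if 0 < p.2 then u p.1 p.2 else 0).
Proof.
move=> c1 c2.
have mg x : measurable_fun [set: mR] (fun y : mR => if 0 < y then u x y else 0).
  have -> : (fun y : mR => if 0 < y then u x y else 0) = (u x : mR -> mR) \_ `]0, +oo[.
    apply/funext => y; rewrite patchE; case: ifPn => y0.
      by rewrite mem_set//= in_itv/= y0.
    by rewrite memNset//= in_itv/= andbT; exact/negP.
  apply/(measurable_restrictT _ _).1 => //.
  apply: open_continuous_measurable_fun; first exact: interval_open.
  by move=> y; rewrite inE/= in_itv/= andbT; exact: c2.
pose rd (n : nat) (x : R) : R := (Num.floor (n.+1%:R * x))%:~R / n.+1%:R.
apply: (@measurable_fun_cvg _ _ _ _ (fun n (p : mR * mR) => if 0 < p.2 then u (rd n p.1) p.2 else 0)).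
  move=> n.
  pose E i : set (mR * mR) := if (unpickle i : option int) is Some k
    then [set p | Num.floor (n.+1%:R * p.1) = k] else set0.
  have -> : [set: mR * mR] = \bigcup_i E i.
    apply/esym; rewrite -subTset => p _; exists (pickle (Num.floor (n.+1%:R * p.1))); first by [].
    by rewrite /E pickleK.
  have mE i : measurable (E i).
    rewrite /E; case: unpickle => // k.
    rewrite (_ : [set p : mR * mR | _] = `[k%:~R / n.+1%:R, (k + 1)%:~R / n.+1%:R[%classic `*` setT).
      exact: measurableX.
    apply/seteqP; split => -[x y] /=; rewrite in_itv/= ler_pdivrMr// ltr_pdivlMr// ![x * _]mulrC.
      by move=> <-; split => //; rewrite floor_le_tmp floorD1_gt.
    by move=> [/floor_def].
  apply/measurable_fun_bigcup => // i; rewrite /E; case: unpickle => [k|]; last first.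
    exact: measurable_fun_set0.
  apply: (@eq_measurable_fun _ _ _ _ _ (fun p : mR * mR => if 0 < p.2 then u (k%:~R / n.+1%:R) p.2 else 0)).
    by move=> p; rewrite inE /rd /= => ->.
  by apply: measurable_funTS; apply: (measurableT_comp (mg (k%:~R / n.+1%:R))).
move=> [x y] _ /=; have [y0|y0] := ltP 0 y; last exact: cvg_cst.
apply: (@cvg_comp _ _ _ (fun n => rd n x) (u^~ y) _ (nbhs x)); last exact: c1.
apply/cvgrPdist_le => e e0.
near=> n.
have n0 : 0 < n.+1%:R :> R by [].
have : `|x - rd n x| <= n.+1%:R^-1.
  rewrite /rd; have := floor_le_tmp (n.+1%:R * x); have := floorD1_gt (n.+1%:R * x).
  set k := Num.floor _; rewrite intrD => H1 H2.
  rewrite (_ : x - _ = (n.+1%:R * x - k%:~R) / n.+1%:R); last by field; rewrite gt_eqF.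
  rewrite normrM [`|_^-1|]ger0_norm ?invr_ge0// -[leRHS]mul1r ler_wpM2r ?invr_ge0//.
  by rewrite ler_norml; apply/andP; split; lra.
move=> /le_trans; apply; apply: ltW; near: n; exact: (near_infty_natSinv_lt (PosNum e0)).
Unshelve. all: by end_near. Qed.

Local Open Scope ereal_scope.

Let linint_le_integral (g : R -> R) (h : mR -> \bar R) (a b : R) :
  cont_seg g a b -> measurable_fun [set: mR] h -> (forall x, 0 <= h x) ->
  (forall x, (a <= x <= b)%R -> (0 <= g x)%R /\ (g x)%:E <= h x) ->
  (linint g a b)%:E <= \int[mu]_x h x.
Proof.
move=> cg mh h0 gh; have ig := cont_seg_integrable cg.
rewrite /linint /Rintegral fineK; last exact: integrable_fin_num.
apply: (@le_trans _ _ (\int[mu]_(x in `[a, b]) h x)).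
  apply: ge0_le_integral => //.
  - by move=> x /=; rewrite in_itv/= lee_fin => /gh[].
  - by case/integrableP: ig.
  - exact: measurable_funTS.
  - by move=> x /=; rewrite in_itv/= => /gh[].
exact: ge0_subset_integral.
Qed.

Let integral_sum4 (h1 h2 h3 h4 : mR -> \bar R) :
  measurable_fun [set: mR] h1 -> measurable_fun [set: mR] h2 ->
  measurable_fun [set: mR] h3 -> measurable_fun [set: mR] h4 ->
  (forall x, 0 <= h1 x) -> (forall x, 0 <= h2 x) ->
  (forall x, 0 <= h3 x) -> (forall x, 0 <= h4 x) ->
  \int[mu]_x ((h1 x + h2 x) + (h3 x + h4 x)) =
  (\int[mu]_x h1 x + \int[mu]_x h2 x) + (\int[mu]_x h3 x + \int[mu]_x h4 x).
Proof.
move=> m1 m2 m3 m4 p1 p2 p3 p4.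
rewrite ge0_integralD//.
- by rewrite !ge0_integralD.
- by move=> x _; exact: adde_ge0.
- exact: emeasurable_funD.
- by move=> x _; exact: adde_ge0.
- exact: emeasurable_funD.
Qed.

(** [square_mean_value] is integrated over half-sides [t] in [[r / 2, r]], where [2 * t >= r]. As
    [t] varies, each of the four sides sweeps out part of the plane, so by Tonelli the right-hand
    sides total at most [4] integrals of [phi]; the left gives [r * n * (r / 2)]. *)
Lemma area_bound f (x0 y0 r : R) (phi : mR * mR -> \bar R) : (0 < r)%R ->
  (forall x y, x0 - r <= x <= x0 + r -> y0 - r <= y <= y0 + r -> cderivable f (x +i* y))%R ->
  measurable_fun [set: mR * mR] phi -> (forall p, 0 <= phi p) ->
  (forall x y, (x0 - r <= x <= x0 + r)%R -> (y0 - r <= y <= y0 + r)%R ->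
     (normsq f x y)%:E <= phi (x, y)) ->
  (r ^+ 2 * normsq f x0 y0)%:E <= 8%:E * \int[(mu \x mu)%E]_p phi p.
Proof.
move=> r0 hf mphi phi0 nphi.
have mphi1 y : measurable_fun [set: mR] (fun x : mR => phi (x, y)).
  by apply: (measurableT_comp mphi); exact: measurable_fun_pair.
have mphi2 x : measurable_fun [set: mR] (fun y : mR => phi (x, y)).
  by apply: (measurableT_comp mphi); exact: measurable_fun_pair.
pose G y := \int[mu]_x phi (x, y); pose F x := \int[mu]_y phi (x, y).
have mG : measurable_fun [set: mR] G by exact: (measurable_fun_fubini_tonelli_G _ mphi phi0).
have mF : measurable_fun [set: mR] F by exact: (measurable_fun_fubini_tonelli_F _ mphi phi0).
have G0 y : 0 <= G y by exact: integral_ge0.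
have F0 x : 0 <= F x by exact: integral_ge0.
set n := normsq f x0 y0.
set I := \int[(mu \x mu)%E]_p phi p.
pose S (t : mR) := (G (- t + y0)%R + G (t + y0)%R) + (F (t + x0)%R + F (- t + x0)%R).
have pw t : `[(r / 2)%R, r]%classic t -> (r * n)%:E <= S t.
  move=> /=; rewrite in_itv/= => /andP[rt tr].
  have t0 : (0 < t)%R by lra.
  have hf' x y : (x0 - t <= x <= x0 + t -> y0 - t <= y <= y0 + t -> cderivable f (x +i* y))%R.
    by move=> /andP[? ?] /andP[? ?]; apply: hf; apply/andP; split; lra.
  have := square_mean_value t0 hf'; rewrite -/n => sq.
  have n0 : (0 <= n)%R by exact: sqr_ge0.
  apply: (@le_trans _ _ (2 * t * n)%:E); first by rewrite lee_fin ler_wpM2r//; lra.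
  move: sq; rewrite -lee_fin => /le_trans; apply.
  rewrite !EFinD; apply: leeD; apply: leeD; apply: linint_le_integral => //.
  - by move=> x Hx; apply: normsq_cont1; apply: hf' => //; apply/andP; split; lra.
  - move=> x /andP[? ?]; split; first exact: sqr_ge0.
    by rewrite [(- t + y0)%R]addrC; apply: nphi; apply/andP; split; lra.
  - by move=> x Hx; apply: normsq_cont1; apply: hf' => //; apply/andP; split; lra.
  - move=> x /andP[? ?]; split; first exact: sqr_ge0.
    by rewrite [(t + y0)%R]addrC; apply: nphi; apply/andP; split; lra.
  - by move=> x Hx; apply: normsq_cont2; apply: hf' => //; apply/andP; split; lra.
  - move=> x /andP[? ?]; split; first exact: sqr_ge0.
    by rewrite [(t + x0)%R]addrC; apply: nphi; apply/andP; split; lra.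
  - by move=> x Hx; apply: normsq_cont2; apply: hf' => //; apply/andP; split; lra.
  - move=> x /andP[? ?]; split; first exact: sqr_ge0.
    by rewrite [(- t + x0)%R]addrC; apply: nphi; apply/andP; split; lra.
have mshift (H : mR -> \bar R) (b : R) : measurable_fun [set: mR] H ->
    measurable_fun [set: mR] (fun t => H (t + b)%R).
  by move=> mH; apply: (measurableT_comp mH); exact: measurable_funD.
have mopp (H : mR -> \bar R) (b : R) : measurable_fun [set: mR] H ->
    measurable_fun [set: mR] (fun t => H (- t + b)%R).
  by move=> mH; apply: (measurableT_comp mH); exact: measurable_funD.
have iopp (H : mR -> \bar R) (b : R) : measurable_fun [set: mR] H -> (forall t, 0 <= H t) ->
    \int[mu]_t H (- t + b)%R = \int[mu]_t H t.
  move=> mH H0; rewrite (integral_opp (f := fun t => H (t + b)%R))//; last exact: mshift.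
  exact: integral_shift.
have IG : \int[mu]_t G t = I by rewrite /I fubini_tonelli2.
have IF : \int[mu]_t F t = I by rewrite /I fubini_tonelli1.
have IS : \int[mu]_t S t = 4%:E * I.
  rewrite [LHS]integral_sum4//; [|exact: mopp|exact: mshift|exact: mshift|exact: mopp].
  rewrite !iopp// !integral_shift// IG IF.
  have I0 : 0 <= I by exact: integral_ge0.
  by rewrite (_ : 4%:E = (1 + 1)%:E + (1 + 1)%:E) ?EFinD ?ge0_muleDl ?mul1e ?adde_ge0//;
    rewrite -EFinD; congr (_%:E); ring.
have : (r * n * (r / 2))%:E <= 4%:E * I.
  rewrite -IS.
  apply: (@le_trans _ _ (\int[mu]_(t in `[(r / 2)%R, r]) (r * n)%:E)).
    rewrite integral_cst//= [X in _ * X](lebesgue_measure_itv `[(r / 2)%R, r]).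
    rewrite /= lte_fin ifT; last lra.
    rewrite -EFinB -EFinM lee_fin le_eqVlt; apply/orP; left; apply/eqP.
    by field.
  have mS : measurable_fun [set: mR] S.
    apply: emeasurable_funD; apply: emeasurable_funD; by [exact: mopp|exact: mshift].
  have S0 t : 0 <= S t by apply: adde_ge0; apply: adde_ge0; [exact: G0|exact: G0|exact: F0|exact: F0].
  apply: (@le_trans _ _ (\int[mu]_(t in `[(r / 2)%R, r]) S t)).
    apply: ge0_le_integral => //.
    - by move=> t _; rewrite lee_fin mulr_ge0 ?sqr_ge0// ltW.
    - exact: measurable_funTS.
  exact: ge0_subset_integral.
move=> H; rewrite (_ : (r ^+ 2 * n)%:E = 2%:E * (r * n * (r / 2))%:E); last first.
  by rewrite -EFinM; congr (_%:E); field.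
rewrite (_ : 8%:E = 2%:E * 4%:E); last by rewrite -EFinM; congr (_%:E); ring.
by rewrite -muleA lee_pmul2l.
Qed.

End AreaBound.

(** * The modular group *)

Section ModularMatrices.
Implicit Types (g h : 'M[int]_2) (a b c d : int).

Definition mk2 a b c d : 'M[int]_2 :=
  \matrix_(i < 2, j < 2) if i == 0 then (if j == 0 then a else b)
                         else (if j == 0 then c else d).

(** A product of equations rather than a conjunction, so that [rewrite] takes the four as one
    multirule. *)
Lemma mk2E a b c d :
  ((mk2 a b c d 0 0 = a)%R * (mk2 a b c d 0 1 = b)%R *
   (mk2 a b c d 1 0 = c)%R * (mk2 a b c d 1 1 = d)%R)%type.
Proof. by rewrite !mxE. Qed.

Lemma mx2_eq g h : g 0 0 = h 0 0 -> g 0 1 = h 0 1 -> g 1 0 = h 1 0 ->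
  g 1 1 = h 1 1 -> g = h.
Proof.
move=> e1 e2 e3 e4; apply/matrixP => i j.
have ordP (k : 'I_2) : k = 0 \/ k = 1.
  by case: k => -[|[|//]] ?; [left|right]; exact: val_inj.
by case: (ordP i) => ->; case: (ordP j) => ->.
Qed.

Lemma mulmx2E g h :
  (((g *m h) 0 0 = g 0 0 * h 0 0 + g 0 1 * h 1 0)%R *
   ((g *m h) 0 1 = g 0 0 * h 0 1 + g 0 1 * h 1 1)%R *
   ((g *m h) 1 0 = g 1 0 * h 0 0 + g 1 1 * h 1 0)%R *
   ((g *m h) 1 1 = g 1 0 * h 0 1 + g 1 1 * h 1 1)%R)%type.
Proof.
have o1 : lift ord0 ord0 = 1 :> 'I_2 by exact: val_inj.
by rewrite !mxE !big_ord_recl !big_ord0 !addr0 /= !o1.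
Qed.

Lemma SL2ZP g : SL2Z g <-> g 0 0 * g 1 1 - g 0 1 * g 1 0 = 1.
Proof.
suff -> : SL2Z g = (g 0 0 * g 1 1 - g 0 1 * g 1 0 = 1) by [].
rewrite /SL2Z/= (expand_det_row _ 0) !big_ord_recl big_ord0 /cofactor !det_mx11 !mxE/=.
have o1 : lift 0 0 = 1 :> 'I_2 by exact: val_inj.
have o0 : lift 1 0 = 0 :> 'I_2 by exact: val_inj.
rewrite -[lift ord0 ord0]/(lift 0 0) -[lift ord0 0]/(lift 0 0) !o1 o0 /bump/=.
by congr (_ = _); rewrite addr0 addn0 expr0 mul1r expr1 mulN1r mulrN.
Qed.

Lemma SL2Z_mul g h : SL2Z g -> SL2Z h -> SL2Z (g *m h).
Proof. by rewrite /SL2Z/= det_mulmx => -> ->; rewrite mulr1. Qed.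

Lemma SL2Z1 : SL2Z 1%:M.
Proof. by rewrite /SL2Z/= det1. Qed.

Lemma SL2Z_unit g : SL2Z g -> g \in unitmx.
Proof. by rewrite unitmxE => ->; rewrite unitr1. Qed.

Lemma SL2Z_inv g : SL2Z g -> SL2Z (invmx g).
Proof. by rewrite /SL2Z/= det_inv => ->; rewrite invr1. Qed.

Lemma invmx2E g : SL2Z g -> invmx g = mk2 (g 1 1) (- g 0 1) (- g 1 0) (g 0 0).
Proof.
move=> Sg; have ug := SL2Z_unit Sg; have /SL2ZP dg := Sg.
rewrite -[RHS]mul1mx -(mulVmx ug) -mulmxA.
rewrite (_ : g *m _ = 1%:M) ?mulmx1//.
by apply: mx2_eq; rewrite !mulmx2E !mk2E !mxE/=; lia.
Qed.

Definition transl (n : int) : 'M[int]_2 := mk2 1 n 0 1.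

Lemma SL2Z_transl n : SL2Z (transl n).
Proof. by apply/SL2ZP; rewrite !mk2E; lia. Qed.

Lemma transl_mul m n : transl m *m transl n = transl (m + n).
Proof. by apply: mx2_eq; rewrite !mulmx2E !mk2E; lia. Qed.

(** [h g^-1] is upper triangular unipotent, and the witness is its upper right entry. *)
Lemma SL2Z_bottom_row g h : SL2Z g -> SL2Z h -> g 1 0 = h 1 0 -> g 1 1 = h 1 1 ->
  exists n, h = transl n *m g.
Proof.
move=> Sg Sh e1 e2; exists (g 0 0 * h 0 1 - g 0 1 * h 0 0).
move/SL2ZP : Sg => dg; move/SL2ZP : Sh => dh; rewrite -e1 -e2 in dh.
apply: mx2_eq; rewrite !mulmx2E !mk2E -?e1 -?e2.
- transitivity (g 0 0 * (h 0 0 * g 1 1 - h 0 1 * g 1 0) + (g 0 0 * h 0 1 - g 0 1 * h 0 0) * g 1 0 + h 0 0 * (1 - (g 0 0 * g 1 1 - g 0 1 * g 1 0))); last by rewrite dh dg; ring.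
  by ring.
- transitivity (g 0 1 * (h 0 0 * g 1 1 - h 0 1 * g 1 0) + (g 0 0 * h 0 1 - g 0 1 * h 0 0) * g 1 1 + h 0 1 * (1 - (g 0 0 * g 1 1 - g 0 1 * g 1 0))); last by rewrite dh dg; ring.
  by ring.
- by ring.
- by ring.
Qed.

(** [h T^n h^-1 - 1] is [n] times an integral matrix. This gives every cusp of a congruence subgroup
    a finite width. *)
Lemma principal_conj (q : nat) h n : SL2Z h -> (q %| n)%Z ->
  principal_subgroup q (h *m transl n *m invmx h).
Proof.
move=> Sh qn; split; first by do 2?[apply: SL2Z_mul] => //; [exact: SL2Z_transl|exact: SL2Z_inv].
have /SL2ZP dh := Sh.
have -> : h *m transl n *m invmx h = mk2 (1 - h 0 0 * h 1 0 * n) (h 0 0 ^+ 2 * n)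
    (- h 1 0 ^+ 2 * n) (1 + h 0 0 * h 1 0 * n).
  rewrite invmx2E//; apply: mx2_eq; rewrite !mulmx2E !mk2E.
  - by rewrite -[in RHS]dh; ring.
  - by ring.
  - by ring.
  - by rewrite -[in RHS]dh; ring.
have qk k : (q%:Z %| k * n)%Z by exact: dvdz_mull.
have ordP (k : 'I_2) : k = 0 \/ k = 1.
  by case: k => -[|[|//]] ?; [left|right]; exact: val_inj.
move=> i j; apply/eqP; rewrite eqz_mod_dvd.
by case: (ordP i) => ->; case: (ordP j) => ->; rewrite mk2E mxE/= ?subr0 //;
  [rewrite addrAC subrr add0r -mulNr|rewrite addrAC subrr add0r]; exact: qk.
Qed.

End ModularMatrices.

Section Moebius.
Context {R : realType}.
Implicit Types (z : R[i]) (f : R[i] -> R[i]) (g h : 'M[int]_2).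
Local Notation normc := Normc.normc.

Lemma automorphy_neq0 g z : SL2Z g -> upper_half z -> automorphy g z != 0.
Proof.
move=> /SL2ZP dg; case: z => x y; rewrite /upper_half/= => y0.
rewrite /automorphy.
have -> : (g 1 0)%:~R * (x +i* y) + (g 1 1)%:~R =
   ((g 1 0)%:~R * x + (g 1 1)%:~R) +i* ((g 1 0)%:~R * y) :> R[i].
  by rewrite -!(rmorph_int (real_complex R)) /=; simpc.
rewrite eq_complex/= negb_and orbC mulf_eq0 (gt_eqF y0) orbF.
have [c0|c0] := eqVneq (g 1 0) 0; last by rewrite intr_eq0 c0.
rewrite c0 mul0r add0r eqxx/=.
by rewrite intr_eq0; apply/eqP => d0; move: dg; rewrite c0 d0; lia.
Qed.

Lemma moebius_mul g h z : SL2Z g -> SL2Z h -> automorphy h z != 0 ->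
  automorphy (g *m h) z = automorphy g (moebius h z) * automorphy h z /\
  moebius (g *m h) z = moebius g (moebius h z).
Proof.
move=> Sg Sh h0.
have mE : moebius h z * automorphy h z = (h 0 0)%:~R * z + (h 0 1)%:~R.
  by rewrite /moebius divfK.
have e1 : automorphy (g *m h) z = automorphy g (moebius h z) * automorphy h z.
  rewrite [in RHS]/automorphy mulrDl -mulrA mE /automorphy !mulmx2E !rmorphD !rmorphM/=.
  by ring.
have num : ((g *m h) 0 0)%:~R * z + ((g *m h) 0 1)%:~R =
   ((g 0 0)%:~R * moebius h z + (g 0 1)%:~R) * automorphy h z.
  rewrite mulrDl -mulrA mE /automorphy !mulmx2E !rmorphD !rmorphM/=.
  by ring.
split => //; rewrite {1}/moebius e1 num invfM.
by rewrite [_^-1 * _]mulrC mulrA mulfK.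
Qed.

Lemma moebius_realE g (x y : R) : SL2Z g ->
  moebius g (x +i* y) =
  (real_moebius (g 0 0)%:~R (g 0 1)%:~R (g 1 0)%:~R (g 1 1)%:~R (x, y)).1 +i*
  (real_moebius (g 0 0)%:~R (g 0 1)%:~R (g 1 0)%:~R (g 1 1)%:~R (x, y)).2.
Proof.
move=> /SL2ZP /(congr1 (fun n : int => n%:~R : R)); rewrite rmorphB !rmorphM/= => dg.
rewrite /moebius /automorphy /real_moebius/=.
rewrite -!(rmorph_int (real_complex R)) /=.
move: dg; set a := (g 0 0)%:~R; set b := (g 0 1)%:~R.
set c := (g 1 0)%:~R; set d := (g 1 1)%:~R => dg.
rewrite (_ : a%:C * (x +i* y) + b%:C = (a * x + b) +i* (a * y)); last by simpc.
rewrite (_ : c%:C * (x +i* y) + d%:C = (c * x + d) +i* (c * y)); last by simpc.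
rewrite (_ : ((c * x + d) +i* (c * y))^-1 = ((c * x + d) / ((c * x + d) ^+ 2 + (c * y) ^+ 2)) +i*
    (- (c * y / ((c * x + d) ^+ 2 + (c * y) ^+ 2))))//.
set N := _ ^+ 2 + _; simpc.
have -> : y / N = (a * d - b * c) * y / N by rewrite dg mul1r.
by congr (_ +i* _); ring.
Qed.

Lemma normc_automorphy g (x y : R) : normc (automorphy g (x +i* y)) ^+ 2 =
  ((g 1 0)%:~R * x + (g 1 1)%:~R) ^+ 2 + ((g 1 0)%:~R * y) ^+ 2.
Proof.
rewrite normcE2 /automorphy -!(rmorph_int (real_complex R)).
by congr (_ ^+ 2 + _ ^+ 2) => /=; ring.
Qed.

Lemma Im_moebius g z : SL2Z g ->
  complex.Im (moebius g z) = complex.Im z / normc (automorphy g z) ^+ 2.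
Proof. by case: z => x y Sg; rewrite moebius_realE// normc_automorphy. Qed.

Lemma moebius_upper g z : SL2Z g -> upper_half z -> upper_half (moebius g z).
Proof.
move=> Sg Hz; rewrite /upper_half/= Im_moebius// divr_gt0// exprn_gt0//.
by rewrite normc_gt0 automorphy_neq0.
Qed.

Lemma moebius1 z : moebius 1%:M z = z.
Proof.
by rewrite /moebius /automorphy !mxE/= !mul0r !mul1r !add0r addr0 divr1.
Qed.

Lemma moebiusM g h z : SL2Z g -> SL2Z h -> upper_half z ->
  moebius (g *m h) z = moebius g (moebius h z).
Proof. by move=> Sg Sh Hz; case: (moebius_mul Sg Sh (automorphy_neq0 Sh Hz)). Qed.

Lemma moebiusK g z : SL2Z g -> upper_half z -> moebius (invmx g) (moebius g z) = z.
Proof.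
move=> Sg Hz; rewrite -moebiusM ?mulVmx ?moebius1//; first exact: SL2Z_unit.
exact: SL2Z_inv.
Qed.

Lemma moebiusVK g z : SL2Z g -> upper_half z -> moebius g (moebius (invmx g) z) = z.
Proof.
move=> Sg Hz; rewrite -moebiusM ?mulmxV ?moebius1//; first exact: SL2Z_unit.
exact: SL2Z_inv.
Qed.

Lemma slash2M f g h z : SL2Z g -> SL2Z h -> upper_half z ->
  slash2 f (g *m h) z = slash2 (slash2 f g) h z.
Proof.
move=> Sg Sh Hz; have [e1 e2] := moebius_mul Sg Sh (automorphy_neq0 Sh Hz).
by rewrite /slash2 e1 e2 exprMn invfM mulrCA mulrA.
Qed.

(** [y |f|] is carried along by the action, so a bound at [z] may be proved at any translate of [z]
    under SL_2(Z), for a slashed form. *)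
Lemma slash2_norm f g z : SL2Z g -> upper_half z ->
  complex.Im z * normc (slash2 f g z) =
  complex.Im (moebius g z) * normc (f (moebius g z)).
Proof.
move=> Sg Hz; rewrite Im_moebius// /slash2 Normc.normcM Normc.normcV expr2 Normc.normcM -expr2.
by rewrite mulrA.
Qed.

Lemma moebius_transl n z : moebius (transl n) z = z + n%:~R.
Proof. by rewrite /moebius /automorphy !mk2E/= mul0r mul1r add0r divr1. Qed.

Lemma slash2_transl f n z : slash2 f (transl n) z = f (z + n%:~R).
Proof.
by rewrite /slash2 moebius_transl /automorphy !mk2E mul0r add0r expr1n invr1 mul1r.
Qed.

Lemma addc_int (x y : R) (n : int) : (x +i* y) + n%:~R = (x + n%:~R) +i* y.
Proof. by rewrite -(rmorph_int (real_complex R)) /=; simpc. Qed.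

(** Near-maximality of [Im] on an orbit: after a translation to [|x| <= 1/2], the
    inversion cannot increase [Im] by more than the factor 10/9. *)
Lemma SL2Z_reduction z : upper_half z ->
  exists2 g, SL2Z g & 4 / 5 <= complex.Im (moebius g z).
Proof.
move=> Hz; pose A := [set complex.Im (moebius g z) | g in SL2Z].
have Hz' : 0 < complex.Im z by [].
have A0 : A !=set0 by exists (complex.Im (moebius 1%:M z)); exists 1%:M => //; exact: SL2Z1.
have ubA : has_ubound A.
  (* If [c = 0] then [d] is 1 or -1 and the height is unchanged; otherwise [|c z + d|^2 >= y^2], so
     the new height is at most [1 / y]. *)
  exists (complex.Im z + (complex.Im z)^-1) => _ [g Sg <-].
  have ynz := automorphy_neq0 Sg Hz.
  rewrite Im_moebius//; case: z Hz Hz' ynz {A A0} => x y _ /= y0 ynz.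
  rewrite ler_pdivrMr ?exprn_gt0 ?normc_gt0// normc_automorphy.
  have [c0|c0] := eqVneq (g 1 0) 0.
    move: Sg => /SL2ZP; rewrite c0 mulr0 subr0 => /eqP ad.
    have d1 : (1 : R) <= (g 1 1)%:~R ^+ 2.
      by rewrite -[1]/(1%:~R) -rmorphXn ler_int; move: ad; nia.
    have yi : 0 < y^-1 by rewrite invr_gt0.
    by rewrite mul0r add0r mul0r expr0n addr0; nra.
  have c1 : (1 : R) <= (g 1 0)%:~R ^+ 2.
    by rewrite -[1]/(1%:~R) -rmorphXn ler_int; move: c0; nia.
  apply: (@le_trans _ _ (y^-1 * ((g 1 0)%:~R * y) ^+ 2)).
    rewrite exprMn (_ : _ * (_ * _) = (g 1 0)%:~R ^+ 2 * y); last by field; rewrite gt_eqF.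
    by rewrite -{1}[y]mul1r (ler_wpM2r (ltW y0)).
  apply: ler_pM; rewrite ?invr_ge0 ?sqr_ge0 ?(ltW y0)//; first by rewrite lerDr ltW.
  by rewrite lerDr sqr_ge0.
have hs : has_sup A by split.
set s := sup A.
have s0 : 0 < s.
  apply: (@lt_le_trans _ _ (complex.Im (moebius 1%:M z))); first by rewrite moebius1.
  by apply: ub_le_sup => //; exists 1%:M => //; exact: SL2Z1.
(* An element of height above [9 s / 10] replaces a maximal one. After the translation,
   [y / (x^2 + y^2) <= s < 10 y / 9] and [x^2 <= 1/4] give [y^2 > 9/10 - 1/4 = 13/20 > (4/5)^2]. *)
have s10 : 0 < s / 10 by rewrite divr_gt0.
have [_ [g Sg <-] gs] := sup_adherent s10 hs.
rewrite -/s in gs; set z1 := moebius g z in gs.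
have Hz1 : upper_half z1 by exact: moebius_upper.
pose n := Num.floor (complex.Re z1 + 2^-1).
exists (transl (- n) *m g); first by apply: SL2Z_mul => //; exact: SL2Z_transl.
have St := SL2Z_transl (- n).
rewrite moebiusM// -/z1 moebius_transl.
have Hz2 : upper_half (z1 + (- n)%:~R) by rewrite -moebius_transl; exact: moebius_upper.
pose J := mk2 0 (-1) 1 0.
have SJ : SL2Z J by apply/SL2ZP; rewrite !mk2E.
have Js : complex.Im (moebius J (z1 + (- n)%:~R)) <= s.
  have Stg : SL2Z (transl (- n) *m g) by exact: SL2Z_mul.
  rewrite -moebius_transl /z1 -(moebiusM St Sg Hz) -(moebiusM SJ Stg Hz).
  apply: ub_le_sup => //; exists (J *m (transl (- n) *m g)) => //.
  exact: SL2Z_mul.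
move: Js; rewrite Im_moebius//.
have [x [y z1E]] : exists x y, z1 = x +i* y by case: (z1) => x y; exists x, y.
move: Hz2 gs; rewrite /n z1E addc_int /upper_half/= => y0 gs.
rewrite normc_automorphy !mk2E !mulr1z !mul1r mulr0z addr0 intrN.
have := floor_le_tmp (x + 2^-1); have := floorD1_gt (x + 2^-1).
rewrite intrD; set k := (Num.floor _)%:~R => f1 f2.
set x' := x - k.
have x2 : x' ^+ 2 <= 1 / 4.
  have : (1/2 - x') * (1/2 + x') >= 0 by rewrite mulr_ge0// /x'; lra.
  lra.
have N0 : 0 < x' ^+ 2 + y ^+ 2 by rewrite ltr_wpDl ?sqr_ge0// exprn_gt0.
rewrite ler_pdivrMr// => ys.
rewrite leNgt; apply/negP => y45.
nra.
Qed.

End Moebius.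

(** * Counting the returns of an orbit to a square *)

Section Counting.
Context {R : realType}.
Implicit Types (z : R[i]) (g h : 'M[int]_2).
Local Notation normc := Normc.normc.

Definition near_point (x0 y0 r : R) z : Prop :=
  `|complex.Re z - x0| <= r /\ `|complex.Im z - y0| <= r.

Definition coset (G : set 'M[int]_2) h : set 'M[int]_2 :=
  [set d | exists2 g, G g & d = g *m h].

(** [w] is a lower bound for the width of the cusp [h oo] of [G]. *)
Definition width_ge (G : set 'M[int]_2) h (w : nat) : Prop :=
  forall n : int, G (h *m transl n *m invmx h) -> n = 0 \/ (w%:Z <= `|n|)%R.

(** Here 12 originates, as 3 values of [c] times 4 of [d + floor (c x)]. The bound 9/7 is the ratio
    of the largest to the smallest height in the square, and 7/10 is slightly below... the least
    height 7/8 * 4/5 itself; they give [c^2 < 4] and [|c x + d| <= 6/5]. *)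
Let small_row (c d : int) (x y N : R) : 7 / 10 <= y -> N <= 9 / 7 ->
  N = (c%:~R * x + d%:~R) ^+ 2 + (c%:~R * y) ^+ 2 ->
  (-1 <= c <= 1)%R /\ (-2 <= d + Num.floor (c%:~R * x) <= 1)%R.
Proof.
move=> y7 N97 NE.
have c2 : c%:~R ^+ 2 < 4 :> R.
  have := sqr_ge0 (c%:~R * x + d%:~R : R).
  have : (7 / 10) ^+ 2 * c%:~R ^+ 2 <= (c%:~R * y) ^+ 2 :> R.
    rewrite [leRHS]exprMn mulrC ler_wpM2l ?sqr_ge0// ler_sqr ?nnegrE//; lra.
  lra.
split.
  move: c2; rewrite -[4 : R]/(4%:~R) -rmorphXn ltr_int => c2.
  by apply/andP; split; nia.
have s2 : (c%:~R * x + d%:~R) ^+ 2 <= 9 / 7 :> R.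
  by have := sqr_ge0 (c%:~R * y : R); lra.
have s3 : - (6 / 5) <= (c%:~R * x + d%:~R : R) <= 6 / 5.
  by apply/andP; split; nra.
have := floor_le_tmp (c%:~R * x); have := floorD1_gt (c%:~R * x).
set k := Num.floor _; rewrite intrD => f1 f2; case/andP: s3 => s3 s4.
have k1 : (d + k)%:~R < 2%:~R :> R by rewrite intrD; lra.
have k2 : (-3)%:~R < (d + k)%:~R :> R by rewrite intrD; lra.
rewrite !ltr_int in k1 k2.
by apply/andP; split; lia.
Qed.

(** All images are compared with a single one, [z1], through [sg d = d^-1 d0], whose bottom row
    falls under [small_row]. Equal rows make [d2^-1 d1] a translation, and its conjugate by [h] is
    [g2^-1 g1], an element of [G], so [width_ge] applies. *)
Lemma coset_count (G : set 'M[int]_2) h (w : nat) (x0 y0 : R) z :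
  SL2Z_subgroup G -> SL2Z h -> width_ge G h w ->
  4 / 5 <= y0 -> y0 <= 2 * w%:R -> upper_half z ->
  exists code : 'M[int]_2 -> 'I_12, forall d1 d2,
    coset G h d1 -> near_point x0 y0 (y0 / 8) (moebius (invmx d1) z) ->
    coset G h d2 -> near_point x0 y0 (y0 / 8) (moebius (invmx d2) z) ->
    code d1 = code d2 -> d1 = d2.
Proof.
move=> [GS G1 GM GV] Sh wG y45 yw Hz.
have [[d0 [Kd0 Nd0]]|none] := pselect (exists d0, coset G h d0 /\
    near_point x0 y0 (y0 / 8) (moebius (invmx d0) z)); last first.
  by exists (fun=> ord0) => d1 d2 K1 N1; case: none; exists d1.
have SK d : coset G h d -> SL2Z d by move=> [g Gg ->]; apply: SL2Z_mul => //; exact: GS.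
have Sd0 := SK _ Kd0.
set z1 := moebius (invmx d0) z in Nd0.
have Hz1 : upper_half z1 by apply: moebius_upper => //; exact: SL2Z_inv.
pose sg d := invmx d *m d0.
have Ssg d : coset G h d -> SL2Z (sg d).
  by move=> /SK Sd; apply: SL2Z_mul => //; exact: SL2Z_inv.
have sgz d : coset G h d -> moebius (sg d) z1 = moebius (invmx d) z.
  move=> /SK Sd; rewrite moebiusM//; last exact: SL2Z_inv.
  by rewrite moebiusVK.
pose k1 d : int := sg d 1 0 + 1.
pose k2 d : int := sg d 1 1 + Num.floor ((sg d 1 0)%:~R * complex.Re z1) + 2.
have kb d : coset G h d -> near_point x0 y0 (y0 / 8) (moebius (invmx d) z) ->
    (0 <= k1 d <= 2)%R /\ (0 <= k2 d <= 3)%R.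
  move=> Kd; rewrite -sgz// => -[_].
  rewrite Im_moebius; last exact: Ssg.
  have [_] := Nd0; rewrite !ler_norml => /andP[y1a y1b] /andP[ya _].
  have N0 : 0 < normc (automorphy (sg d) z1) ^+ 2.
    by rewrite exprn_gt0// normc_gt0 automorphy_neq0//; exact: Ssg.
  have N97 : normc (automorphy (sg d) z1) ^+ 2 <= 9 / 7.
    have : 7 / 8 * y0 <= complex.Im z1 / normc (automorphy (sg d) z1) ^+ 2 by lra.
    rewrite ler_pdivlMr// => H.
    have y0p : 0 < y0 by lra.
    by nra.
  have := @small_row (sg d 1 0) (sg d 1 1) (complex.Re z1) (complex.Im z1) _ _ N97.
  rewrite /k1 /k2 -normc_automorphy; case: (z1) y1a => a b y1a /=.
  have b7 : 7 / 10 <= b by move: y1a => /=; lra.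
  move=> /(_ b7 erefl)[/andP[? ?] /andP[? ?]].
  by split; apply/andP; split; lia.
(* The pair [(k1, k2)], with 3 and 4 possible values, read as digits in base 4. *)
exists (fun d => inord (`|k1 d| * 4 + `|k2 d|)%N) => d1 d2 K1 N1 K2 N2.
have [/andP[a1 a2] /andP[a3 a4]] := kb _ K1 N1.
have [/andP[b1 b2] /andP[b3 b4]] := kb _ K2 N2.
move=> /(congr1 (@nat_of_ord _)); rewrite !inordK; [|lia|lia] => ee.
have [e1 e2] : k1 d1 = k1 d2 /\ k2 d1 = k2 d2 by split; lia.
have r1 : sg d1 1 0 = sg d2 1 0 by move: e1; rewrite /k1; lia.
have r2 : sg d1 1 1 = sg d2 1 1 by move: e2; rewrite /k2 r1; lia.
have [n Hn] := SL2Z_bottom_row (Ssg _ K1) (Ssg _ K2) r1 r2.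
have [g1 Gg1 d1E] := K1; have [g2 Gg2 d2E] := K2.
have u0 := SL2Z_unit Sd0; have uh := SL2Z_unit Sh.
have u1 := SL2Z_unit (SK _ K1); have u2 := SL2Z_unit (SK _ K2).
have tE : transl n = invmx d2 *m d1.
  have : sg d2 *m invmx d0 *m d1 = transl n *m sg d1 *m invmx d0 *m d1 by rewrite Hn.
  by rewrite /sg !mulmxA mulmxK// -!mulmxA mulKVmx// mulVmx// mulmx1 => <-.
have Gt : G (h *m transl n *m invmx h).
  have ug2 : g2 \in unitmx by apply: SL2Z_unit; exact: GS.
  have hE : h *m invmx d2 = invmx g2.
    by rewrite -[LHS](mulKmx ug2) [g2 *m _]mulmxA -d2E mulmxV// mulmx1.
  rewrite tE mulmxA hE d1E -!mulmxA mulmxV// mulmx1.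
  by apply: GM => //; exact: GV.
(* Both points lie in a square of side [y0 / 4], which is at most [w / 2]. *)
have nsmall : `|n%:~R : R| < w%:R.
  have [N1' _] := N1; have [N2' _] := N2.
  rewrite -!sgz// Hn in N1' N2'.
  rewrite moebiusM// in N2'; [|exact: SL2Z_transl|exact: Ssg].
  rewrite moebius_transl in N2'.
  case: (moebius (sg d1) z1) N1' N2' => a b; rewrite addc_int/= => N1' N2'.
  have := ler_normB (a + n%:~R - x0) (a - x0).
  by rewrite (_ : a + n%:~R - x0 - (a - x0) = n%:~R); [lra|ring].
have n0 : n = 0.
  have [//|] := wG _ Gt; rewrite leNgt => /negP[].
  by rewrite -(ltr_int R) intr_norm.
have : invmx d2 *m d1 = 1%:M.
  by rewrite -tE n0; apply: mx2_eq; rewrite !mk2E !mxE.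
by move=> /(congr1 (mulmx d2)); rewrite mulmxA mulmxV// mul1mx mulmx1.
Qed.

End Counting.

(** * Unfolding *)

Section Unfolding.
Context {R : realType}.
Local Notation mR := (measurableTypeR R).
Local Notation mu := (@lebesgue_measure R).
Local Notation normc := Normc.normc.
Implicit Types (g h : 'M[int]_2).

Definition rmob g : mR * mR -> mR * mR :=
  real_moebius (g 0 0)%:~R (g 0 1)%:~R (g 1 0)%:~R (g 1 1)%:~R.

Lemma rmobE g (p : mR * mR) : SL2Z g ->
  moebius g (p.1 +i* p.2) = (rmob g p).1 +i* (rmob g p).2.
Proof. by case: p => x y Sg; rewrite moebius_realE. Qed.

Lemma rmob_upper g (p : mR * mR) : SL2Z g -> 0 < p.2 -> 0 < (rmob g p).2.
Proof.
move=> Sg p0; have : upper_half (moebius g (p.1 +i* p.2)) by exact: moebius_upper.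
by rewrite rmobE.
Qed.

Lemma rmobVK g (p : mR * mR) : SL2Z g -> 0 < p.2 -> rmob (invmx g) (rmob g p) = p.
Proof.
move=> Sg p0; have Si := SL2Z_inv Sg.
have Hp : upper_half (p.1 +i* p.2) by [].
have := moebiusK Sg Hp; rewrite rmobE// rmobE//.
by case: (rmob _ _) => a b /= [-> ->]; case: p {p0 Hp}.
Qed.

(** The values of [f] off the upper half-plane are arbitrary; cutting them off gives a function that
    is measurable on the whole plane. *)
Definition hnormsq (f : R[i] -> R[i]) (p : mR * mR) : R :=
  if 0 < p.2 then normsq f p.1 p.2 else 0.

Lemma hnormsq_ge0 f p : 0 <= hnormsq f p.
Proof. by rewrite /hnormsq; case: ifP => // _; exact: sqr_ge0. Qed.

Lemma measurable_hnormsq f : holomorphic_on_upper_half f ->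
  measurable_fun [set: mR * mR] (hnormsq f).
Proof.
by move=> hf; apply: measurable_separately_continuous => x y y0;
  [apply: normsq_cont1|apply: normsq_cont2]; apply: hf.
Qed.

(** [N] bounds the number of times the square around [x0 + i y0] meets an orbit, so
    it covers [G \ H] at most [N] times. Only the surjectivity of [D -> G \ H] is
    used, not that representatives are unique. *)
Section unfold.
Variables (G : set 'M[int]_2) (h : 'M[int]_2) (D : set (mR * mR)) (f : R[i] -> R[i]).
Hypotheses (SG : SL2Z_subgroup G) (Sh : SL2Z h) (FD : fundamental_domain G D).
Hypotheses (hf : holomorphic_on_upper_half f)
  (Gf : forall g, G g -> forall z, upper_half z -> slash2 f g z = f z).
Hypothesis mfh : measurable_fun [set: mR * mR] (hnormsq (slash2 f h)).
Variables (x0 y0 r : R) (N : nat).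
Hypothesis ry : r < y0.
Hypothesis count : forall z, upper_half z ->
  exists code : 'M[int]_2 -> 'I_N, forall d1 d2,
    coset G h d1 -> near_point x0 y0 r (moebius (invmx d1) z) ->
    coset G h d2 -> near_point x0 y0 r (moebius (invmx d2) z) ->
    code d1 = code d2 -> d1 = d2.

Let Q : set (mR * mR) := `[x0 - r, x0 + r] `*` `[y0 - r, y0 + r].

Let mQ : measurable Q. Proof. exact: measurableX. Qed.

Let QP (p : mR * mR) : Q p <-> near_point x0 y0 r (p.1 +i* p.2).
Proof.
rewrite /Q /near_point/= !in_itv/= !ler_distl.
by split => [[]|[]].
Qed.

Let Qpos (p : mR * mR) : Q p -> 0 < p.2.
Proof.
move=> [_]; rewrite /= in_itv/= => /andP[H _].
by apply: lt_le_trans H; rewrite subr_gt0.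
Qed.

(** In the upper half-plane this is the image of the square [Q] under [d]. *)
Let A d : set (mR * mR) := rmob (invmx d) @^-1` Q.

Let mA d : measurable (A d).
Proof.
by rewrite -[A d]setTI; apply: (measurable_real_moebius _ _ _ _).
Qed.

Let mD : measurable D. Proof. by case: FD. Qed.

(** The factor [p.2 ^+ 2] makes the integrand invariant and later cancels the weight of
    [hyp_int]. *)
Let H (d : 'M[int]_2) (p : mR * mR) : \bar R :=
  (\1_(D `&` A d) p * (hnormsq f p * p.2 ^+ 2))%:E.

(** The coset as a sequence indexed by codes, with 0 at all other indices. [pickle_inv] succeeds
    only on the exact code of a matrix, so each matrix occurs once. *)
Let Hk (k : nat) (p : mR * mR) : \bar R :=
  if (pickle_inv k : option 'M[int]_2) is Some d then
    if `[< coset G h d >] then H d p else 0%E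
  else 0%E.

Let H_ge0 d p : (0 <= H d p)%E.
Proof. by rewrite lee_fin mulr_ge0// mulr_ge0 ?hnormsq_ge0 ?sqr_ge0. Qed.

Let Hk_ge0 k p : (0 <= Hk k p)%E.
Proof. by rewrite /Hk; case: pickle_inv => // d; case: ifP. Qed.

Let mH d : measurable_fun [set: mR * mR] (H d).
Proof.
apply/measurable_EFinP; apply: measurable_funM.
  by apply: measurable_indic; exact: measurableI.
apply: measurable_funM; first exact: measurable_hnormsq.
exact: measurable_funX.
Qed.

Let mHk k : measurable_fun [set: mR * mR] (Hk k).
Proof.
rewrite /Hk; case: pickle_inv => [d|]; last exact: measurable_cst.
by case: (asboolP (coset G h d)) => _; [exact: mH|exact: measurable_cst].
Qed.

(** The piece of [D] meeting [d Q], pulled back by [d] to a piece of the square. *)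
Let Psi k (p : mR * mR) : \bar R :=
  if (pickle_inv k : option 'M[int]_2) is Some d then
    if `[< coset G h d >] then H d (rmob d p) else 0%E
  else 0%E.

Let SK d : coset G h d -> SL2Z d.
Proof. by case: SG => GS _ _ _ [g Gg ->]; apply: SL2Z_mul => //; exact: GS. Qed.

Let Psi_int k : hyp_int (Psi k) = hyp_int (Hk k).
Proof.
rewrite /Psi /Hk; case: pickle_inv => [d|//]; case: (asboolP (coset G h d)) => [Kd|//].
apply: (hyp_int_moebius _ (mH d) (H_ge0 d)).
by move/SL2ZP: (SK Kd) => /(congr1 (fun n : int => n%:~R : R)); rewrite rmorphB !rmorphM.
Qed.

Let Psi_ge0 k p : (0 <= Psi k p)%E.
Proof. by rewrite /Psi; case: pickle_inv => // d; case: ifP. Qed.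

Let mPsi k : measurable_fun [set: mR * mR] (Psi k).
Proof.
rewrite /Psi; case: pickle_inv => [d|]; last exact: measurable_cst.
case: (asboolP (coset G h d)) => _; last exact: measurable_cst.
by apply: (measurableT_comp (mH d)); exact: measurable_real_moebius.
Qed.

Let mw : measurable_fun [set: mR * mR] (fun p : mR * mR => (posinv p.2 ^+ 2)%:E).
Proof.
apply/measurable_EFinP; apply: measurable_funX.
by apply: (measurableT_comp (@measurable_posinv R)).
Qed.

Definition local_normsq (p : mR * mR) : \bar R :=
  (\1_Q p * hnormsq (slash2 f h) p)%:E.

Let posinv_cancel (y t : R) : 0 < y -> posinv y ^+ 2 * (t * y ^+ 2) = t.
Proof. by move=> y0'; rewrite posinv_eq//; field; rewrite gt_eqF. Qed.

(** With [d = g h], slashing [f] by [d] is slashing by [h], since [f] is invariant under [g]; then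
    [slash2_norm] is squared. *)
Let slash_coset d (p : mR * mR) : coset G h d -> 0 < p.2 ->
  hnormsq f (rmob d p) * (rmob d p).2 ^+ 2 = hnormsq (slash2 f h) p * p.2 ^+ 2.
Proof.
move=> Kd p0; have Sd := SK Kd; have [g Gg dE] := Kd.
have Hp : upper_half (p.1 +i* p.2) by [].
have Sg : SL2Z g by case: SG => GS _ _ _; exact: GS.
rewrite /hnormsq rmob_upper// p0.
have := slash2_norm f Sd Hp; rewrite rmobE//= => /(congr1 (fun t => t ^+ 2)).
rewrite !exprMn mulrC [RHS]mulrC /normsq => <-; congr (normc _ ^+ 2 * _).
rewrite dE slash2M// /slash2 -/(slash2 f g _); congr (_ * _).
by rewrite -[LHS]/(slash2 f g (moebius h (p.1 +i* p.2))) Gf//; exact: moebius_upper.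
Qed.

Let pair_eq (p q : mR * mR) : p.1 +i* p.2 = q.1 +i* q.2 -> p = q.
Proof. by case: p => a b; case: q => c d /= [-> ->]. Qed.

(** For [p] in the square some [g] in [G] carries [h p] into [D], and the single term [d = g h]
    already equals the left-hand side. *)
Let local_le p : (local_normsq p <= \sum_(k <oo) ((posinv p.2 ^+ 2)%:E * Psi k p))%E.
Proof.
have pos k : (0 <= (posinv p.2 ^+ 2)%:E * Psi k p)%E by rewrite mule_ge0// lee_fin sqr_ge0.
have [Qp|nQ] := pselect (Q p); last first.
  by rewrite /local_normsq indicE memNset// mul0r; exact: nneseries_ge0.
have p0 := Qpos Qp.
have [_ _ FD3] := FD.
have Hp : upper_half (moebius h (p.1 +i* p.2)) by exact: moebius_upper.
have [p' [[Dp' [g Gg p'E]] _]] := FD3 _ Hp.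
pose d := g *m h; have Kd : coset G h d by exists g.
have Sg : SL2Z g by case: SG => GS _ _ _; exact: GS.
have Sd := SK Kd.
have rE : rmob d p = p'.
  by apply: pair_eq; rewrite p'E -moebiusM// -/d rmobE.
apply: le_trans (nneseries_lim_ge (pickle d).+1 _); last by move=> *; exact: pos.
rewrite big_mkord big_ord_recr/=; apply: (@le_trans _ _ ((posinv p.2 ^+ 2)%:E * Psi (pickle d) p)%E).
  rewrite /Psi pickleK_inv asboolT// /H -EFinM lee_fin.
  have Ap : (D `&` A d) (rmob d p) by split; rewrite ?rE// /A/= -rE rmobVK.
  rewrite !indicE !mem_set// !mul1r slash_coset//.
  by rewrite posinv_cancel.
by rewrite leeDr// sume_ge0.
Qed.

(** At a point [p] of [D], the term of [d] contributes only if [d^-1 p] lies in the square, and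
    [code] injects these [d] into [N] values. *)
Let series_le p : (\sum_(k <oo) ((posinv p.2 ^+ 2)%:E * Hk k p)
  <= N%:R%:E * (\1_D p * hnormsq f p)%:E)%E.
Proof.
have rhs0 : (0 <= N%:R%:E * (\1_D p * hnormsq f p)%:E)%E.
  by rewrite -EFinM lee_fin !mulr_ge0// hnormsq_ge0.
have [Dp|nD] := pselect (D p); last first.
  rewrite eseries0// => k _ _; rewrite /Hk; case: pickle_inv => [d|]; last by rewrite mule0.
  case: ifP => _; last by rewrite mule0.
  by rewrite /H indicE memNset ?mul0r ?mule0// => -[].
have p0 : 0 < p.2 by case: FD => _ DH _; exact: DH.
have [code inj] := count (p0 : upper_half (p.1 +i* p.2)).
pose V k := if (pickle_inv k : option 'M[int]_2) is Some d then
   `[< coset G h d >] && `[< A d p >] else false.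
have HV k : ((posinv p.2 ^+ 2)%:E * Hk k p = ((V k)%:R * hnormsq f p)%:E)%E.
  rewrite /Hk /V; case: pickle_inv => [d|]; last by rewrite mule0 mul0r.
  case: ifPn => Kd /=; last by rewrite mule0 mul0r.
  rewrite /H -EFinM indicE; case: asboolP => Ad.
    by rewrite mem_set ?mul1r ?posinv_cancel//; split.
  by rewrite memNset ?mul0r ?mulr0//; case.
apply: lime_le.
  by apply: is_cvg_nneseries => k _ _; rewrite HV lee_fin mulr_ge0// hnormsq_ge0.
apply: nearW => n; rewrite big_mkord.
under eq_bigr do rewrite HV.
rewrite sumEFin -mulr_suml -EFinM lee_fin indicE mem_set// mul1r.
rewrite ler_wpM2r ?hnormsq_ge0//.
rewrite -natr_sum ler_nat.
have -> : (\sum_(i < n) V i)%N = #|[set k : 'I_n | V k]%SET|.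
  rewrite -sum1dep_card [RHS]big_mkcond/=.
  by apply: eq_bigr => i _; case: (V i).
rewrite -[leqRHS]card_ord.
(* The default [1%:M] is never reached, because [V] is false at indices that encode no matrix. *)
apply: (@leq_card_in _ _ (fun k : 'I_n => code (odflt 1%:M (pickle_inv k)))) => k1 k2.
rewrite !inE /V.
case e1 : (pickle_inv _) => [d1|//] /andP[/asboolP K1 /asboolP A1].
case e2 : (pickle_inv _) => [d2|//] /andP[/asboolP K2 /asboolP A2] /= cc.
have N1 d : coset G h d -> A d p -> near_point x0 y0 r (moebius (invmx d) (p.1 +i* p.2)).
  by move=> /SK Sd /QP; rewrite rmobE//; exact: SL2Z_inv.
have dd := inj _ _ K1 (N1 _ K1 A1) K2 (N1 _ K2 A2) cc.
apply: val_inj => /=.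
have := pickle_invK (T := 'M[int]_2) k1; have := pickle_invK (T := 'M[int]_2) k2.
by rewrite e1 e2 dd /= => <- <-.
Qed.

Lemma unfold_bound :
  (\int[(mu \x mu)%E]_p local_normsq p <=
   N%:R%:E * \int[(mu \x mu)%E]_(p in D) (normsq f p.1 p.2)%:E)%E.
Proof.
have mterm (F : mR * mR -> \bar R) : measurable_fun [set: mR * mR] F ->
    measurable_fun [set: mR * mR] (fun p : mR * mR => ((posinv p.2 ^+ 2)%:E * F p)%E).
  by move=> mF; exact: emeasurable_funM.
have pterm (F : mR * mR -> \bar R) : (forall p, 0 <= F p)%E ->
    forall p : mR * mR, (0 <= (posinv p.2 ^+ 2)%:E * F p)%E.
  by move=> F0 p; rewrite mule_ge0// lee_fin sqr_ge0.
have mloc : measurable_fun [set: mR * mR] local_normsq.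
  by apply/measurable_EFinP; apply: measurable_funM => //.
have mDf : measurable_fun [set: mR * mR] (fun p => (\1_D p * hnormsq f p)%:E).
  by apply/measurable_EFinP; apply: measurable_funM => //; exact: measurable_hnormsq.
apply: (@le_trans _ _ (\int[(mu \x mu)%E]_p \sum_(k <oo) ((posinv p.2 ^+ 2)%:E * Psi k p))%E).
  apply: ge0_le_integral => //.
  - by move=> p _; rewrite lee_fin mulr_ge0// hnormsq_ge0.
  - by apply: ge0_emeasurable_sum => k *; [exact: pterm|exact: mterm].
rewrite integral_nneseries//; [|by move=> k; exact: mterm|by move=> k p _; exact: pterm].
(* The invariance of the measure moves every piece from the square to [D], term by term. *)
under eq_eseriesr do rewrite -/(hyp_int _) Psi_int /hyp_int.
rewrite -integral_nneseries//; [|by move=> k; exact: mterm|by move=> k p _; exact: pterm].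
apply: (@le_trans _ _ (\int[(mu \x mu)%E]_p (N%:R%:E * (\1_D p * hnormsq f p)%:E))%E).
  apply: ge0_le_integral => //.
  - by move=> p _; apply: nneseries_ge0 => k _ _; exact: pterm.
  - by apply: ge0_emeasurable_sum => k *; [exact: pterm|exact: mterm].
  - exact: emeasurable_funM.
rewrite ge0_integralZl//; last by move=> p _; rewrite lee_fin mulr_ge0// hnormsq_ge0.
rewrite lee_wpmul2l ?lee_fin//.
rewrite [leRHS]integral_mkcond le_eqVlt; apply/orP; left; apply/eqP.
apply: eq_integral => p _; rewrite patchE indicE; case: ifPn => pD.
  rewrite mul1r /hnormsq ifT//; case: FD => _ DH _.
  by apply: DH; rewrite inE in pD.
by rewrite mul0r.
Qed.

End unfold.
End Unfolding.

(** * The uniform bound *)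

Section SupBound.
Context {R : realType}.
Local Notation mR := (measurableTypeR R).
Local Notation mu := (@lebesgue_measure R).
Local Notation normc := Normc.normc.
Implicit Types (g h : 'M[int]_2) (f : R[i] -> R[i]) (x y : R).

Lemma slash2_holo f g : SL2Z g -> holomorphic_on_upper_half f ->
  holomorphic_on_upper_half (slash2 f g).
Proof.
move=> Sg hf z Hz.
have lin (a b : R[i]) : cderivable (fun z => a * z + b) z.
  apply: cderivableD; last exact: cderivable_cst.
  by apply: cderivableM; [exact: cderivable_cst|exact: cderivable_id].
have an0 : automorphy g z != 0 by exact: automorphy_neq0.
have da : cderivable (automorphy g) z by exact: lin.
apply: (@cderivableM _ (fun z => automorphy g z ^- 2) (f \o moebius g)).
  apply: cderivableV; first by rewrite expf_neq0.
  by apply: (@cderivableM _ (automorphy g) (automorphy g)).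
apply: cderivable_comp; first by apply: hf; exact: moebius_upper.
by apply: cderivableM; [exact: lin|exact: cderivableV].
Qed.

Lemma SL2Z_subgroup_subset (G : set 'M[int]_2) g : SL2Z_subgroup G -> G g -> SL2Z g.
Proof. by case=> + _ _ _; apply. Qed.

Lemma slash2_periodic (G : set 'M[int]_2) f h n z : SL2Z_subgroup G -> cusp_form2 G f ->
  SL2Z h -> G (h *m transl n *m invmx h) -> upper_half z ->
  slash2 f h (z + n%:~R) = slash2 f h z.
Proof.
move=> SG [_ fG _] Sh Gn Hz.
have St := SL2Z_transl n; have Sc := SL2Z_subgroup_subset SG Gn.
rewrite -slash2_transl -slash2M//.
have -> : h *m transl n = (h *m transl n *m invmx h) *m h.
  by rewrite mulmxKV// SL2Z_unit.
rewrite slash2M// {1}/slash2 fG//; exact: moebius_upper.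
Qed.

(** The least positive [n] with [h T^n h^-1] in [G]. It serves both as a separation bound for the
    counting and as an actual period for the decay. *)
Lemma congruence_width (G : set 'M[int]_2) h : congruence_subgroup G -> SL2Z h ->
  exists w : nat, [/\ (0 < w)%N, G (h *m transl w *m invmx h) & width_ge G h w].
Proof.
move=> [SG [q q0 qG]] Sh.
pose P (n : nat) := `[< (0 < n)%N /\ G (h *m transl n *m invmx h) >].
have [|w /asboolP[w0 Gw] wmin] := @ex_minnP P.
  by exists q; apply/asboolP; split => //; apply: qG; exact: principal_conj.
exists w; split => // n Gn; have [->|n0] := eqVneq n 0; [by left|right].
have GN : G (h *m transl `|n| *m invmx h).
  have [n1|n1] := leP 0 n; first by rewrite ger0_norm.
  rewrite ltr0_norm//; case: SG => GS _ _ GV.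
  have := GV _ Gn; congr G.
  have Sc := GS _ Gn; have uc := SL2Z_unit Sc.
  have uh := SL2Z_unit Sh.
  apply: (can_inj (mulKmx uc)); rewrite mulmxV//.
  rewrite !mulmxA mulmxKV// -(mulmxA h) transl_mul subrr.
  have -> : transl 0 = 1%:M by apply: mx2_eq; rewrite !mk2E !mxE.
  by rewrite mulmx1 mulmxV.
have : P `|n|%N by apply/asboolP; split; [rewrite absz_gt0|rewrite abszE].
by move=> /wmin; rewrite -lez_nat abszE.
Qed.

Let width_arith (w : R) : 1 <= w -> 4 / 5 <= w /\ w <= 2 * w.
Proof. by move=> w1; split; lra. Qed.

(** With [t = y / w > 2], [expR_ge1Dx] and [pi >= 2] give [dl <= 1 / (4 t - 3)]. Hence [dl <= 1/5]
    and [t * dl <= 2/5], so [y n <= 5/3 * 2/5 * S], which is below [S]. *)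
Let decay_arith (n w y S : R) : 0 <= n -> 1 <= w -> 2 * w < y -> 0 <= S ->
  n * (1 - 2 * expR (- (2 * pi / w * (y - w)))) <=
    expR (- (2 * pi / w * (y - w))) * (S / w) ->
  (y * n) ^+ 2 <= S ^+ 2.
Proof.
move=> n0 w1 wy S0; have w0 : 0 < w by lra.
pose t := y / w; have yE : y = t * w by rewrite /t divfK// gt_eqF.
have t2 : 2 < t by rewrite /t ltr_pdivlMr.
rewrite (_ : 2 * pi / w * (y - w) = 2 * pi * (t - 1)); last first.
  by rewrite yE; field; rewrite gt_eqF.
set dl := expR _ => dec.
have dl0 : 0 < dl by exact: expR_gt0.
have dlt : dl * (4 * t - 3) <= 1.
  rewrite /dl expRN mulrC ler_pdivrMr ?expR_gt0// mul1r.
  apply: le_trans (expR_ge1Dx _); have := pi_ge2 R; nra.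
have dl5 : dl <= 1 / 5 by nra.
have {}dec : n * (1 - 2 * dl) * w <= dl * S by move: dec; rewrite mulrA ler_pdivlMr.
have dec' : n * w * (3 / 5) <= dl * S.
  apply: le_trans dec; rewrite mulrAC (ler_wpM2r (ltW w0))// (ler_wpM2l n0)//; lra.
have yn : 0 <= y * n by rewrite mulr_ge0//; lra.
have dec2 : t * (n * w * (3 / 5)) <= t * (dl * S) by rewrite ler_wpM2l//; lra.
have dec3 : t * dl * S <= 2 / 5 * S by rewrite ler_wpM2r//; nra.
rewrite ler_sqr ?nnegrE// yE; lra.
Qed.

Section fixed_form.
Variables (G : set 'M[int]_2) (D : set (mR * mR)) (f : R[i] -> R[i]).
Hypotheses (CG : congruence_subgroup G) (FD : fundamental_domain G D)
  (cf : cusp_form2 G f).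

Definition norm2 (D : set (mR * mR)) f : \bar R :=
  \int[(mu \x mu)%E]_(p in D) (normsq f p.1 p.2)%:E.

Lemma norm2_ge0 : (0 <= norm2 D f)%E.
Proof. by apply: integral_ge0 => p _; rewrite lee_fin sqr_ge0. Qed.

(** 6144 = 64 * 8 * 12, with 64 = (y0 / r)^2 from the square of half-side [r = y0 / 8],
    8 from [area_bound] and 12 from [coset_count]. *)
Lemma sup_bound_low h (w : nat) (x0 y0 : R) : SL2Z h -> width_ge G h w ->
  4 / 5 <= y0 -> y0 <= 2 * w%:R ->
  ((y0 ^+ 2 * normsq (slash2 f h) x0 y0)%:E <= 6144%:E * norm2 D f)%E.
Proof.
move=> Sh wG y45 yw.
have [SG _] := CG; have [hf fG _] := cf.
have hF := slash2_holo Sh hf.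
pose r := y0 / 8.
have r0 : 0 < r by rewrite /r; lra.
have ry : r < y0 by rewrite /r; lra.
have mF := measurable_hnormsq hF.
have cnt (z : R[i]) (Hz : upper_half z) := coset_count x0 SG Sh wG y45 yw Hz.
have ub := unfold_bound SG Sh FD hf fG mF ry cnt.
have Q x y : x0 - r <= x <= x0 + r -> y0 - r <= y <= y0 + r -> 0 < y.
  by move=> _ /andP[? _]; lra.
have := @area_bound _ (slash2 f h) x0 y0 r (local_normsq h f x0 y0 r) r0.
have H1 x y : x0 - r <= x <= x0 + r -> y0 - r <= y <= y0 + r -> cderivable (slash2 f h) (x +i* y).
  by move=> Hx Hy; apply: hF; exact: (Q _ _ Hx Hy).
have H2 : measurable_fun [set: mR * mR] (local_normsq h f x0 y0 r).
  apply/measurable_EFinP; apply: measurable_funM => //.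
  by apply: measurable_indic; exact: measurableX.
have H3 p : (0 <= local_normsq h f x0 y0 r p)%E.
  by rewrite lee_fin mulr_ge0// hnormsq_ge0.
move=> /(_ H1 H2 H3) ab.
have {}ab : ((r ^+ 2 * normsq (slash2 f h) x0 y0)%:E <= 96%:E * norm2 D f)%E.
  apply: le_trans (ab _) _.
    move=> x y Hx Hy; rewrite /local_normsq /hnormsq/= (Q _ _ Hx Hy).
    by rewrite indicE mem_set ?mul1r//=; split; rewrite /= in_itv.
  rewrite (_ : 96%:E = 8%:E * 12%:R%:E)%E; last by rewrite -EFinM; congr (_%:E); ring.
  by rewrite -muleA lee_pmul2l.
rewrite (_ : (y0 ^+ 2 * _)%:E = 64%:E * (r ^+ 2 * normsq (slash2 f h) x0 y0)%:E)%E; last first.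
  by rewrite -EFinM; congr (_%:E); rewrite /r; field.
rewrite (_ : 6144%:E = 64%:E * 96%:E)%E; last by rewrite -EFinM; congr (_%:E); ring.
by rewrite -muleA lee_pmul2l.
Qed.

Lemma sup_bound_fin (I : R) : norm2 D f = I%:E -> forall z, upper_half z ->
  (complex.Im z * normc (f z)) ^+ 2 <= 6144 * I.
Proof.
move=> fI z Hz; have [SG _] := CG; have [hf fG vf] := cf.
have [g Sg yg] := SL2Z_reduction Hz.
set z0 := moebius g z in yg.
have Hz0 : upper_half z0 by exact: moebius_upper.
pose h := invmx g; have Sh : SL2Z h by exact: SL2Z_inv.
have hz0 : moebius h z0 = z by rewrite /h moebiusK.
have := slash2_norm f Sh Hz0; rewrite hz0 => <-.
have [w [w0 Gw wG]] := congruence_width CG Sh.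
have low x y : 4 / 5 <= y -> y <= 2 * w%:R -> (y * normc (slash2 f h (x +i* y))) ^+ 2 <= 6144 * I.
  move=> y1 y2; have := sup_bound_low x Sh wG y1 y2.
  by rewrite fI -EFinM lee_fin exprMn.
case: z0 yg {Hz0 hz0} => x y /= y45.
have [yw|yw] := leP y (2 * w%:R); first exact: low.
have W1 : (1 : R) <= w%:R by rewrite (ler_nat _ 1).
have w0' : (0 : R) < w%:R by rewrite ltr0n.
have [w45 w2] := width_arith W1.
have wy : w%:R < y by exact: le_lt_trans yw.
have I0 : 0 <= 6144 * I.
  by have := norm2_ge0; rewrite fI lee_fin; lra.
pose S := Num.sqrt (6144 * I); have S0 : 0 <= S by exact: sqrtr_ge0.
have S2 : S ^+ 2 = 6144 * I by rewrite sqr_sqrtr.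
(* As [w >= 1], the height [w] lies in the range of [low], which bounds the form on the line from
   which it decays. *)
have line x' : normc (slash2 f h (x' +i* w%:R)) <= S / w%:R.
  rewrite ler_pdivlMr//.
  rewrite -ler_sqr ?nnegrE ?mulr_ge0 ?normc_ge0 ?S2//.
  by rewrite mulrC; exact: low.
have hF x' y' : 0 < y' -> cderivable (slash2 f h) (x' +i* y').
  by move=> y'0; apply: (slash2_holo Sh hf).
have pF x' y' : 0 < y' -> slash2 f h ((x' + w%:R) +i* y') = slash2 f h (x' +i* y').
  move=> y'0; have := slash2_periodic SG cf Sh Gw (y'0 : upper_half (x' +i* y')).
  by rewrite addc_int.
have := periodic_decay x w0' w0' wy hF pF (vf h Sh) line.
by rewrite -S2; apply: decay_arith => //; exact: normc_ge0.
Qed.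

End fixed_form.
End SupBound.

(** * Norms of linear combinations, and the vanishing in level one *)

Section Duality.
Context {R : realType}.
Local Notation mR := (measurableTypeR R).
Local Notation mu := (@lebesgue_measure R).
Local Notation normc := Normc.normc.
Implicit Types (g h : 'M[int]_2) (f : R[i] -> R[i]).

Lemma cderivable_sum (n : nat) (F : 'I_n -> R[i] -> R[i]) z :
  (forall i, cderivable (F i) z) -> cderivable (fun u => \sum_(i < n) F i u) z.
Proof.
elim: n F => [|n IH] F HF.
  rewrite (_ : (fun _ => _) = (fun=> 0)); first exact: cderivable_cst.
  by apply/funext => u; rewrite big_ord0.
rewrite (_ : (fun _ => _) = (fun u => F ord0 u + \sum_(i < n) F (lift ord0 i) u)).
  by apply: cderivableD => //; exact: IH.
by apply/funext => u; rewrite big_ord_recl.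
Qed.

Lemma vanishes_sum (n : nat) (c : 'I_n -> R[i]) (F : 'I_n -> R[i] -> R[i]) :
  (forall i, vanishes_at_im_infty (F i)) ->
  vanishes_at_im_infty (fun u => \sum_(i < n) c i * F i u).
Proof.
elim: n c F => [|n IH] c F HF e e0.
  by exists 0 => z _ _; rewrite big_ord0 Normc.normc0 ltW.
have c0 : 0 < 1 + normc (c ord0) by rewrite ltr_pwDl// normc_ge0.
have [|A1 H1] := HF ord0 (e / 2 / (1 + normc (c ord0))); first by rewrite !divr_gt0.
have [|A2 H2] := IH (fun i => c (lift ord0 i)) (fun i => F (lift ord0 i)) (fun i => HF _) (e / 2).
  by rewrite divr_gt0.
exists (Num.max A1 A2) => z Hz; rewrite ge_max => /andP[/(H1 _ Hz){}H1 /(H2 _ Hz){}H2].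
rewrite big_ord_recl; apply: le_trans (normc_triangle _ _) _.
have : normc (c ord0 * F ord0 z) <= e / 2.
  rewrite Normc.normcM; move: H1; rewrite ler_pdivlMr// => H1.
  apply: le_trans H1; rewrite mulrC ler_wpM2l ?normc_ge0//; lra.
lra.
Qed.

Lemma cusp_form2_sum (G : set 'M[int]_2) (n : nat) (c : 'I_n -> R[i]) (B : 'I_n -> R[i] -> R[i]) :
  (forall i, cusp_form2 G (B i)) ->
  cusp_form2 G (fun u => \sum_(i < n) c i * B i u).
Proof.
move=> cB; have sE g z : slash2 (fun u => \sum_(i < n) c i * B i u) g z =
    \sum_(i < n) c i * slash2 (B i) g z.
  by rewrite /slash2 mulr_sumr; apply: eq_bigr => i _; rewrite mulrCA.
split.
- move=> z Hz; apply: cderivable_sum => i.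
  by apply: cderivableM; [exact: cderivable_cst|case: (cB i) => hB _ _; exact: hB].
- move=> g Gg z Hz; rewrite sE; apply: eq_bigr => i _.
  by case: (cB i) => _ iB _; rewrite iB.
- move=> g Sg; rewrite (_ : slash2 _ g = fun z => \sum_(i < n) c i * slash2 (B i) g z).
    by apply: vanishes_sum => i; case: (cB i) => _ _; exact.
  by apply/funext => z; exact: sE.
Qed.

Let ReD (x y : R[i]) : complex.Re (x + y) = complex.Re x + complex.Re y.
Proof. by case: x; case: y. Qed.

Let Re_mul (x y : R[i]) :
  complex.Re (x * y) = complex.Re x * complex.Re y - complex.Im x * complex.Im y.
Proof. by case: x; case: y. Qed.

Let Re_sum I (r : seq I) (F : I -> R[i]) :
  complex.Re (\sum_(i <- r) F i) = \sum_(i <- r) complex.Re (F i).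
Proof. exact: (big_morph _ ReD). Qed.

Let conj_sum I (r : seq I) (F : I -> R[i]) :
  (\sum_(i <- r) F i)^*%C = \sum_(i <- r) (F i)^*%C.
Proof.
apply: (big_morph (fun x : R[i] => x^*%C)); last by rewrite /= oppr0.
by case=> a b [c d] /=; rewrite addcE opprD.
Qed.

Let conj_mul (x y : R[i]) : (x * y)^*%C = x^*%C * y^*%C.
Proof. by case: x => a b; case: y => c d; rewrite mulcE/= mulcE; congr (_ +i* _); ring. Qed.

Let normcJ2 (x : R[i]) : normc x ^+ 2 = complex.Re (x * x^*%C).
Proof. by rewrite normcE2; case: x => a b /=; ring. Qed.

Section basis.
Variables (D : set (mR * mR)).
Hypotheses (mD : measurable D) (Dpos : forall p : mR * mR, D p -> 0 < p.2).
Local Notation mu2 := (mu \x mu)%E.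

Let uu f1 f2 (p : mR * mR) : R := complex.Re (f1 (p.1 +i* p.2) * (f2 (p.1 +i* p.2))^*%C).
Let vv f1 f2 (p : mR * mR) : R := complex.Im (f1 (p.1 +i* p.2) * (f2 (p.1 +i* p.2))^*%C).

(** In weight 2 the factor [y^2] cancels the density of the hyperbolic measure, leaving the plain
    L^2 product for [dx dy]. *)
Let petersson_uv f1 f2 :
  petersson D f1 f2 = (Rintegral mu2 D (uu f1 f2)) +i* (Rintegral mu2 D (vv f1 f2)).
Proof.
rewrite /petersson /hyperbolic_integral.
have key (X : R[i]) (t : R) : 0 < t ->
    complex.Re (X * (t ^+ 2)%:C) / t ^+ 2 = complex.Re X /\
    complex.Im (X * (t ^+ 2)%:C) / t ^+ 2 = complex.Im X.
  by move=> t0; case: X => a b /=; split; field; rewrite gt_eqF.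
by congr (_ +i* _); apply: eq_Rintegral => p /set_mem/Dpos p0 /=;
  case: (key (f1 (p.1 +i* p.2) * (f2 (p.1 +i* p.2))^*%C) _ p0).
Qed.

Let measurable_ReIm f : holomorphic_on_upper_half f ->
  measurable_fun D (fun p : mR * mR => complex.Re (f (p.1 +i* p.2))) /\
  measurable_fun D (fun p : mR * mR => complex.Im (f (p.1 +i* p.2))).
Proof.
move=> hf; split.
  apply: (@eq_measurable_fun _ _ _ _ _
    (fun p : mR * mR => if 0 < p.2 then complex.Re (f (p.1 +i* p.2)) else 0)).
    by move=> p /set_mem/Dpos ->.
  apply: measurable_funTS; apply: (@measurable_separately_continuous _ (fun x y => complex.Re (f (x +i* y)))).
    by move=> x y y0; case: (@holo_contRe _ f x y (hf (x +i* y) y0)).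
  by move=> x y y0; case: (@holo_contIm _ f x y (hf (x +i* y) y0)).
apply: (@eq_measurable_fun _ _ _ _ _
  (fun p : mR * mR => if 0 < p.2 then complex.Im (f (p.1 +i* p.2)) else 0)).
  by move=> p /set_mem/Dpos ->.
apply: measurable_funTS; apply: (@measurable_separately_continuous _ (fun x y => complex.Im (f (x +i* y)))).
  by move=> x y y0; case: (@holo_contRe _ f x y (hf (x +i* y) y0)).
by move=> x y y0; case: (@holo_contIm _ f x y (hf (x +i* y) y0)).
Qed.

Let measurable_uv f1 f2 : holomorphic_on_upper_half f1 -> holomorphic_on_upper_half f2 ->
  measurable_fun D (uu f1 f2) /\ measurable_fun D (vv f1 f2).
Proof.
move=> /measurable_ReIm[r1 i1] /measurable_ReIm[r2 i2]; split.
  rewrite (_ : uu _ _ = (fun p => complex.Re (f1 (p.1 +i* p.2)) * complex.Re (f2 (p.1 +i* p.2)) +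
     complex.Im (f1 (p.1 +i* p.2)) * complex.Im (f2 (p.1 +i* p.2)))).
    by apply: measurable_funD; exact: measurable_funM.
  by apply/funext => p; rewrite /uu Re_mul; case: (f2 _) => a b /=; ring.
rewrite (_ : vv _ _ = (fun p => complex.Im (f1 (p.1 +i* p.2)) * complex.Re (f2 (p.1 +i* p.2)) -
   complex.Re (f1 (p.1 +i* p.2)) * complex.Im (f2 (p.1 +i* p.2)))).
  by apply: measurable_funB; exact: measurable_funM.
by apply/funext => p; rewrite /vv; case: (f1 _) => a b; case: (f2 _) => c d /=; ring.
Qed.

Let uuE f (p : mR * mR) : uu f f p = normsq f p.1 p.2.
Proof. by rewrite /normsq normcJ2. Qed.

(** [Rintegral] sends an infinite integral to 0, so the value 1 proves that the integral is
    finite. *)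
Lemma petersson_norm2 f : holomorphic_on_upper_half f -> petersson D f f = 1 ->
  norm2 D f = 1%:E.
Proof.
move=> hf; rewrite petersson_uv => -[] + _; rewrite /Rintegral.
under eq_integral do rewrite uuE.
rewrite -/(norm2 D f); have := norm2_ge0 D f; case: (norm2 D f) => //= [r _ ->//|_ /eqP].
by rewrite eq_sym oner_eq0.
Qed.

Variables (n : nat) (B : 'I_n -> R[i] -> R[i]).
Hypotheses (hB : forall i, holomorphic_on_upper_half (B i))
  (oB : forall i j, petersson D (B i) (B j) = (i == j)%:R).

Let integrable_normsq i : mu2.-integrable D (fun p => (normsq (B i) p.1 p.2)%:E).
Proof.
apply/integrableP; split.
  apply/measurable_EFinP; have [+ _] := measurable_uv (@hB i) (@hB i).
  by congr measurable_fun; apply/funext => p; rewrite uuE.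
under eq_integral do rewrite abse_EFin ger0_norm ?sqr_ge0//.
by rewrite -/(norm2 D (B i)) petersson_norm2// ?oB ?eqxx// ltry.
Qed.

(** The products are dominated by [|B_i|^2 + |B_j|^2], integrable by the normalization; this makes
    the orthogonality relations statements about genuine integrals. *)
Let integrable_uv i j : mu2.-integrable D (EFin \o uu (B i) (B j)) /\
  mu2.-integrable D (EFin \o vv (B i) (B j)).
Proof.
have [mu_ mv_] := measurable_uv (@hB i) (@hB j).
have int2 : mu2.-integrable D (fun p => (normsq (B i) p.1 p.2)%:E + (normsq (B j) p.1 p.2)%:E)%E.
  exact: integrableD.
have bound (p : mR * mR) : `|uu (B i) (B j) p| <= normsq (B i) p.1 p.2 + normsq (B j) p.1 p.2 /\
    `|vv (B i) (B j) p| <= normsq (B i) p.1 p.2 + normsq (B j) p.1 p.2.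
  rewrite /uu /vv /normsq !normcE2; case: (B i _) => a b; case: (B j _) => c d /=.
  rewrite !ler_norml.
  have := sqr_ge0 (a - c); have := sqr_ge0 (a + c); have := sqr_ge0 (b - d).
  have := sqr_ge0 (b + d); have := sqr_ge0 (a - d); have := sqr_ge0 (a + d).
  have := sqr_ge0 (b - c); have := sqr_ge0 (b + c).
  by move=> *; split; apply/andP; split; nra.
split; apply: (le_integrable _ _ _ int2) => //; try exact/measurable_EFinP.
  by move=> p _ /=; rewrite lee_fin (le_trans (proj1 (bound p)))// ler_norm.
by move=> p _ /=; rewrite lee_fin (le_trans (proj2 (bound p)))// ler_norm.
Qed.

(** Parseval's identity. The double sum is taken over pairs of indices, each term being split by
    [gg] because the Petersson product is given through two real integrals. *)
Lemma norm2_orthonormal (c : 'I_n -> R[i]) :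
  norm2 D (fun u => \sum_(i < n) c i * B i u) = (\sum_(i < n) normc (c i) ^+ 2)%:E.
Proof.
pose gg (k : 'I_n * 'I_n) (p : mR * mR) : R :=
  complex.Re (c k.1 * (c k.2)^*%C) * uu (B k.1) (B k.2) p -
  complex.Im (c k.1 * (c k.2)^*%C) * vv (B k.1) (B k.2) p.
have ig k : mu2.-integrable D (EFin \o gg k).
  have [iu iv] := integrable_uv k.1 k.2.
  rewrite (_ : _ \o _ = (fun p => (complex.Re (c k.1 * (c k.2)^*%C))%:E * (EFin \o uu (B k.1) (B k.2)) p -
      (complex.Im (c k.1 * (c k.2)^*%C))%:E * (EFin \o vv (B k.1) (B k.2)) p)%E); last first.
    by apply/funext => p; rewrite /= -!EFinM -EFinB.
  by apply: integrableB => //; exact: integrableZl.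
have gE (p : mR * mR) : normsq (fun u => \sum_(i < n) c i * B i u) p.1 p.2 = \sum_k gg k p.
  rewrite /normsq normcJ2 conj_sum mulr_suml.
  under eq_bigr do rewrite mulr_sumr.
  rewrite pair_bigA /= Re_sum; apply: eq_bigr => k _.
  by rewrite /gg /uu /vv -Re_mul conj_mul mulrACA.
rewrite /norm2.
under eq_integral do rewrite gE -sumEFin.
rewrite (@integral_sum _ _ _ mu2 D mD _ (fun k => EFin \o gg k))//.
have iZ (t : R) (F : mR * mR -> R) : mu2.-integrable D (EFin \o F) ->
    mu2.-integrable D (EFin \o (fun p => t * F p)).
  by move=> iF; have := integrableZl mD t iF.
have RE k : (\int[mu2]_(p in D) (EFin \o gg k) p)%E =
    (complex.Re (c k.1 * (c k.2)^*%C) * (k.1 == k.2)%:R)%:E.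
  have [iu iv] := integrable_uv k.1 k.2.
  rewrite -[LHS]fineK; last exact: integrable_fin_num.
  congr (_%:E); rewrite -/(Rintegral mu2 D (gg k)) /gg.
  rewrite RintegralB//; [|exact: iZ|exact: iZ].
  rewrite !RintegralZl//.
  have := oB k.1 k.2; rewrite petersson_uv.
  rewrite -(rmorph_nat (real_complex R)) => -[-> ->].
  by rewrite mulr0 subr0.
under eq_bigr do rewrite RE.
rewrite sumEFin; congr (_%:E).
rewrite -(pair_bigA _ (fun i j => complex.Re (c i * (c j)^*%C) * (i == j)%:R))/=.
apply: eq_bigr => i _; rewrite (bigD1 i)//= eqxx mulr1 big1 ?addr0 ?normcJ2//.
by move=> j ji; rewrite eq_sym (negbTE ji) mulr0.
Qed.

End basis.

(** There is no cusp form of weight 2 and level 1: between the heights [y] and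
    [y / 2], [periodic_decay] makes [sup y |f|] contract by the factor 10/11. *)
Lemma level_one_vanish f (K : R) : cusp_form2 SL2Z f ->
  (forall z, upper_half z -> complex.Im z * normc (f z) <= K) ->
  forall z, upper_half z -> normc (f z) = 0.
Proof.
move=> cf fK; have [hf fG vf] := cf.
pose A := [set complex.Im z * normc (f z) | z in @upper_half R].
have Hi : upper_half (0 +i* 1 : R[i]) by rewrite /upper_half/=.
have A0 : A !=set0 by exists (complex.Im (0 +i* 1 : R[i]) * normc (f (0 +i* 1))), (0 +i* 1).
have ubA : has_ubound A by exists K => _ [z Hz <-]; exact: fK.
pose s := sup A.
have As z : upper_half z -> complex.Im z * normc (f z) <= s.
  by move=> Hz; apply: ub_le_sup => //; exists z.
suff sle : s <= 10 / 11 * s.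
  move=> z Hz; apply/eqP; rewrite eq_le normc_ge0 andbT.
  have := As z Hz; have z0 : 0 < complex.Im z by [].
  rewrite -(pmulr_rle0 _ z0); lra.
have s0 : 0 <= s by apply: le_trans (As _ Hi); rewrite mulr_ge0 ?normc_ge0 ?ler01.
apply: ge_sup => // _ [z Hz <-].
have [g Sg yg] := SL2Z_reduction Hz.
have Hz0 : upper_half (moebius g z) by exact: moebius_upper.
have := slash2_norm f Sg Hz; rewrite fG// => ->.
case: (moebius g z) Hz0 yg => x y; rewrite /upper_half/= => y0 y45.
have y20 : 0 < y / 2 by lra.
have y2y : y / 2 < y by lra.
have hF x' y' : 0 < y' -> cderivable f (x' +i* y') by move=> ?; exact: hf.
have pF (x' y' : R) : 0 < y' -> f ((x' + 1) +i* y') = f (x' +i* y').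
  move=> y'0; have := fG _ (SL2Z_transl 1) (x' +i* y') y'0.
  by rewrite slash2_transl addc_int.
have v1 : vanishes_at_im_infty f.
  move=> e e0; have [A' HA'] := vf _ SL2Z1 e e0; exists A' => z' Hz' Az'.
  by have := HA' z' Hz' Az'; rewrite fG//; exact: SL2Z1.
have line x' : normc (f (x' +i* (y / 2))) <= s / (y / 2).
  by rewrite ler_pdivlMr// mulrC; exact: (As (x' +i* (y / 2)) y20).
have := periodic_decay x ltr01 y20 y2y hF pF v1 line.
set n := normc _; have n0 : 0 <= n by exact: normc_ge0.
rewrite (_ : 2 * pi / 1 * (y - y / 2) = pi * y); last by field.
set dl := expR _ => dec.
have dl0 : 0 < dl by exact: expR_gt0.
(* [y >= 4/5] and [pi >= 2] give [pi * y >= 8/5], and [(6/5)^8 > 21/5]. Hence [1 - 2 dl >= 11/21],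
   and the factor 10/11 is [2 * (5/21) / (11/21)]. *)
have dlt : dl * (21 / 5) <= 1.
  rewrite /dl expRN mulrC ler_pdivrMr ?expR_gt0// mul1r.
  apply: (@le_trans _ _ (expR (8%:R * (1 / 5)))); last first.
    by rewrite ler_expR; have := pi_ge2 R; nra.
  rewrite expRM_natl.
  have e5 : 6 / 5 <= expR (1 / 5) :> R by apply: le_trans (expR_ge1Dx _); lra.
  apply: (@le_trans _ _ ((6 / 5) ^+ 8)); last by rewrite lerXn2r ?nnegrE ?expR_ge0//; lra.
  lra.
have : n * (1 - 2 * dl) * (y / 2) <= dl * s.
  by move: dec; rewrite mulrA ler_pdivlMr.
move=> {}dec; have yn0 : 0 <= y * n by rewrite mulr_ge0// ltW.
have d1 : dl <= 5 / 21 by lra.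
have t1 : (y * n) * (11 / 21) <= (y * n) * (1 - 2 * dl) by rewrite ler_wpM2l//; lra.
have t2 : dl * s <= 5 / 21 * s by rewrite ler_wpM2r.
lra.
Qed.

End Duality.

Lemma sup_bound (R : realType) : exists2 K : R, 0 < K &
  forall G D f, congruence_subgroup G -> fundamental_domain G D -> cusp_form2 G f ->
  forall I : R, norm2 D f = I%:E -> forall z, upper_half z ->
  (complex.Im z * Normc.normc (f z)) ^+ 2 <= K * I.
Proof.
exists 6144; first by rewrite ltr0n.
by move=> G D f CG FD cf I fI z Hz; exact: (sup_bound_fin CG FD cf fI Hz).
Qed.

Theorem theorem10p5 (R : realType) :
  exists C : R,
    forall (q : nat) (G : set 'M[int]_2),
      congruence_subgroup G -> is_level G q -> G `<=` Gamma0 q ->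
      forall D : set (measurableTypeR R * measurableTypeR R),
        fundamental_domain G D ->
        forall (n : nat) (B : 'I_n -> R[i] -> R[i]),
          orthonormal_basis G D B ->
          (sup_S2 B <= (C * ln (q%:R : R))%:E)%E.
Proof.
have [K K0 sup_bound] := @sup_bound R.
exists (K / ln 2) => q G CG [q0 qG _] _ D FD n B [cB oB _].
have [mD Dup _] := FD.
have Dpos p : D p -> 0 < p.2 by move=> /Dup.
have hB i : holomorphic_on_upper_half (B i) by case: (cB i).
have ln2 : 0 < ln 2 :> R by rewrite ln_gt0// ltr1n.
apply: ge_ereal_sup => _ [z Hz <-]; rewrite lee_fin.
have [q1|q1] := leqP q 1.
  have {}q1 : q = 1%N by apply/eqP; rewrite eqn_leq q1.
  (* Modulo 1 every matrix is congruent to the identity, so the principal subgroup of level 1 is all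
     of SL_2(Z). *)
  have GE : G = SL2Z.
    apply/seteqP; split; first by case: CG => -[].
    by move=> g Sg; apply: qG; split => // i j; rewrite q1 !modz1.
  rewrite q1 ln1 mulr0 big1// => i _.
  suff -> : Normc.normc (B i z) = 0 by rewrite expr0n/= mulr0.
  have cBi := cB i; have oBi := oB i i; rewrite eqxx in oBi.
  have nB := petersson_norm2 Dpos (hB i) oBi.
  rewrite GE in CG FD cBi.
  (* The bound for a form of norm 1 supplies the finite supremum that the contraction needs. *)
  apply: (@level_one_vanish _ _ (Num.sqrt K) cBi) => // z' Hz'.
  have := sup_bound _ _ _ CG FD cBi _ nB _ Hz'; rewrite mulr1 => sq.
  rewrite -ler_sqr ?nnegrE ?sqrtr_ge0 ?mulr_ge0 ?normc_ge0 ?(ltW Hz')//.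
  by rewrite sqr_sqrtr ?(ltW K0).
pose S : R := \sum_(i < n) Normc.normc (B i z) ^+ 2.
have S0 : 0 <= S by apply: sumr_ge0 => i _; exact: sqr_ge0.
apply: (@le_trans _ _ K); last first.
  rewrite mulrAC ler_pdivlMr// ler_pM2l// ler_ln ?posrE ?ltr0n// ler_nat//.
(* The coefficients of the reproducing kernel at [z]: the resulting form has squared norm [S] and
   value [S] at [z], so its bound reads [y^2 S^2 <= K S]. *)
pose c i := (B i z)^*%C.
have nc i : Normc.normc (c i) = Normc.normc (B i z).
  by rewrite /c; case: (B i z) => a b /=; rewrite sqrrN.
have cf : cusp_form2 G (fun u => \sum_(i < n) c i * B i u) by exact: cusp_form2_sum.
have nf : norm2 D (fun u => \sum_(i < n) c i * B i u) = S%:E.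
  by rewrite norm2_orthonormal//; congr (_%:E); apply: eq_bigr => i _; rewrite nc.
have := sup_bound _ _ _ CG FD cf _ nf _ Hz.
have -> : \sum_(i < n) c i * B i z = S%:C.
  rewrite /S (rmorph_sum (real_complex R))/=; apply: eq_bigr => i _.
  rewrite normcE2 /c; case: (B i z) => a b; rewrite /= mulcE.
  by congr (_ +i* _); ring.
rewrite normc_real ger0_norm// -mulr_sumr -/S => H.
have [->|Sn0] := eqVneq S 0; first by rewrite mulr0 ltW.
have Sp : 0 < S by rewrite lt_neqAle eq_sym Sn0.
by rewrite -(ler_pM2r Sp); apply: le_trans H; rewrite exprMn -mulrA -expr2.
Qed.
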